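(* Let $k\in\mathbb Z_{>0}$ and $1+\frac1n<p<1+\frac{k+1}{kn}$ (so that $\sigma\in(0,\frac{1}{2k})$). Let $u_0\in L^1_1(\mathbb R^n)\cap L^\infty(\mathbb R^n)$ and let $u$ be the global solution of the convection-diffusion problem with initial datum $u_0$. Then for every $q\in[1,\infty]$ there exists $C>0$ such that for all $t>2^k$, $$t^{\frac n2(1-\frac1q)}\|u(t)-\mathcal A_{0,k}(t)\|_q\le\begin{cases}Ct^{-(k+1)\sigma}&\text{if }(k+1)\sigma<\frac12,\\ Ct^{-\frac12}\log(2+t)&\text{if }(k+1)\sigma=\frac12,\\ Ct^{-\frac12}&\text{if }(k+1)\sigma>\frac12.\end{cases}$$
   Context: Let $n\ge1$, $a=(a_1,\dots,a_n)\in\mathbb R^n\setminus\{0\}$, $p\in(1,\infty)$, and let $f\in C^1(\mathbb R)$, $f\not\equiv0$, $f(0)=0$, satisfy $|f(\xi)-f(\eta)|\le C(|\xi|^{p-1}+|\eta|^{p-1})|\xi-\eta|$ for all $\xi,\eta\in\mathbb R$. $\|\cdot\|_q$ is the $L^q(\mathbb R^n)$ norm; $L^1_1(\mathbb R^n)=\{\varphi\in L^1(\mathbb R^n): x_j\varphi\in L^1 \text{ for } j=1,\dots,n\}$. $G_t(x)=(4\pi t)^{-n/2}e^{-|x|^2/(4t)}$, $e^{t\Delta}\varphi=G_t*\varphi$ for $t>0$, $e^{0\Delta}\varphi=\varphi$. For $u_0\in L^1\cap L^\infty$, the global solution of $\partial_tu-\Delta u=a\cdot\nabla f(u)$, $u(0)=u_0$,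 is the unique $u\in (C\cap L^\infty)([0,\infty);L^1(\mathbb R^n))\cap(C\cap L^\infty)((0,\infty);L^\infty(\mathbb R^n))$ with $u(t)=e^{t\Delta}u_0+\int_0^ta\cdot\nabla e^{(t-s)\Delta}f(u(s))\,ds$ in $L^1\cap L^\infty$ for all $t>0$ (it exists and satisfies $\sup_{q\in[1,\infty]}\sup_{t>0}t^{\frac n2(1-\frac1q)}\|u(t)\|_q\le C\|u_0\|_1$). Dilation: $(\delta_t\varphi)(x)=t^{-n/2}\varphi(t^{-1/2}x)$. $\mathcal M_0(\varphi)=\int_{\mathbb R^n}\varphi\,dx$. $\mathcal A_0(t)=\mathcal M_0(u_0)\delta_tG_1=\mathcal M_0(u_0)G_t$. $\sigma=\frac n2(p-1)-\frac12$. Profiles: $\mathcal A_{0,0}=\mathcal A_0$ and for $k\ge1$, $\mathcal A_{0,k}(t)=\mathcal A_0(t)+\int_0^1a\cdot\nabla e^{(t-s)\Delta}f(\mathcal A_0(s))ds+\int_1^ta\cdot\nabla e^{(t-s)\Delta}f(\mathcal A_{0,k-1}(s))ds$. *)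

(* Defs.v *)
From HB Require Import structures.
From mathcomp Require Import all_boot all_order all_algebra.
From mathcomp Require Import all_classical all_reals all_analysis.

Set Implicit Arguments.
Unset Strict Implicit.
Unset Printing Implicit Defensive.

Import Order.TTheory GRing.Theory Num.Theory.
Import numFieldNormedType.Exports.
Local Open Scope classical_set_scope.
Local Open Scope ring_scope.

(* Lebesgue integral over R^n of an extended-real valued function,
   computed as the iterated one-dimensional Lebesgue integral
   (first coordinate outermost).  For nonnegative Borel functions this is
   the integral w.r.t. n-dimensional Lebesgue measure (Tonelli), and for
   integrable Borel functions as well (Fubini). *)
Fixpoint iint {R : realType} (n : nat) : ('rV[R]_n -> \bar R) -> \bar R :=
  match n return ('rV[R]_n -> \bar R) -> \bar R with
  | 0 => fun f => f 0
  | m.+1 => fun f =>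
      (\int[@lebesgue_measure R]_x
         iint (fun y : 'rV[R]_m => f (row_mx (const_mx x : 'rV[R]_1) y)))%E
  end.

Definition rint {R : realType} (n : nat) (f : 'rV[R]_n -> R) : R :=
  fine (iint (fun x => (f x)%:E)).

Definition borel_set {R : realType} (n : nat) (A : set 'rV[R]_n) : Prop :=
  <<s [set U : set 'rV[R]_n | open U] >> A.

Definition borel_fun {R : realType} (n : nat) (f : 'rV[R]_n -> R) : Prop :=
  forall B : set R, measurable B -> borel_set (f @^-1` B).

Definition lmeas {R : realType} (n : nat) (A : set 'rV[R]_n) : \bar R :=
  iint (fun x => (\1_A x)%:E).

Definition esssup_abs {R : realType} (n : nat) (f : 'rV[R]_n -> R) : \bar R :=
  ereal_inf [set M : \bar R | (0 <= M)%E /\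
                lmeas [set x | (M < (`|f x|)%:E)%E] = 0%E].

Definition Lq_norm {R : realType} (n : nat) (q : \bar R)
  (f : 'rV[R]_n -> R) : \bar R :=
  match q with
  | r%:E => poweR (iint (fun x => (powR `|f x| r)%:E)) r^-1
  | +oo%E => esssup_abs f
  | -oo%E => 0%E
  end.

Definition inv_exp {R : realType} (q : \bar R) : R :=
  match q with r%:E => r^-1 | _ => 0 end.

Definition in_Lq {R : realType} (n : nat) (q : \bar R)
  (f : 'rV[R]_n -> R) : Prop :=
  borel_fun f /\ (Lq_norm q f < +oo)%E.

Definition in_L11 {R : realType} (n : nat) (f : 'rV[R]_n -> R) : Prop :=
  in_Lq 1%E f /\ forall j : 'I_n, in_Lq 1%E (fun x => x ord0 j * f x).

Definition sqnorm {R : realType} (n : nat) (x : 'rV[R]_n) : R :=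
  \sum_(j < n) (x ord0 j) ^+ 2.

Definition gauss {R : realType} (n : nat) (t : R) (x : 'rV[R]_n) : R :=
  powR (4 * pi * t) (- (n%:R / 2)) * expR (- sqnorm x / (4 * t)).

Definition heat {R : realType} (n : nat) (t : R) (phi : 'rV[R]_n -> R) :
  'rV[R]_n -> R :=
  if t == 0 then phi else fun x => rint (fun y => gauss t (x - y) * phi y).

Definition duhamel {R : realType} (n : nat) (a : 'rV[R]_n) (f : R -> R)
  (v : R -> 'rV[R]_n -> R) (t0 t1 t : R) (x : 'rV[R]_n) : R :=
  fine (\int[@lebesgue_measure R]_(s in `[t0, t1])
          ('D_a (heat (t - s) (f \o v s)) x)%:E)%E.

Definition ae_eq {R : realType} (n : nat) (f g : 'rV[R]_n -> R) : Prop :=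
  lmeas [set x | f x != g x] = 0%E.

(* The global solution of  d_t u - Delta u = a . grad f(u), u(0) = u0,
   in the class (C cap L^oo)([0,oo); L^1) cap (C cap L^oo)((0,oo); L^oo),
   satisfying the Duhamel formula in L^1 cap L^oo for every t > 0. *)
Definition global_solution {R : realType} (n : nat) (a : 'rV[R]_n)
  (f : R -> R) (u0 : 'rV[R]_n -> R) (u : R -> 'rV[R]_n -> R) : Prop :=
      (forall t, 0 <= t -> in_Lq 1%E (u t)) /\
      (forall t, 0 < t -> in_Lq +oo%E (u t)) /\
      Lq_norm 1%E (u 0 \- u0) = 0%E /\
      (forall t0, 0 <= t0 -> forall e : R, 0 < e -> exists2 d : R, 0 < d &
         forall t, 0 <= t -> `|t - t0| < d ->
           (Lq_norm 1%E ((u t \- u t0)%R) < e%:E)%E) /\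
      (exists M : R, forall t, 0 <= t -> (Lq_norm 1%E (u t) <= M%:E)%E) /\
      (forall t0, 0 < t0 -> forall e : R, 0 < e -> exists2 d : R, 0 < d &
         forall t, 0 < t -> `|t - t0| < d ->
           (Lq_norm +oo%E ((u t \- u t0)%R) < e%:E)%E) /\
      (exists M : R, forall t, 0 < t -> (Lq_norm +oo%E (u t) <= M%:E)%E) /\
      (forall t, 0 < t ->
         ae_eq (u t) (heat t u0 \+ duhamel a f u 0 t t)).

Definition mass {R : realType} (n : nat) (phi : 'rV[R]_n -> R) : R := rint phi.

Definition A0 {R : realType} (n : nat) (u0 : 'rV[R]_n -> R) (t : R) :
  'rV[R]_n -> R := fun x => mass u0 * gauss t x.

Fixpoint A0k {R : realType} (n : nat) (a : 'rV[R]_n) (f : R -> R)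
  (u0 : 'rV[R]_n -> R) (k : nat) : R -> 'rV[R]_n -> R :=
  match k with
  | 0 => A0 u0
  | k'.+1 => fun t x =>
      A0 u0 t x + duhamel a f (A0 u0) 0 1 t x
                + duhamel a f (A0k a f u0 k') 1 t t x
  end.

Definition sigma_exp {R : realType} (n : nat) (p : R) : R :=
  n%:R / 2 * (p - 1) - 2^-1.

(* Main.v *)
(* The solution decays like t^(-n/2) in sup norm. For w = e^(h Delta) v the integral of
   f(w) a.grad w vanishes, so up to a small regularization error the nonlinearity does not
   contribute to the L^2 balance, and the heat flow makes the L^2 norm, hence the sup norm,
   arbitrarily small at some time. From that time on |f(z)| <= C |z|^p with p > 1 + 1/n
   turns the Duhamel term into a small perturbation of the heat semigroup.

   The finite first moment gives e^(t Delta) u0 = M_0 G_t + O(t^(-1/2)), and the part over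
   (0, 1) of the Duhamel integral is O(t^(-1/2)) too. If u - A_{0,j} = O(t^(-gamma)), then
   f(u) - f(A_{0,j}) = O(s^(-1/2 - sigma - gamma)), and integrating against (t - s)^(-1/2)
   over (1, t) gains the factor t^(-sigma) as long as gamma + sigma < 1/2; this is iterated
   k times. All bounds are proved in L^1 and, with the extra factor t^(-n/2), in L^oo, and
   interpolated. *)
Require Import Defs.
From HB Require Import structures.
From mathcomp Require Import all_boot all_order all_algebra.
From mathcomp Require Import all_classical all_reals all_analysis.
From mathcomp Require Import measurable_realfun.
From mathcomp Require Import ring lra.
Set Implicit Arguments.
Unset Strict Implicit.
Unset Printing Implicit Defensive.
Import Order.TTheory GRing.Theory Num.Theory.
Import numFieldNormedType.Exports.
Local Open Scope classical_set_scope.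
Local Open Scope ring_scope.

(** * Lebesgue measure on R^n as an iterated measure *)

(** Two obstacles shape the proof. At each time the solution is given only up to null sets in x, and
    in time only as a curve continuous in norm, while Fubini and pointwise bounds need a jointly
    measurable function. It is therefore replaced by the right-hand side U of its own Duhamel
    formula, defined at every point, and by a truncation V of U that obeys the sup bound everywhere.
    Nor is the solution known to be differentiable, so the energy balance is not differentiated in
    time but written for steps of length tau, for the energy of e^(h Delta) V. Only 1/4 - 1/8 > 0
    matters. The parameters are chosen in the order: total time, h, tau. Smallness has to precede
    decay: in |z|^(p-1) the power 1/n, applied to the decay t^(-n/2), gives the critical weight
    t^(-1/2), and only the remaining power p - 1 - 1/n, applied to the sup norm, makes the constant
    small. *)

(* The Borel sigma-algebra is the one of [borel_set]; ['rV[R]_n] itself carries no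
   measurable structure in the library. *)
Definition Rn (R : realType) (n : nat) :=
  g_sigma_algebraType [set U : set 'rV[R]_n | open U].

Section BorelRn.
Context {R : realType}.

Lemma borel_funP n (f : 'rV[R]_n -> R) :
  borel_fun f <-> measurable_fun [set: Rn R n] f.
Proof.
split=> [bf _ B mB|mf B mB]; first by rewrite setTI; exact: bf.
by rewrite -[_ @^-1` _]setTI; exact: mf.
Qed.

Lemma measurable_coord n (i : 'I_n) :
  measurable_fun [set: Rn R n] (fun x : 'rV[R]_n => x ord0 i).
Proof.
apply: (measurability _ (RGenOpens.measurableE R)).
move=> _ [_ [a [b ->]] <-]; rewrite setTI.
apply: sub_sigma_algebra.
have /continuousP cf : continuous (fun x : 'rV[R]_n => x ord0 i).
  by move=> x; exact: coord_continuous.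
exact/cf/interval_open.
Qed.

(** An open set is the union of the rational boxes inside it, of which there are countably many, and
    the preimage of a box is a finite intersection of preimages under coordinates. *)
Lemma measurable_to_Rn d (T : measurableType d) n (h : T -> Rn R n) :
  (forall i, measurable_fun setT (fun t => (h t : 'rV[R]_n) ord0 i)) ->
  measurable_fun setT h.
Proof.
move=> mh; refine (@measurability _ _ T (Rn R n) setT h [set U : set 'rV[R]_n | open U] _ _) =>
  //.
move=> _ [U oU <-]; rewrite setTI.
pose box (q : 'rV[rat]_n * rat) : set 'rV[R]_n :=
  [set x | forall i, `|x ord0 i - ratr (q.1 ord0 i)| < ratr q.2].
have -> : U = \bigcup_(q in [set q | box q `<=` U]) box q.
  apply/seteqP; split=> [x Ux|x [q qU]]; last exact: qU.
  have /nbhs_ballP[e e0 xeU] : nbhs x U by exact: open_nbhs_nbhs.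
  have [r /[!in_itv]/= /andP[r0 re]] := rat_in_itvoo (divr_gt0 e0 (ltr0Sn R 1)).
  have [q qP] : exists q : 'rV[rat]_n, forall i, `|x ord0 i - ratr (q ord0 i)| < ratr r.
    have /choice[q qP] : forall i, exists q : rat, `|x ord0 i - ratr q| < ratr r.
      move=> i; have [q /[!in_itv]/= /andP[q1 q2]] :=
        @rat_in_itvoo R (x ord0 i - ratr r) (x ord0 i + ratr r) ltac:(lra).
      by exists q; rewrite ltr_norml; lra.
    by exists (\row_i q i) => i; rewrite mxE.
  exists (q, r) => //= y yq; apply: xeU; split=> // i j.
  rewrite (ord1 i) -ball_normE /=; have := yq j; have := qP j => /=.
  by rewrite !ltr_norml => /andP[? ?] /andP[? ?]; apply/andP; split; lra.
rewrite preimage_bigcup bigcup_mkcond.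
apply: countable_bigcupT_measurable => [|q]; first exact: countableP.
case: ifPn => // _.
have -> : h @^-1` box q = \bigcap_(i : 'I_n)
   ((fun t => (h t : 'rV[R]_n) ord0 i) @^-1`
     [set z | `|z - ratr (q.1 ord0 i)| < ratr q.2]).
  by apply/seteqP; split => t /= tq i *; exact: tq.
apply: fin_bigcap_measurable => [|i _]; first exact: finite_finset.
rewrite -[_ @^-1` _]setTI; apply: mh => //.
rewrite (_ : [set z | _] = ball (ratr (q.1 ord0 i) : R) (ratr q.2)).
  exact: measurable_ball.
by apply/seteqP; split=> z /=; rewrite /ball/= distrC.
Qed.

End BorelRn.

(** The row that [iint] builds, as a map on the product space, so that the product measure can be
    pushed forward along it. *)
Definition cons_rV {R : realType} m (z : measurableTypeR R * Rn R m) : Rn R m.+1 :=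
  row_mx (const_mx z.1 : 'rV[R]_1) (z.2 : 'rV[R]_m).

Lemma cons_rV0 {R : realType} m (z : measurableTypeR R * Rn R m) :
  (cons_rV z : 'rV[R]_m.+1) ord0 ord0 = z.1.
Proof.
rewrite /cons_rV; have -> : ord0 = lshift m (ord0 : 'I_1) by exact/val_inj.
by apply: eq_trans (row_mxEl _ _ _ _) _; rewrite mxE.
Qed.

Lemma cons_rVS {R : realType} m (z : measurableTypeR R * Rn R m) (i : 'I_m) :
  (cons_rV z : 'rV[R]_m.+1) ord0 (lift ord0 i) = (z.2 : 'rV[R]_m) ord0 i.
Proof.
rewrite /cons_rV; have -> : lift ord0 i = rshift 1 i by exact/val_inj.
exact: row_mxEr.
Qed.

Lemma measurable_cons_rV {R : realType} m :
  measurable_fun setT (@cons_rV R m).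
Proof.
apply: measurable_to_Rn => i.
case: (unliftP ord0 i) => [j ->|->].
  rewrite (_ : (fun _ => _) = fun z : measurableTypeR R * Rn R m => (z.2 : 'rV[R]_m) ord0 j).
    exact: (measurableT_comp (measurable_coord j) measurable_snd).
  by apply/funext => z; exact: cons_rVS.
rewrite (_ : (fun _ => _) = fst); first exact: measurable_fst.
by apply/funext => z; exact: cons_rV0.
Qed.

Section cons_measure.
Context {R : realType} (m : nat) (mu : {sigma_finite_measure set (Rn R m) -> \bar R}).
Local Open Scope ereal_scope.


Definition cons_measure : set (Rn R m.+1) -> \bar R :=
  pushforward (lebesgue_measure \x mu) (@cons_rV R m).

Let preim_measurable A : measurable A -> measurable (@cons_rV R m @^-1` A).
Proof. move=> mA; rewrite -[X in measurable X]setTI; exact: (measurable_cons_rV measurableT). Qed.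

Let cons_measure0 : cons_measure set0 = 0.
Proof. by rewrite /cons_measure /pushforward preimage_set0 measure0. Qed.

Let cons_measure_ge0 A : 0 <= cons_measure A.
Proof. by rewrite /cons_measure /pushforward; exact: measure_ge0. Qed.

Let cons_measure_sigma_additive : semi_sigma_additive cons_measure.
Proof.
move=> F mF tF mUF; rewrite /cons_measure /pushforward preimage_bigcup.
apply: measure_semi_sigma_additive.
- by move=> k; exact: preim_measurable.
- apply/trivIsetP => /= i j _ _ ij; rewrite -preimage_setI.
  by move/trivIsetP : tF => /(_ _ _ _ _ ij) ->//; rewrite preimage_set0.
- by rewrite -preimage_bigcup; exact: preim_measurable.
Qed.

HB.instance Definition _ := isMeasure.Build _ _ _ cons_measure
  cons_measure0 cons_measure_ge0 cons_measure_sigma_additive.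

Let uncons_rV (x : Rn R m.+1) : measurableTypeR R * Rn R m :=
  ((x : 'rV[R]_m.+1) ord0 ord0, \row_i (x : 'rV[R]_m.+1) ord0 (lift ord0 i)).

Let cons_rVK : cancel (@cons_rV R m) uncons_rV.
Proof.
move=> z; rewrite /uncons_rV cons_rV0 [RHS]surjective_pairing; congr pair.
by apply/rowP => i; rewrite mxE cons_rVS.
Qed.

Let measurable_uncons_rV : measurable_fun setT uncons_rV.
Proof.
apply: measurable_fun_pair; first exact: measurable_coord.
apply: measurable_to_Rn => i; rewrite (_ : (fun _ => _) =
  fun x : Rn R m.+1 => (x : 'rV[R]_m.+1) ord0 (lift ord0 i)).
  exact: measurable_coord.
by apply/funext => x; rewrite mxE.
Qed.

(** The exhausting sets are products of those of the two factors, carried over by the inverse of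
    [cons_rV]; both sequences are nondecreasing, which lets a point be captured in both factors by a
    common index. *)
Let cons_measure_sigma_finite : sigma_finite setT cons_measure.
Proof.
have /sigma_finiteP[F [TF ndF Foo]] := sigma_finiteT (@lebesgue_measure R).
have /sigma_finiteP[G [TG ndG Goo]] := sigma_finiteT mu.
exists (fun k => uncons_rV @^-1` (F k `*` G k)).
  rewrite -preimage_bigcup; apply/esym/seteqP; split=> // x _.
  have : (\bigcup_i F i) (uncons_rV x).1 by rewrite -TF.
  have : (\bigcup_i G i) (uncons_rV x).2 by rewrite -TG.
  move=> [k _ Gk] [l _ Fl]; exists (maxn k l) => //; split.
    by move: Fl; apply/subsetPset/ndF/leq_maxr.
  by move: Gk; apply/subsetPset/ndG/leq_maxl.
move=> k; have [? ?] := Foo k; have [? ?] := Goo k; split.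
  rewrite -[X in measurable X]setTI; apply: measurable_uncons_rV => //.
  exact: measurableX.
rewrite /cons_measure /pushforward -comp_preimage.
rewrite (_ : _ @^-1` _ = F k `*` G k).
  by rewrite product_measure1E// lte_mul_pinfty// ge0_fin_numE.
by apply/funext => z; apply: (congr1 (F k `*` G k)); exact: cons_rVK.
Qed.

HB.instance Definition _ := Measure_isSigmaFinite.Build _ _ _ cons_measure
  cons_measure_sigma_finite.

Lemma ge0_integral_cons (f : Rn R m.+1 -> \bar R) :
  measurable_fun setT f -> (forall x, 0 <= f x) ->
  \int[cons_measure]_x f x =
  \int[lebesgue_measure]_x \int[mu]_y f (cons_rV (x, y)).
Proof.
move=> mf f0; transitivity (\int[lebesgue_measure \x mu]_z (f (cons_rV z))).
  exact: (ge0_integral_pushforward (@measurable_cons_rV R m)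
    (lebesgue_measure \x mu) measurableT mf (fun y _ => f0 y)).
rewrite fubini_tonelli1 //.
exact: (measurableT_comp mf (@measurable_cons_rV R m)).
Qed.

End cons_measure.

(** The recursion mirrors that of [iint], so that iterated integrals can be compared with a genuine
    measure by induction on the dimension. In dimension 0 [iint] evaluates at the only point, hence
    the Dirac mass. *)
Fixpoint leb (R : realType) (n : nat) : {sigma_finite_measure set (Rn R n) -> \bar R} :=
  match n return {sigma_finite_measure set (Rn R n) -> \bar R} with
  | 0 => dirac ((0 : 'rV[R]_0) : Rn R 0)
  | m.+1 => cons_measure (leb R m)
  end.

Section iint.
Context {R : realType}.
Local Open Scope ereal_scope.

Lemma ge0_iintE n (f : Rn R n -> \bar R) : measurable_fun setT f ->
  (forall x, 0 <= f x) -> iint f = \int[leb R n]_x f x.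
Proof.
elim: n f => [|n IH] f mf f0 /=.
  by rewrite integral_dirac // diracE in_setT mul1e.
rewrite ge0_integral_cons //; apply: eq_integral => x _.
rewrite IH //.
apply: (measurableT_comp mf).
exact: (measurableT_comp (@measurable_cons_rV R n) (pair1_measurable x)).
Qed.

Lemma integrable_cons m (f : Rn R m.+1 -> \bar R) :
  (leb R m.+1).-integrable setT f ->
  (lebesgue_measure \x leb R m).-integrable setT
    (f \o @cons_rV R m).
Proof.
move=> /integrableP[mf fi].
have mfc := measurableT_comp mf (@measurable_cons_rV R m).
apply: (proj2 (@integrable12ltyP _ _ _ _ R lebesgue_measure (leb R m) _ mfc)).
move: fi; rewrite /= ge0_integral_cons //.
exact: measurableT_comp.
Qed.

(** No integrability is required: the integral of a signed function is the difference of those of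
    its positive and negative parts, and Tonelli applies to each. *)
Lemma measurable_iint d (T : measurableType d) n (f : T * Rn R n -> \bar R) :
  measurable_fun setT f ->
  measurable_fun setT (fun t => iint (fun y : 'rV[R]_n => f (t, y))).
Proof.
elim: n d T f => [|n IH] d T f mf /=.
  exact: (measurableT_comp mf (pair2_measurable _)).
have mg : measurable_fun setT (fun z : T * measurableTypeR R =>
    iint (fun y : 'rV[R]_n => f (z.1, cons_rV (z.2, y)))).
  apply: (IH _ _ (fun w => f (w.1.1, cons_rV (w.1.2, w.2)))).
  apply: (measurableT_comp mf); apply: measurable_fun_pair => /=.
    exact: (measurableT_comp measurable_fst measurable_fst).
  apply: (measurableT_comp (@measurable_cons_rV R n)).
  apply: measurable_fun_pair => /=; last exact: measurable_snd.
  exact: (measurableT_comp measurable_snd measurable_fst).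
pose g (z : T * measurableTypeR R) :=
  iint (fun y : 'rV[R]_n => f (z.1, cons_rV (z.2, y))).
rewrite (_ : (fun _ => _) = fun t =>
  \int[lebesgue_measure]_x g^\+ (t, x) - \int[lebesgue_measure]_x g^\- (t, x)).
  apply: emeasurable_funB.
    apply: (measurable_fun_fubini_tonelli_F (m2 := lebesgue_measure) g^\+) => //.
    exact: measurable_funepos.
  apply: (measurable_fun_fubini_tonelli_F (m2 := lebesgue_measure) g^\-) => //.
  exact: measurable_funeneg.
apply/funext => t; rewrite [LHS]integralE.
by congr (_ - _); apply: eq_integral => x _; rewrite ?funeposE ?funenegE.
Qed.

(** By Fubini the inner functions are integrable for almost every x only, so the induction
    hypothesis identifies the two outer integrands almost everywhere; [measurable_iint] makes this
    enough. *)
Lemma iintE n (f : Rn R n -> \bar R) : (leb R n).-integrable setT f ->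
  iint f = \int[leb R n]_x f x.
Proof.
elim: n f => [|n IH] f fi.
  have /integrableP[mf _] := fi.
  by rewrite /= integral_dirac // diracE in_setT mul1e.
have /integrableP[mf _] := fi.
have fci := integrable_cons fi.
transitivity (\int[lebesgue_measure]_x \int[leb R n]_y f (cons_rV (x, y))).
  apply: ae_eq_integral => //.
  - apply: (@measurable_iint _ (measurableTypeR R) n (f \o @cons_rV R n)).
    exact: (measurableT_comp mf (@measurable_cons_rV R n)).
  - exact: (measurable_fubini_F fci).
  - apply: filterS (ae_integrable1 fci) => x ix _.
    by rewrite -(IH (fun y => f (cons_rV (x, y)))).
rewrite (integral12_prod_meas1 fci); apply/esym.
exact: (integral_pushforward (@measurable_cons_rV R n) mf fci measurableT).
Qed.

End iint.

(** * Reflection invariance of the measure *)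

Section invariance.
Context {R : realType}.
Local Open Scope ereal_scope.

Lemma ge0_integral_leb_cons n (f : Rn R n.+1 -> \bar R) :
  measurable_fun setT f -> (forall x, 0 <= f x) ->
  \int[leb R n.+1]_x f x = \int[lebesgue_measure]_x \int[leb R n]_y f (cons_rV (x, y)).
Proof. exact: ge0_integral_cons. Qed.

(** Lebesgue measure is determined by half-open intervals, and the preimage of []a, b]] is [[c - b,
    c - a[], of the same length. *)
Lemma lebesgue_measure_reflect (c : R) (A : set R) : measurable A ->
  pushforward lebesgue_measure (fun x : measurableTypeR R => (c - x)%R : measurableTypeR R) A =
  lebesgue_measure A.
Proof.
have mf : measurable_fun [set: measurableTypeR R]
    (fun x : measurableTypeR R => (c - x)%R : measurableTypeR R).
  exact: measurable_funB.
move=> mA; apply/esym.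
apply: (@lebesgue_measure_unique R (pushforward lebesgue_measure
  (fun x : measurableTypeR R => (c - x)%R : measurableTypeR R))) => //= _ [[a b]] _ <-.
rewrite /pushforward/= (_ : _ @^-1` _ = `[(c - b)%R, (c - a)%R[%classic).
  rewrite !lebesgue_measure_itv/= !lte_fin ltrBlDr addrAC ltrBrDr.
  by rewrite ltrD2l; case: ifP => // _; rewrite -EFinB -EFinB; congr EFin; lra.
by apply/seteqP; split=> x /=; rewrite !in_itv/=; lra.
Qed.

Lemma ge0_integral_reflect1 (c : R) (f : R -> \bar R) :
  measurable_fun setT f -> (forall x, 0 <= f x) ->
  \int[lebesgue_measure]_x f (c - x)%R = \int[lebesgue_measure]_x f x.
Proof.
move=> mf f0.
have mc : measurable_fun [set: measurableTypeR R]
    (fun x : measurableTypeR R => (c - x)%R : measurableTypeR R).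
  exact: measurable_funB.
rewrite -[LHS](ge0_integral_pushforward mc lebesgue_measure measurableT mf) //.
by apply: eq_measure_integral => A mA _; exact: lebesgue_measure_reflect.
Qed.

Lemma measurable_subl n (c : 'rV[R]_n) :
  measurable_fun setT (fun y : Rn R n => (c - (y : 'rV[R]_n))%R : Rn R n).
Proof.
apply: measurable_to_Rn => i.
rewrite (_ : (fun _ => _) = fun y : Rn R n => (c ord0 i - (y : 'rV[R]_n) ord0 i)%R).
  by apply: measurable_funB => //; exact: measurable_coord.
by apply/funext => y; rewrite !mxE.
Qed.

(** Reflections are what convolutions call for, since the kernel is evaluated at x - y; a
    translation is a composition of two of them. *)
Lemma ge0_integral_reflect n (c : 'rV[R]_n) (f : Rn R n -> \bar R) :
  measurable_fun setT f -> (forall x, 0 <= f x) ->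
  \int[leb R n]_y f (c - (y : 'rV[R]_n))%R = \int[leb R n]_y f y.
Proof.
elim: n c f => [|n IH] c f mf f0.
  have m2 := measurableT_comp mf (measurable_subl c).
  rewrite /= !integral_dirac//; congr (_ * f _).
  by apply/rowP => -[].
have m2 := measurableT_comp mf (measurable_subl c).
rewrite (ge0_integral_leb_cons mf f0) (ge0_integral_leb_cons m2 (fun=> f0 _)).
pose c' : 'rV[R]_n := (\row_i c ord0 (lift ord0 i))%R.
have E x y : (c - (cons_rV (x, y) : 'rV[R]_n.+1))%R =
    cons_rV ((c ord0 ord0 - x)%R : measurableTypeR R, (c' - (y : 'rV[R]_n))%R : Rn R n).
  apply/rowP => i; case: (unliftP ord0 i) => [j ->|->].
    apply: etrans (esym (cons_rVS (_, _) j)).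
    rewrite [LHS]mxE [RHS]mxE; congr (_ + _)%R; first by rewrite mxE.
    by rewrite [LHS]mxE [RHS]mxE; congr (- _)%R; exact: (cons_rVS (x, y) j).
  apply: etrans (esym (cons_rV0 (_, _))).
  rewrite [LHS]mxE; congr (_ + _)%R.
  by rewrite [LHS]mxE; congr (- _)%R; exact: (cons_rV0 (x, y)).
have mfc := measurableT_comp mf (@measurable_cons_rV R n).
transitivity (\int[lebesgue_measure]_x \int[leb R n]_y
   f (cons_rV ((c ord0 ord0 - x)%R : measurableTypeR R, y))).
  apply: eq_integral => x _.
  transitivity (\int[leb R n]_y f (cons_rV ((c ord0 ord0 - x)%R : measurableTypeR R,
      (c' - (y : 'rV[R]_n))%R : Rn R n))).
    by apply: eq_integral => y _; congr (f _); exact: E.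
  apply: (IH c' (fun y => f (cons_rV ((c ord0 ord0 - x)%R : measurableTypeR R, y)))) => //.
  exact: (measurableT_comp mfc (pair1_measurable _)).
apply: (@ge0_integral_reflect1 _ (fun x => \int[leb R n]_y f (cons_rV (x, y)))).
  exact: (measurable_fun_fubini_tonelli_F (m2 := leb R n) (f \o @cons_rV R n) mfc (fun z => f0
    _)).
by move=> x; exact: integral_ge0.
Qed.

Lemma integral_reflect n (c : 'rV[R]_n) (f : Rn R n -> \bar R) :
  measurable_fun setT f ->
  \int[leb R n]_y f (c - (y : 'rV[R]_n))%R = \int[leb R n]_y f y.
Proof.
move=> mf; rewrite integralE [RHS]integralE; congr (_ - _).
  rewrite -(ge0_integral_reflect c (measurable_funepos mf)) //.
  by apply: eq_integral => y _; rewrite !funeposE.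
rewrite -(ge0_integral_reflect c (measurable_funeneg mf)) //.
by apply: eq_integral => y _; rewrite !funenegE.
Qed.

End invariance.

(** * Total mass of the Gaussian *)

Section gauss.
Context {R : realType}.

Lemma sqnorm_cons n (x : R) (y : 'rV[R]_n) :
  sqnorm (cons_rV (x : measurableTypeR R, y : Rn R n) : 'rV[R]_n.+1) = x ^+ 2 + sqnorm y.
Proof.
rewrite /sqnorm big_ord_recl cons_rV0; congr (_ + _).
by apply: eq_bigr => i _; rewrite cons_rVS.
Qed.

Lemma measurable_sqnorm n : measurable_fun setT (fun x : Rn R n => sqnorm (x : 'rV[R]_n)).
Proof.
apply: measurable_sum => i; apply: measurable_funX; exact: measurable_coord.
Qed.

(** Writing 1/x as x (x^2)^(-1) reduces the claim to [powR] on nonnegative reals; at 0 the factor x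
    takes care of the convention. *)
Lemma measurable_invr : measurable_fun setT (fun x : R => x^-1).
Proof.
rewrite (_ : (fun _ => _) = fun x : R => x * powR (x ^+ 2) (-1)).
  apply: measurable_funM => //.
  apply: (@measurableT_comp _ _ _ _ _ _ (@powR R ^~ (-1))); first exact: measurable_powR.
  exact: exprn_measurable.
apply/funext => x; rewrite powR_inv1 ?sqr_ge0//.
have [->|x0] := eqVneq x 0; first by rewrite mul0r invr0.
by field.
Qed.

Lemma measurable_gauss_joint n :
  measurable_fun setT (fun z : R * Rn R n => gauss z.1 (z.2 : 'rV[R]_n)).
Proof.
have m1 : measurable_fun setT (fun z : R * Rn R n => z.1) by exact: measurable_fst.
apply: measurable_funM.
  apply: (measurableT_comp (measurable_powR _)).
  exact: measurable_funM.
apply: (@measurableT_comp _ _ _ _ _ _ expR); first exact: measurable_expR.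
apply: measurable_funM.
  apply: measurable_funN; exact: (measurableT_comp (@measurable_sqnorm n) measurable_snd).
apply: (measurableT_comp measurable_invr).
exact: measurable_funM.
Qed.

Lemma measurable_gauss n (t : R) : measurable_fun setT (fun x : Rn R n => gauss t (x : 'rV[R]_n)).
Proof. exact: (measurableT_comp (@measurable_gauss_joint n) (pair1_measurable _)). Qed.

Lemma gauss_ge0 n t (x : 'rV[R]_n) : 0 <= gauss t x.
Proof. by rewrite mulr_ge0 ?powR_ge0 ?expR_ge0. Qed.

(** The first coordinate splits off as the normal density of variance 2 t, whose integral is
    known. *)
Lemma gauss_cons n t (x : R) (y : 'rV[R]_n) : 0 < t ->
  gauss t (cons_rV (x : measurableTypeR R, y : Rn R n) : 'rV[R]_n.+1) =
  normal_pdf 0 (Num.sqrt (2 * t)) x * gauss t y.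
Proof.
move=> t0; have t4 : 0 < 4 * pi * t :> R by rewrite !mulr_gt0// pi_gt0.
rewrite normal_pdfE ?gt_eqF ?sqrtr_gt0 ?mulr_gt0//.
rewrite /gauss sqnorm_cons /normal_peak /normal_fun subr0 sqr_sqrtr ?mulr_ge0 ?ltW//.
rewrite (_ : - (n.+1%:R / 2) = - 2^-1 + - (n%:R / 2)); last by rewrite -natr1; lra.
rewrite powRD; last by apply/implyP => /eqP; rewrite gt_eqF.
rewrite powRN powR12_sqrt ?ltW// (_ : 2 * t * pi *+ 2 = 4 * pi * t); last first.
  by rewrite -mulr_natl; ring.
rewrite (_ : - (x ^+ 2 + sqnorm y) / (4 * t) = - x ^+ 2 / (2 * t *+ 2) + - sqnorm y / (4 * t)).
  by rewrite expRD; ring.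
rewrite -mulr_natl; field; lra.
Qed.

Lemma integral_gauss n t : 0 < t -> (\int[leb R n]_x (gauss t (x : 'rV[R]_n))%:E = 1)%E.
Proof.
move=> t0; elim: n => [|n IH].
  rewrite /= integral_dirac//; last by apply/measurable_EFinP; exact: measurable_gauss.
  rewrite diracE in_setT mul1e /gauss /sqnorm big_ord0 !mul0r !oppr0 powRr0 mul1r.
  by rewrite mul0r expR0.
rewrite ge0_integral_leb_cons; last 2 first.
- by apply/measurable_EFinP; exact: measurable_gauss.
- by move=> x; rewrite lee_fin gauss_ge0.
transitivity (\int[@lebesgue_measure R]_x (normal_pdf 0 (Num.sqrt (2 * t)) x)%:E)%E.
  apply: eq_integral => x _; under eq_integral do rewrite gauss_cons// EFinM.
  rewrite ge0_integralZl ?IH ?mule1 ?lee_fin ?normal_pdf_ge0//.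
  - by apply/measurable_EFinP; exact: measurable_gauss.
  - by move=> y _; rewrite lee_fin gauss_ge0.
by rewrite integral_normal_pdf// gt_eqF// sqrtr_gt0 mulr_gt0.
Qed.

End gauss.

(** * Fubini for real-valued integrals *)

Section Rintegral_fubini.
Context {d1 d2} {S : measurableType d1} {T : measurableType d2} {R : realType}.
Context (m1 : {sigma_finite_measure set S -> \bar R}).
Context (m2 : {sigma_finite_measure set T -> \bar R}).

Lemma measurable_integral_param (f : S * T -> \bar R) : measurable_fun setT f ->
  measurable_fun setT (fun x => \int[m2]_y f (x, y))%E.
Proof.
move=> mf; rewrite (_ : (fun _ => _) = fun x =>
  (\int[m2]_y (f^\+)%E (x, y) - \int[m2]_y (f^\-)%E (x, y))%E).
  apply: emeasurable_funB.
    by apply: (measurable_fun_fubini_tonelli_F (m2 := m2) (f^\+)%E) => //;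
      exact: measurable_funepos.
  by apply: (measurable_fun_fubini_tonelli_F (m2 := m2) (f^\-)%E) => //;
    exact: measurable_funeneg.
apply/funext => x; rewrite [LHS]integralE.
by congr (_ - _)%E; apply: eq_integral => y _; rewrite ?funeposE ?funenegE.
Qed.

Lemma measurable_Rintegral_param (f : S * T -> R) : measurable_fun setT f ->
  measurable_fun setT (fun x => \int[m2]_y f (x, y)).
Proof.
move=> mf; apply: (@measurableT_comp _ _ _ _ _ _ fine) => //.
by apply: (measurable_integral_param (f := EFin \o f)); exact/measurable_EFinP.
Qed.

Lemma Rintegral_iterated (f : S * T -> R) : measurable_fun setT f ->
  (\int[m1]_x \int[m2]_y `|f (x, y)|%:E < +oo)%E ->
  \int[m1]_x (\int[m2]_y f (x, y)) = fine (\int[(m1 \x m2)%E]_z (f z)%:E)%E.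
Proof.
move=> mf foo.
have mfE : measurable_fun setT (EFin \o f) by exact/measurable_EFinP.
have fi : ((m1 \x m2)%E).-integrable setT (EFin \o f).
  exact: (proj2 (integrable12ltyP m1 m2 mfE)).
congr fine; rewrite -(integral12_prod_meas1 fi).
apply: ae_eq_integral => //.
- by apply/measurable_EFinP; exact: measurable_Rintegral_param.
- exact: (measurable_fubini_F fi).
- apply: filterS (ae_integrable1 fi) => x ix _.
  by rewrite fineK//; exact: integrable_fin_num.
Qed.

End Rintegral_fubini.

Section Rintegral_swap.
Context {d1 d2} {S : measurableType d1} {T : measurableType d2} {R : realType}.
Context (m1 : {sigma_finite_measure set S -> \bar R}).
Context (m2 : {sigma_finite_measure set T -> \bar R}).

Lemma Rintegral_swap (f : S * T -> R) : measurable_fun setT f ->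
  (\int[m1]_x \int[m2]_y `|f (x, y)|%:E < +oo)%E ->
  \int[m1]_x (\int[m2]_y f (x, y)) = \int[m2]_y (\int[m1]_x f (x, y)).
Proof.
move=> mf foo.
have mfE : measurable_fun setT (EFin \o f) by exact/measurable_EFinP.
have fi : ((m1 \x m2)%E).-integrable setT (EFin \o f).
  exact: (proj2 (integrable12ltyP m1 m2 mfE)).
rewrite Rintegral_iterated// -(integral21_prod_meas1 fi); congr fine.
apply: ae_eq_integral => //.
- exact: (measurable_fubini_G fi).
- apply/measurable_EFinP.
  apply: (measurable_Rintegral_param m1 (f := fun z : T * S => f (z.2, z.1))).
  apply: (measurableT_comp mf).
  by apply: measurable_fun_pair; [exact: measurable_snd|exact: measurable_fst].
- apply: filterS (ae_integrable2 fi) => x ix _.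
  by rewrite fineK//; exact: integrable_fin_num.
Qed.

(* Minkowski's integral inequality in [L^1] *)
Lemma integral_Rintegral_le (f : S * T -> R) : measurable_fun setT f ->
  (\int[m2]_y `|\int[m1]_x f (x, y)|%:E <= \int[m1]_x \int[m2]_y `|f (x, y)|%:E)%E.
Proof.
move=> mf; have mfa : measurable_fun setT (fun z : S * T => `|f z|%:E).
  by apply/measurable_EFinP; exact: measurableT_comp.
rewrite (fubini_tonelli (m1 := m1) (m2 := m2) (fun z => `|f z|%:E))//.
have mfs : measurable_fun setT (fun z : T * S => f (z.2, z.1)).
  apply: (measurableT_comp mf).
  by apply: measurable_fun_pair; [exact: measurable_snd|exact: measurable_fst].
apply: ge0_le_integral => //.
- apply/measurable_EFinP; apply: measurableT_comp => //.
  exact: (measurable_Rintegral_param m1 (f := fun z : T * S => f (z.2, z.1))).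
- exact: (measurable_fun_fubini_tonelli_G (m1 := m1) (fun z => `|f z|%:E)).
- move=> y _.
  have mfy : measurable_fun setT (fun x => (f (x, y))%:E).
    apply/measurable_EFinP; exact: (measurableT_comp mf (pair2_measurable y)).
  apply: le_trans (le_abse_integral _ _ mfy) => //=.
  rewrite /Rintegral; case: (\int[m1]_x _)%E => [r| |] //=; by rewrite normr0 leey.
Qed.

End Rintegral_swap.

(** * Integrable functions and convolutions *)

Section L1le.
Context {R : realType} {n : nat}.
Local Notation mu := (leb R n).
Implicit Types (f g k l phi psi : 'rV[R]_n -> R) (A B : R).

(** Measurability and an explicit bound in one predicate: constants then compose through the
    estimates, and integrability is never a separate side condition. *)
Definition L1le f A := measurable_fun [set: Rn R n] f /\
  (\int[mu]_x `|f x|%:E <= A%:E)%E.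

(** A bound at every point. The representatives used below satisfy such bounds, so essential suprema
    enter only when the given solution is read in and when the final norm is estimated. *)
Definition bnd f B := forall x, `|f x| <= B.

Lemma L1le_measurable f A : L1le f A -> measurable_fun [set: Rn R n] f.
Proof. by case. Qed.

Lemma L1le_integrable f A : L1le f A -> mu.-integrable setT (EFin \o f).
Proof.
move=> [mf fA]; apply/integrableP; split; first exact/measurable_EFinP.
by apply: le_lt_trans fA _; rewrite ltry.
Qed.

Lemma L1le_ge0 f A : L1le f A -> 0 <= A.
Proof. by move=> [_ fA]; rewrite -lee_fin; apply: le_trans fA; exact: integral_ge0. Qed.

Lemma L1le_trans f A B : A <= B -> L1le f A -> L1le f B.
Proof. by move=> AB [mf fA]; split=> //; apply: le_trans fA _; rewrite lee_fin. Qed.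

Lemma integrable_L1le f : mu.-integrable setT (EFin \o f) ->
  L1le f (\int[mu]_x `|f x|).
Proof.
move=> fi; have /integrableP[/measurable_EFinP mf foo] := fi; split=> //.
by rewrite /Rintegral fineK// ge0_fin_numE//; exact: integral_ge0.
Qed.

Lemma L1leZ c f A : L1le f A -> L1le (fun x => c * f x) (`|c| * A).
Proof.
move=> [mf fA]; split; first exact: measurable_funM.
under eq_integral do rewrite normrM EFinM.
rewrite ge0_integralZl//.
- by rewrite EFinM lee_wpmul2l.
- by apply/measurable_EFinP; exact: measurableT_comp.
Qed.

Lemma L1le_dom c f g A : measurable_fun [set: Rn R n] f ->
  (forall x, `|f x| <= c * `|g x|) -> 0 <= c -> L1le g A -> L1le f (c * A).
Proof.
move=> mf fg c0 gA; have [mcg] := L1leZ c gA; rewrite ger0_norm// => cgA; split=> //.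
apply: le_trans cgA; apply: ge0_le_integral => //.
- by apply/measurable_EFinP; exact: measurableT_comp.
- by apply/measurable_EFinP; exact: measurableT_comp.
- by move=> x _; rewrite lee_fin normrM (ger0_norm c0).
Qed.

Lemma L1leD f g A B : L1le f A -> L1le g B -> L1le (fun x => f x + g x) (A + B).
Proof.
move=> [mf fA] [mg gB]; split; first exact: measurable_funD.
apply: (@le_trans _ _ (\int[mu]_x (`|f x|%:E + `|g x|%:E))%E).
  apply: ge0_le_integral => //.
  - by apply/measurable_EFinP; apply: measurableT_comp => //; exact: measurable_funD.
  - by apply: emeasurable_funD; apply/measurable_EFinP; exact: measurableT_comp.
  - by move=> x _; rewrite -EFinD lee_fin ler_normD.
rewrite ge0_integralD//; last 2 first.
- by apply/measurable_EFinP; exact: measurableT_comp.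
- by apply/measurable_EFinP; exact: measurableT_comp.
by rewrite EFinD leeD.
Qed.

Lemma L1leN f A : L1le f A -> L1le (fun x => - f x) A.
Proof.
move=> [mf fA]; split; first exact: measurable_funN.
by under eq_integral do rewrite normrN.
Qed.

Lemma L1leB f g A B : L1le f A -> L1le g B -> L1le (fun x => f x - g x) (A + B).
Proof. by move=> fA gB; exact: L1leD fA (L1leN gB). Qed.

Lemma L1leM f g A B : L1le f A -> measurable_fun [set: Rn R n] g -> bnd g B ->
  L1le (fun x => f x * g x) (B * A).
Proof.
move=> fA mg gB; have [mf _] := fA.
apply: L1le_dom fA; first exact: measurable_funM.
  by move=> x; rewrite normrM mulrC ler_wpM2r.
exact: le_trans (gB 0).
Qed.

Lemma L1le_Rintegral f A : L1le f A -> `|\int[mu]_x f x| <= A.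
Proof.
move=> fA; have fi := L1le_integrable fA; have [mf fA'] := fA.
rewrite -lee_fin; apply: le_trans fA'.
rewrite EFin_normr_Rintegral//; apply: le_abse_integral => //.
exact/measurable_EFinP.
Qed.

Lemma RintB f g A B : L1le f A -> L1le g B ->
  \int[mu]_x (f x - g x) = \int[mu]_x f x - \int[mu]_x g x.
Proof. by move=> /L1le_integrable fi /L1le_integrable gi; rewrite RintegralB. Qed.

Lemma RintD f g A B : L1le f A -> L1le g B ->
  \int[mu]_x (f x + g x) = \int[mu]_x f x + \int[mu]_x g x.
Proof. by move=> /L1le_integrable fi /L1le_integrable gi; rewrite RintegralD. Qed.

Lemma RintZ c f A : L1le f A ->
  \int[mu]_x (c * f x) = c * \int[mu]_x f x.
Proof. by move=> /L1le_integrable fi; rewrite RintegralZl. Qed.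

Lemma Rint_reflect (c : 'rV[R]_n) f : measurable_fun [set: Rn R n] f ->
  \int[mu]_y f (c - y) = \int[mu]_y f y.
Proof.
move=> mf; congr fine; apply: (integral_reflect c (f := EFin \o f)).
exact/measurable_EFinP.
Qed.

Lemma L1le_reflect (c : 'rV[R]_n) f A : L1le f A -> L1le (fun y => f (c - y)) A.
Proof.
move=> [mf fA]; split; first exact: (measurableT_comp mf (measurable_subl c)).
rewrite (integral_reflect c (f := fun y => `|f y|%:E))//.
by apply/measurable_EFinP; exact: measurableT_comp.
Qed.

Lemma Rint_shift (c : 'rV[R]_n) f : measurable_fun [set: Rn R n] f ->
  \int[mu]_y f (y + c) = \int[mu]_y f y.
Proof.
move=> mf; rewrite -(Rint_reflect c mf).
rewrite -(@Rint_reflect 0 (fun y => f (c - y))).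
  by apply: eq_Rintegral => y _; rewrite sub0r opprK addrC.
exact: (measurableT_comp mf (measurable_subl c)).
Qed.

Lemma L1le_shift (c : 'rV[R]_n) f A : L1le f A -> L1le (fun y => f (y + c)) A.
Proof.
move=> fA; have := L1le_reflect 0 (L1le_reflect c fA).
by congr L1le; apply/funext => y; rewrite sub0r opprK addrC.
Qed.

Lemma measurable_sub2 d (T : measurableType d) (g h : T -> 'rV[R]_n) :
  measurable_fun setT (g : T -> Rn R n) -> measurable_fun setT (h : T -> Rn R n) ->
  measurable_fun setT ((fun t => g t - h t) : T -> Rn R n).
Proof.
move=> mg mh; apply: measurable_to_Rn => i.
rewrite (_ : (fun _ => _) = fun t => g t ord0 i - h t ord0 i).
  apply: measurable_funB; first exact: (measurableT_comp (measurable_coord i) mg).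
  exact: (measurableT_comp (measurable_coord i) mh).
by apply/funext => y; rewrite !mxE.
Qed.

End L1le.

Section convol.
Context {R : realType} {n : nat}.
Local Notation mu := (leb R n).
Implicit Types (f g k l phi psi : 'rV[R]_n -> R) (A B : R).

Definition convol k phi (x : 'rV[R]_n) : R := \int[mu]_y (k (x - y) * phi y).

Lemma convol_L1le k phi K A x : measurable_fun [set: Rn R n] k -> bnd k K ->
  L1le phi A -> L1le (fun y => k (x - y) * phi y) (K * A).
Proof.
move=> mk kK pA; under [X in L1le X]eq_fun do rewrite mulrC.
apply: (L1leM pA); first exact: (measurableT_comp mk (measurable_subl x)).
by move=> y; exact: kK.
Qed.

Lemma convol_sup k phi K A : measurable_fun [set: Rn R n] k -> bnd k K ->
  L1le phi A -> bnd (convol k phi) (K * A).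
Proof. by move=> mk kK pA x; exact/L1le_Rintegral/convol_L1le. Qed.

Lemma convol_bnd k phi A B : L1le k A -> measurable_fun [set: Rn R n] phi -> bnd phi B ->
  bnd (convol k phi) (B * A).
Proof.
by move=> kA mp pB x; apply: L1le_Rintegral; exact: L1leM (L1le_reflect x kA) mp pB.
Qed.

Lemma measurable_convol_joint k phi : measurable_fun [set: Rn R n] k ->
  measurable_fun [set: Rn R n] phi ->
  measurable_fun setT (fun z : Rn R n * Rn R n => k (z.1 - z.2) * phi z.2).
Proof.
move=> mk mp; apply: measurable_funM; last exact: (measurableT_comp mp measurable_snd).
apply: (measurableT_comp mk).
by apply: measurable_sub2; [exact: measurable_fst|exact: measurable_snd].
Qed.

Lemma measurable_convol k phi : measurable_fun [set: Rn R n] k ->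
  measurable_fun [set: Rn R n] phi -> measurable_fun [set: Rn R n] (convol k phi).
Proof.
move=> mk mp.
exact: (measurable_Rintegral_param mu (measurable_convol_joint mk mp)).
Qed.

Lemma integral_convol_le k phi A B : L1le k A -> L1le phi B ->
  (\int[mu]_y \int[mu]_x `|k (x - y) * phi y|%:E <= (A * B)%:E)%E.
Proof.
move=> kA [mp pB]; have A0 := L1le_ge0 kA.
apply: (@le_trans _ _ (\int[mu]_y (A%:E * `|phi y|%:E))%E).
  have mj := measurable_convol_joint (L1le_measurable kA) mp.
  apply: ge0_le_integral => //.
  - by move=> y _; exact: integral_ge0.
  - apply: (measurable_fun_fubini_tonelli_G (m1 := mu)
      (fun z : Rn R n * Rn R n => `|k (z.1 - z.2) * phi z.2|%:E)) => //.
    by apply/measurable_EFinP; exact: measurableT_comp.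
  - by apply/measurable_EFinP; apply: measurable_funM => //; exact: measurableT_comp.
  - move=> y _; have [mk kA'] := L1le_shift (- y) kA.
    under eq_integral do rewrite normrM mulrC EFinM.
    rewrite ge0_integralZl//; last by apply/measurable_EFinP; exact: measurableT_comp.
    by rewrite muleC lee_wpmul2r.
rewrite ge0_integralZl//; last by apply/measurable_EFinP; exact: measurableT_comp.
by rewrite EFinM lee_wpmul2l.
Qed.

(** Young's inequality in L^1, from Minkowski's inequality and translation invariance. *)
Lemma convol_L1 k phi A B : L1le k A -> L1le phi B -> L1le (convol k phi) (A * B).
Proof.
move=> kA pB; have [mk _] := kA; have [mp _] := pB.
split; first exact: measurable_convol.
apply: le_trans (integral_convol_le kA pB).
have mj : measurable_fun setT (fun z : Rn R n * Rn R n => k (z.2 - z.1) * phi z.1).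
  apply: measurable_funM; last exact: (measurableT_comp mp measurable_fst).
  apply: (measurableT_comp mk).
  by apply: measurable_sub2; [exact: measurable_snd|exact: measurable_fst].
exact: (integral_Rintegral_le mu mu mj).
Qed.

Lemma convolBr k phi psi K A B : measurable_fun [set: Rn R n] k -> bnd k K ->
  L1le phi A -> L1le psi B ->
  convol k (fun y => phi y - psi y) = fun x => convol k phi x - convol k psi x.
Proof.
move=> mk kK pA pB; apply/funext => x.
rewrite /convol -(RintB (convol_L1le x mk kK pA) (convol_L1le x mk kK pB)).
by apply: eq_Rintegral => y _; rewrite mulrBr.
Qed.

Lemma convolBl k l phi K L A : measurable_fun [set: Rn R n] k -> bnd k K ->
  measurable_fun [set: Rn R n] l -> bnd l L -> L1le phi A ->
  convol (fun y => k y - l y) phi = fun x => convol k phi x - convol l phi x.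
Proof.
move=> mk kK ml lL pA; apply/funext => x.
rewrite /convol -(RintB (convol_L1le x mk kK pA) (convol_L1le x ml lL pA)).
by apply: eq_Rintegral => y _; rewrite mulrBl.
Qed.

(** Convolution forgets null sets, and the conclusion holds at every point. This is how functions
    that agree only almost everywhere are exchanged inside the heat flow. *)
Lemma convol_ae (k phi psi : 'rV[R]_n -> R) : measurable_fun [set: Rn R n] k ->
  measurable_fun [set: Rn R n] phi -> measurable_fun [set: Rn R n] psi ->
  {ae mu, forall y, phi y = psi y} -> convol k phi = convol k psi.
Proof.
move=> mk mp mps pp; apply/funext => x; congr fine; apply: ae_eq_integral => //.
- apply/measurable_EFinP; apply: measurable_funM => //.
  exact: (measurableT_comp mk (measurable_subl x)).
- apply/measurable_EFinP; apply: measurable_funM => //.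
  exact: (measurableT_comp mk (measurable_subl x)).
- case: pp => N [mN N0 sN]; exists N; split=> // y /= yN; apply: sN => /= e.
  by apply: yN => _; rewrite e.
Qed.

Lemma convolC k l : measurable_fun [set: Rn R n] k -> measurable_fun [set: Rn R n] l ->
  convol k l = convol l k.
Proof.
move=> mk ml; apply/funext => x; rewrite /convol.
rewrite -(@Rint_reflect _ _ x (fun y => l (x - y) * k y)).
  by apply: eq_Rintegral => y _; rewrite opprB addrCA subrr addr0 mulrC.
by apply: measurable_funM => //; exact: (measurableT_comp ml (measurable_subl x)).
Qed.

Lemma iterated_lty (F : Rn R n * Rn R n -> R) C g A : measurable_fun setT F ->
  (forall x, L1le (fun y => F (x, y)) (C * `|g x|)) -> L1le g A ->
  (\int[mu]_x \int[mu]_y `|F (x, y)|%:E < +oo)%E.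
Proof.
move=> mF FC [mg gA].
have mag : measurable_fun [set: Rn R n] (fun x => `|g x|%:E).
  by apply/measurable_EFinP; exact: measurableT_comp.
apply: (@le_lt_trans _ _ (\int[mu]_x (`|C|%:E * `|g x|%:E))%E).
  apply: ge0_le_integral => //.
  - by move=> x _; exact: integral_ge0.
  - apply: (measurable_fun_fubini_tonelli_F (m2 := mu) (fun z => `|F z|%:E)) => //.
    by apply/measurable_EFinP; exact: measurableT_comp.
  - exact: emeasurable_funM.
  - move=> x _; have [_ h] := FC x; apply: le_trans h _.
    by rewrite -EFinM lee_fin ler_wpM2r// ler_norm.
rewrite ge0_integralZl//; apply: le_lt_trans (lee_wpmul2l _ gA) _; first by rewrite lee_fin.
by rewrite -EFinM ltry.
Qed.

Lemma convolA k l phi K A L L' B x : L1le k A -> bnd k K -> L1le l L -> bnd l L' ->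
  L1le phi B ->
  convol k (convol l phi) x = convol (convol k l) phi x.
Proof.
move=> kA kK lL lL' pB; have [mk _] := kA; have [ml _] := lL; have [mp _] := pB.
have mj : measurable_fun setT (fun z : Rn R n * Rn R n =>
    k (x - z.1) * (l (z.1 - z.2) * phi z.2)).
  apply: measurable_funM; last exact: measurable_convol_joint.
  exact: (measurableT_comp (measurableT_comp mk (measurable_subl x)) measurable_fst).
have K0 : 0 <= K by exact: le_trans (kK 0).
have Rswap : \int[mu]_y (\int[mu]_z (k (x - y) * (l (y - z) * phi z))) =
    \int[mu]_z (\int[mu]_y (k (x - y) * (l (y - z) * phi z))).
  apply: (Rintegral_swap mj).
  apply: (iterated_lty mj _ (L1le_reflect x kA)) => y.
  by have := L1leZ (k (x - y)) (convol_L1le y ml lL' pB); rewrite mulrC; exact.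
transitivity (\int[mu]_y (\int[mu]_z (k (x - y) * (l (y - z) * phi z)))).
  by apply: eq_Rintegral => y _; rewrite (RintZ _ (convol_L1le y ml lL' pB)).
rewrite Rswap; apply: eq_Rintegral => z _.
have mkl := L1leM lL (measurableT_comp mk (measurable_subl (x - z))) (fun y => kK (x - z - y)).
under eq_Rintegral do rewrite mulrA.
rewrite RintegralZr//; last first.
  have := L1le_integrable (L1le_shift (- z) mkl).
  by congr (integrable mu setT _); apply/funext => y /=; rewrite mulrC opprB addrA subrK.
rewrite /convol -(Rint_shift (- z) (f := fun y => k (x - z - y) * l y)); last first.
  apply: measurable_funM => //; exact: (measurableT_comp mk (measurable_subl (x - z))).
by congr (_ * _); apply: eq_Rintegral => y _; rewrite opprB addrA subrK.
Qed.

(** The adjoint of a convolution has the reflected kernel. For the even kernel [gauss] this gives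
    symmetry, for the odd kernel [dgauss] antisymmetry. *)
Lemma convol_dual k phi psi K A B : measurable_fun [set: Rn R n] k -> bnd k K ->
  L1le phi A -> L1le psi B ->
  \int[mu]_x (convol k phi x * psi x) = \int[mu]_x (phi x * convol (fun y => k (- y)) psi x).
Proof.
move=> mk kK pA qB; have [mp _] := pA; have [mq _] := qB.
have mj : measurable_fun setT (fun z : Rn R n * Rn R n => psi z.1 * (k (z.1 - z.2) * phi z.2)).
  apply: measurable_funM; first exact: (measurableT_comp mq measurable_fst).
  exact: measurable_convol_joint.
transitivity (\int[mu]_x (\int[mu]_y (psi x * (k (x - y) * phi y)))).
  by apply: eq_Rintegral => x _; rewrite (RintZ _ (convol_L1le x mk kK pA)) mulrC.
rewrite (Rintegral_swap mj); last first.
  apply: (iterated_lty mj _ qB) => x.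
  by have := L1leZ (psi x) (convol_L1le x mk kK pA); rewrite mulrC; exact.
have mk' : measurable_fun [set: Rn R n] (fun y => k (- y)).
  have := measurableT_comp mk (measurable_subl (0 : 'rV[R]_n)).
  by congr measurable_fun; apply/funext => y /=; rewrite sub0r.
have kK' : bnd (fun y => k (- y)) K by move=> y; exact: kK.
apply: eq_Rintegral => y _.
rewrite -(RintZ _ (convol_L1le y mk' kK' qB)).
by apply: eq_Rintegral => x _; rewrite opprB; ring.
Qed.

End convol.

(** * The heat kernel *)

Lemma powRN_anti {R : realType} (r s t : R) : 0 <= r -> 0 < s -> s <= t ->
  powR t (- r) <= powR s (- r).
Proof.
move=> r0 s0 st; have t0 := lt_le_trans s0 st.
rewrite !powRN lef_pV2 ?posrE ?powR_gt0//.
by rewrite ge0_ler_powR// nnegrE ltW.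
Qed.

Section gauss_kernel.
Context {R : realType} {n : nat}.
Local Notation mu := (leb R n).
Implicit Types (a x y : 'rV[R]_n) (s t h : R).

Definition dot a x : R := \sum_(j < n) a ord0 j * x ord0 j.
(** The l^1 norm serves as the constant attached to a direction and as the weight of the first
    moment; being a sum over coordinates, it fits the moment hypotheses, which are stated
    coordinatewise. *)
Definition l1n a : R := \sum_(j < n) `|a ord0 j|.

Lemma l1n_ge0 a : 0 <= l1n a.
Proof. by apply: sumr_ge0 => j _. Qed.

Lemma sqnorm_ge0 x : 0 <= sqnorm x.
Proof. by apply: sumr_ge0 => j _; exact: sqr_ge0. Qed.

Lemma dot_le a x : `|dot a x| <= l1n a * Num.sqrt (sqnorm x).
Proof.
apply: le_trans (ler_norm_sum _ _ _) _; rewrite /l1n mulr_suml.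
apply: ler_sum => j _; rewrite normrM ler_wpM2l// -sqrtr_sqr ler_wsqrtr//.
by rewrite /sqnorm (bigD1 j)//= lerDl; apply: sumr_ge0 => i _; exact: sqr_ge0.
Qed.

Lemma measurable_dot a : measurable_fun [set: Rn R n] (dot a).
Proof.
by apply: measurable_sum => j; apply: measurable_funM => //; exact: measurable_coord.
Qed.

Lemma dotDr a x y : dot a (x + y) = dot a x + dot a y.
Proof. by rewrite /dot -big_split; apply: eq_bigr => j _; rewrite mxE mulrDr. Qed.

Lemma dotZr a (c : R) x : dot a (c *: x) = c * dot a x.
Proof. by rewrite /dot mulr_sumr; apply: eq_bigr => j _; rewrite mxE mulrCA. Qed.

Lemma dotNr a x : dot a (- x) = - dot a x.
Proof. by rewrite -scaleN1r dotZr mulN1r. Qed.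

Lemma dotC a x : dot a x = dot x a.
Proof. by apply: eq_bigr => j _; rewrite mulrC. Qed.

Lemma sqnormE x : sqnorm x = dot x x.
Proof. by apply: eq_bigr => j _; rewrite expr2. Qed.

Lemma sqnormD x y : sqnorm (x + y) = sqnorm x + 2 * dot x y + sqnorm y.
Proof. rewrite !sqnormE dotDr !(dotC (x + y)) !dotDr (dotC y x); ring. Qed.

Lemma sqnormZ (c : R) x : sqnorm (c *: x) = c ^+ 2 * sqnorm x.
Proof. rewrite !sqnormE dotZr dotC dotZr; ring. Qed.

Lemma sqnormN x : sqnorm (- x) = sqnorm x.
Proof. by rewrite -scaleN1r sqnormZ sqrrN expr1n mul1r. Qed.

Lemma gaussN t x : gauss t (- x) = gauss t x.
Proof. by rewrite /gauss sqnormN. Qed.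

Lemma four_pi_t_gt0 t : 0 < t -> 0 < 4 * pi * t :> R.
Proof. by move=> t0; rewrite !mulr_gt0// pi_gt0. Qed.

Lemma gauss_le t : 0 < t -> bnd (@gauss R n t) (powR t (- (n%:R / 2))).
Proof.
move=> t0 x; rewrite ger0_norm ?gauss_ge0// /gauss.
have t4 := four_pi_t_gt0 t0.
apply: (@le_trans _ _ (powR (4 * pi * t) (- (n%:R / 2)))).
  rewrite ler_piMr ?powR_ge0// -expR0 ler_expR mulNr oppr_le0.
  by rewrite divr_ge0 ?sqnorm_ge0// mulr_ge0// ltW.
apply: powRN_anti; rewrite ?divr_ge0//.
by have := pi_ge2 R; nra.
Qed.

Lemma gauss_L1 t : 0 < t -> L1le (@gauss R n t) 1.
Proof.
move=> t0; split; first exact: measurable_gauss.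
under eq_integral do rewrite ger0_norm ?gauss_ge0//.
by rewrite integral_gauss.
Qed.

Lemma Rint_gauss t : 0 < t -> \int[mu]_x gauss t (x : 'rV[R]_n) = 1.
Proof. by move=> t0; rewrite /Rintegral integral_gauss. Qed.

(** Completion of the square in y; the new centre is s x / (t + s). *)
Lemma gauss_mul t s x y : 0 < t -> 0 < s -> gauss t (x - y) * gauss s y =
  gauss (t + s) x * gauss (t * s / (t + s)) (y - (s / (t + s)) *: x).
Proof.
move=> t0 s0; rewrite /gauss.
have ts0 : 0 < t + s by rewrite addr_gt0.
rewrite [LHS]mulrACA [RHS]mulrACA -!powRM ?mulr_ge0 ?pi_ge0 ?divr_ge0 ?mulr_ge0 ?invr_ge0 ?(ltW
  ts0) ?(ltW t0) ?(ltW s0)//.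
rewrite -!expRD !sqnormD !sqnormN sqnormZ !dotNr dotZr (dotC y x).
congr (powR _ _ * expR _); field; lra.
Qed.

Lemma convol_gauss t s : 0 < t -> 0 < s ->
  convol (@gauss R n t) (gauss s) = gauss (t + s).
Proof.
move=> t0 s0; apply/funext => x; rewrite /convol.
under eq_Rintegral do rewrite gauss_mul//.
have r0 : 0 < t * s / (t + s) by rewrite divr_gt0 ?mulr_gt0 ?addr_gt0.
have gL := L1le_shift (- ((s / (t + s)) *: x)) (gauss_L1 r0).
rewrite (RintZ (gauss (t + s) x) gL).
rewrite (Rint_shift (- ((s / (t + s)) *: x)) (f := gauss (t * s / (t + s))));
  last exact: measurable_gauss.
by rewrite Rint_gauss// mulr1.
Qed.

(** The derivative of [gauss t] in the direction a, as [gauss_taylor] shows. *)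
Definition dgauss a t x : R := - (dot a x / (2 * t)) * gauss t x.

(** The factor 2^(n/2) is the ratio of the normalizations of [gauss t] and [gauss (2 * t)]; the
    factor 2 comes from the 4 in r e^(-r^2/(8t)) <= 4 sqrt t, divided by the 2 in the denominator 2
    t. *)
Definition cdg : R := 2 * powR 2 (n%:R / 2).

Lemma cdg_ge0 : 0 <= cdg.
Proof. by rewrite mulr_ge0// powR_ge0. Qed.

(** One half of the exponent absorbs the linear factor, the other half is the exponent at time 2
    t. *)
Lemma dot_gauss_le a t x : 0 < t ->
  `|dot a x| / (2 * t) * gauss t x <= l1n a * cdg * powR t (- 2^-1) * gauss (2 * t) x.
Proof.
move=> t0; set q := sqnorm x; have q0 : 0 <= q by exact: sqnorm_ge0.
have t4 := four_pi_t_gt0 t0.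
have -> : gauss (2 * t) x = powR (4 * pi * t) (- (n%:R / 2)) * powR 2 (- (n%:R / 2))
    * expR (- q / (8 * t)).
  rewrite /gauss -powRM ?(ltW t4)// (_ : 4 * pi * (2 * t) = 4 * pi * t * 2); last by ring.
  by rewrite (_ : 4 * (2 * t) = 8 * t)//; ring.
rewrite /gauss -/q (_ : - q / (4 * t) = - q / (8 * t) + - q / (8 * t)); last by field; lra.
rewrite expRD /cdg.
set P := powR (4 * pi * t) _; set e := expR _.
have P0 : 0 <= P by exact: powR_ge0.
have e0 : 0 <= e by exact: expR_ge0.
have p20 : 0 < powR 2 (n%:R / 2) :> R by exact: powR_gt0.
rewrite (_ : l1n a * (2 * powR 2 (n%:R / 2)) * powR t (- 2^-1) *
  (P * powR 2 (- (n%:R / 2)) * e) = l1n a * 2 * powR t (- 2^-1) * (P * e)); last first.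
  by rewrite (powRN 2); field; lra.
rewrite (_ : `|dot a x| / (2 * t) * (P * (e * e)) = `|dot a x| / (2 * t) * e * (P * e));
  last by ring.
apply: ler_wpM2r; first exact: mulr_ge0.
rewrite powRN powR12_sqrt ?(ltW t0)//.
set r := Num.sqrt q; have r0 : 0 <= r by exact: sqrtr_ge0.
set w := Num.sqrt t; have w0 : 0 < w by rewrite sqrtr_gt0.
have tw : t = w ^+ 2 by rewrite sqr_sqrtr// ltW.
have qr : q = r ^+ 2 by rewrite sqr_sqrtr.
have re : r * e <= 4 * w.
  rewrite /e mulNr expRN ler_pdivrMr ?expR_gt0//.
  have := expR_ge1Dx (q / (8 * t)).
  rewrite qr tw.
  set X := expR _ => hX.
  apply: le_trans (ler_wpM2l _ hX); last by rewrite mulr_ge0// ltW.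
  have -> : 4 * w * (1 + r ^+ 2 / (8 * w ^+ 2)) = (8 * w ^+ 2 + r ^+ 2) / (2 * w).
    by field; lra.
  rewrite ler_pdivlMr ?mulr_gt0//; nra.
have da := dot_le a x; rewrite -/q -/r in da.
rewrite [leLHS](_ : _ = `|dot a x| * e / (2 * t)); last by ring.
rewrite ler_pdivrMr ?mulr_gt0//.
apply: (@le_trans _ _ (l1n a * r * e)); first by rewrite ler_wpM2r.
rewrite -mulrA; apply: le_trans (ler_wpM2l (l1n_ge0 a) re) _.
by rewrite tw le_eqVlt; apply/orP; left; apply/eqP; field; lra.
Qed.

Lemma dgauss_le a t x : 0 < t ->
  `|dgauss a t x| <= l1n a * cdg * powR t (- 2^-1) * gauss (2 * t) x.
Proof.
move=> t0; apply: le_trans (dot_gauss_le a x t0).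
rewrite normrM normrN normrM (ger0_norm (gauss_ge0 _ _)) [`|(2 * t)^-1|]ger0_norm//.
by rewrite invr_ge0 mulr_ge0// ltW.
Qed.

Lemma measurable_dgauss a t : measurable_fun [set: Rn R n] (dgauss a t).
Proof.
apply: measurable_funM; last exact: measurable_gauss.
by apply: measurable_funN; apply: measurable_funM => //; exact: measurable_dot.
Qed.

Lemma dgauss_L1 a t : 0 < t -> L1le (dgauss a t) (l1n a * cdg * powR t (- 2^-1)).
Proof.
move=> t0; have t20 : 0 < 2 * t by rewrite mulr_gt0.
have := @L1le_dom _ _ (l1n a * cdg * powR t (- 2^-1)) (dgauss a t) (gauss (2 * t)) 1.
rewrite mulr1; apply; first exact: measurable_dgauss.
- by move=> x; rewrite (ger0_norm (gauss_ge0 _ _)); exact: dgauss_le.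
- by rewrite !mulr_ge0 ?l1n_ge0 ?cdg_ge0 ?powR_ge0.
- exact: gauss_L1.
Qed.

Lemma dgauss_bnd a t : 0 < t ->
  bnd (dgauss a t) (l1n a * cdg * powR t (- 2^-1) * powR t (- (n%:R / 2))).
Proof.
move=> t0 x; apply: le_trans (dgauss_le a x t0) _.
apply: ler_wpM2l; first by rewrite !mulr_ge0 ?l1n_ge0 ?cdg_ge0 ?powR_ge0.
have t20 : 0 < 2 * t by rewrite mulr_gt0.
have := gauss_le t20 x; rewrite ger0_norm ?gauss_ge0// => /le_trans; apply.
by apply: powRN_anti; rewrite ?divr_ge0//; lra.
Qed.

Lemma dgaussN a t x : dgauss a t (- x) = - dgauss a t x.
Proof. by rewrite /dgauss gaussN dotNr !mulNr opprK. Qed.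

(* The total variation distance of two densities is twice the mass of the positive
   part of their difference, so a one-sided bound suffices. *)
Lemma L1le_tv (f g h : 'rV[R]_n -> R) F G H :
  L1le f F -> L1le g G -> L1le h H -> \int[mu]_x f x = \int[mu]_x g x ->
  (forall x, 0 <= h x) -> (forall x, f x - g x <= h x) ->
  L1le (fun x => f x - g x) (2 * H).
Proof.
move=> fF gG hH fg h0 fgh; have fgi := L1leB fF gG.
have [mfg _] := fgi.
have h2 := L1leZ 2 hH; have h2fg := L1leB h2 fgi.
apply: (L1le_trans (A := \int[mu]_x `|f x - g x|)); last first.
  exact: integrable_L1le (L1le_integrable fgi).
apply: (@le_trans _ _ (\int[mu]_x (2 * h x - (f x - g x)))).
  apply: le_Rintegral => //.
  - have := L1le_integrable fgi => /integrable_norm.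
    by congr (integrable _ _ _); apply/funext.
  - exact: L1le_integrable h2fg.
  - by move=> x _; have := h0 x; have := fgh x; case: (ler0P (f x - g x)); lra.
rewrite (RintB h2 fgi) (RintB fF gG) fg subrr subr0 (RintZ 2 hH).
by rewrite ler_wpM2l//; apply: le_trans (ler_norm _) (L1le_Rintegral hH).
Qed.

End gauss_kernel.

(** * Second-order expansions along a line *)

Section taylor.
Context {R : realType}.
Implicit Types (f df ddf : R -> R).

Lemma derive_lip f df (x y K : R) : (forall z : R, is_derive z 1 f (df z)) ->
  (forall z, Num.min x y <= z <= Num.max x y -> `|df z| <= K) ->
  `|f x - f y| <= K * `|x - y|.
Proof.
move=> fdf; wlog xy : x y / x <= y => [hw dfK|].
  have [xy|/ltW yx] := leP x y; first exact: hw.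
  by rewrite distrC [`|x - y|]distrC; apply: hw => // z; rewrite minC maxC; exact: dfK.
rewrite (min_idPl xy) (max_idPr xy) => dfK.
have cf : {within `[x, y], continuous f}.
  apply: continuous_subspaceT => z.
  by apply/differentiable_continuous/derivable1_diffP; have [] := fdf z.
have [c cxy e] := MVT_segment xy (fun z _ => fdf z) cf.
rewrite distrC e normrM [`|x - y|]distrC ler_wpM2r// dfK//.
Qed.

(** The mean value theorem is used twice, for f' and for f(z) - z f'(0); this gives K in place of
    the sharp K / 2. *)
Lemma taylor2 f df ddf K : (forall z : R, is_derive z 1 f (df z)) ->
  (forall z : R, is_derive z 1 df (ddf z)) -> (forall z, `|ddf z| <= K) ->
  forall e, `|f e - f 0 - e * df 0| <= K * e ^+ 2.
Proof.
move=> fdf dfddf ddfK e.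
have hd (z : R) : is_derive z 1 (fun z => f z - z * df 0) (df z - df 0).
  have d1 : is_derive z 1 (fun z : R => z * df 0) (df 0).
    by apply: is_derive_eq; rewrite /GRing.scale/=; ring.
  exact: is_deriveB.
have K0 : 0 <= K by exact: le_trans (ddfK 0).
have -> : f e - f 0 - e * df 0 = (f e - e * df 0) - (f 0 - 0 * df 0) by ring.
have -> : K * e ^+ 2 = K * `|e| * `|e - 0| by rewrite subr0 -mulrA -expr2 real_normK// num_real.
apply: (derive_lip hd) => z zb.
apply: le_trans (derive_lip dfddf (fun z _ => ddfK z)) _.
rewrite subr0 ler_wpM2l//; move: zb; rewrite minElt maxElt.
by case: ltrP => ? /andP[? ?]; rewrite ler_norml; move: (ler_norm e) (ler_norm (- e));
  rewrite normrN => ? ?; apply/andP; split; lra.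
Qed.

(** The exponential of the Gaussian along the line x + z a, with al = |x|^2, be = a . x and ga =
    |a|^2. *)
Definition gaus (al be ga t z : R) : R := expR (- (al + 2 * be * z + ga * z ^+ 2) / (4 * t)).

Definition dgaus (al be ga t z : R) : R := - ((be + ga * z) / (2 * t)) * gaus al be ga t z.

Lemma is_derive_gaus (al be ga t z : R) : t != 0 ->
  is_derive z 1 (gaus al be ga t) (dgaus al be ga t z).
Proof.
move=> t0; rewrite /gaus.
have d1 : is_derive z 1 (fun z : R => - (al + 2 * be * z + ga * z ^+ 2) / (4 * t))
    (- (2 * be + ga * (2 * z)) / (4 * t)).
  by apply: is_derive_eq; rewrite /GRing.scale/=; field.
have d2 := @is_derive1_comp _ expR _ z _ _ (is_derive_expR _) d1.
by apply: (is_derive_eq d2); rewrite /dgaus /gaus; field.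
Qed.

Lemma is_derive_dgaus (al be ga t z : R) : t != 0 ->
  is_derive z 1 (dgaus al be ga t)
   ((- (ga / (2 * t)) + ((be + ga * z) / (2 * t)) ^+ 2) * gaus al be ga t z).
Proof.
move=> t0.
have d1 : is_derive z 1 (fun z : R => - ((be + ga * z) / (2 * t))) (- (ga / (2 * t))).
  by apply: is_derive_eq; rewrite /GRing.scale/=; field.
have d2 := is_deriveM d1 (is_derive_gaus al be ga z t0).
by apply: (is_derive_eq d2); rewrite /dgaus /GRing.scale/=; ring.
Qed.

End taylor.

Section heat_kernel.
Context {R : realType} {n : nat}.
Local Notation mu := (leb R n).
Implicit Types (a x y : 'rV[R]_n) (s t h : R) (phi : 'rV[R]_n -> R).

Definition ctaylor a t : R :=
  powR (4 * pi * t) (- (n%:R / 2)) * (sqnorm a / (2 * t) + l1n a ^+ 2 / t).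

(** The second derivative along a is bounded uniformly in x, since q e^(-q/(4t)) <= 4 t for q = |x +
    z a|^2. Uniformity lets the expansion pass under a convolution with any L^1 function. *)
Lemma gauss_taylor a t x (e : R) : 0 < t ->
  `|gauss t (x + e *: a) - gauss t x - e * dgauss a t x| <= ctaylor a t * e ^+ 2.
Proof.
move=> t0; have tn0 : t != 0 by rewrite gt_eqF.
set P := powR (4 * pi * t) (- (n%:R / 2)); have P0 : 0 <= P by exact: powR_ge0.
pose al := sqnorm x; pose be := dot a x; pose ga := sqnorm a.
have qE z : sqnorm (x + z *: a) = al + 2 * be * z + ga * z ^+ 2.
  by rewrite sqnormD dotZr sqnormZ dotC /al /be /ga; ring.
have gE z : gauss t (x + z *: a) = P * gaus al be ga t z by rewrite /gauss qE.
have g0 : gauss t x = P * gaus al be ga t 0 by rewrite -gE scale0r addr0.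
rewrite (gE e) /dgauss g0.
have -> : P * gaus al be ga t e - P * gaus al be ga t 0 - e *
    (- (dot a x / (2 * t)) * (P * gaus al be ga t 0)) =
  P * (gaus al be ga t e - gaus al be ga t 0 - e * dgaus al be ga t 0).
  by rewrite /dgaus mulr0 addr0 -/be; ring.
rewrite normrM (ger0_norm P0) /ctaylor -/P -mulrA; apply: ler_wpM2l => //.
apply: (taylor2 (fun z => is_derive_gaus al be ga z tn0)
  (fun z => is_derive_dgaus al be ga z tn0)) => z.
pose q := sqnorm (x + z *: a); have q0 : 0 <= q by exact: sqnorm_ge0.
have ga0 : 0 <= ga by exact: sqnorm_ge0.
have dq : `|be + ga * z| <= l1n a * Num.sqrt q.
  have -> : be + ga * z = dot a (x + z *: a).
    by rewrite dotDr dotZr -sqnormE /be /ga mulrC.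
  exact: dot_le.
have dq2 : (be + ga * z) ^+ 2 <= l1n a ^+ 2 * q.
  rewrite -[q in leRHS](sqr_sqrtr q0) -exprMn -real_normK ?num_real//.
  by rewrite ler_sqr ?nnegrE ?mulr_ge0 ?l1n_ge0 ?sqrtr_ge0.
rewrite /gaus -qE -/q normrM [`|expR _|]ger0_norm ?expR_ge0//.
set e1 := expR _.
have e1_0 : 0 < e1 by exact: expR_gt0.
have e1_1 : e1 <= 1.
  by rewrite /e1 -expR0 ler_expR mulNr oppr_le0 divr_ge0// mulr_ge0// ltW.
have qe : q * e1 <= 4 * t.
  rewrite /e1 mulNr expRN ler_pdivrMr ?expR_gt0//.
  have /(ler_wpM2l (x := 4 * t)) := expR_ge1Dx (q / (4 * t)).
  rewrite mulrDr mulr1 (_ : 4 * t * (q / (4 * t)) = q); last by field.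
  by move=> /(_ ltac:(lra)); lra.
apply: (@le_trans _ _ ((ga / (2 * t) + l1n a ^+ 2 * q / (4 * t ^+ 2)) * e1)).
  apply: ler_wpM2r; first exact: ltW.
  apply: le_trans (ler_normD _ _) _; rewrite normrN lerD//.
    by rewrite ger0_norm// divr_ge0// mulr_ge0// ltW.
  rewrite ger0_norm ?sqr_ge0// exprMn exprVn (_ : (2 * t) ^+ 2 = 4 * t ^+ 2); last by ring.
  by rewrite ler_wpM2r// invr_ge0 mulr_ge0// sqr_ge0.
rewrite mulrDl lerD//.
  by rewrite ler_piMr// divr_ge0// mulr_ge0// ltW.
rewrite [leLHS](_ : _ = l1n a ^+ 2 / (4 * t ^+ 2) * (q * e1)); last by ring.
apply: le_trans (ler_wpM2l _ qe) _.
  by rewrite divr_ge0// ?sqr_ge0// mulr_ge0// sqr_ge0.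
by rewrite le_eqVlt; apply/orP; left; apply/eqP; field.
Qed.

Lemma ctaylor_ge0 a t : 0 < t -> 0 <= ctaylor a t.
Proof.
move=> t0; rewrite mulr_ge0 ?powR_ge0// addr_ge0// divr_ge0 ?sqnorm_ge0 ?sqr_ge0 ?mulr_ge0//
  ltW//.
Qed.

Lemma is_derive_taylor (F : 'rV[R]_n -> R) a x (d C : R) :
  (forall e, `|F (x + e *: a) - F x - e * d| <= C * e ^+ 2) -> is_derive x a F d.
Proof.
move=> FC.
have C0 : 0 <= C by have := FC 1; rewrite expr1n mulr1; exact: le_trans.
suff H : (fun h : R => h^-1 *: (F (h *: a + x) - F x)) @ 0^' --> d.
  apply: DeriveDef; first by apply/cvg_ex; exists d.
  by apply/cvg_lim => //; exact: norm_hausdorff.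
apply/cvgrPdist_le => e e0; near=> h.
have h0 : h != 0 by near: h; exact: nbhs_dnbhs_neq.
rewrite [h *: a + x]addrC.
have -> : d - h^-1 *: (F (x + h *: a) - F x) = - h^-1 * (F (x + h *: a) - F x - h * d).
  by rewrite /GRing.scale/=; field.
rewrite normrM normrN normfV ler_pdivrMl ?normr_gt0//.
apply: le_trans (FC h) _; rewrite -real_normK ?num_real// expr2 mulrCA ler_wpM2l//.
apply: (@le_trans _ _ ((C + 1) * `|h|)); first by rewrite ler_wpM2r// lerDl.
rewrite -ler_pdivlMl; last by rewrite ltr_wpDl.
near: h; apply: dnbhs0_le.
by rewrite mulr_gt0// invr_gt0 ltr_wpDl.
Unshelve. all: by end_near. Qed.

Lemma convol_gauss_taylor a t phi A x (e : R) : 0 < t -> L1le phi A ->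
  `|convol (gauss t) phi (x + e *: a) - convol (gauss t) phi x - e * convol (dgauss a t) phi x|
  <= ctaylor a t * A * e ^+ 2.
Proof.
move=> t0 pA; have mg := @measurable_gauss R n t; have gb := @gauss_le R n _ t0.
have mge : measurable_fun [set: Rn R n] (fun z : 'rV[R]_n => gauss t (z + e *: a)).
  exact: L1le_measurable (L1le_shift (e *: a) (gauss_L1 t0)).
have gbe : bnd (fun z : 'rV[R]_n => gauss t (z + e *: a)) (powR t (- (n%:R / 2))).
  by move=> z; exact: gauss_le.
have l1 := convol_L1le x mge gbe pA.
have l2 := convol_L1le x mg gb pA.
have l3 := L1leZ e (convol_L1le x (measurable_dgauss a t) (dgauss_bnd a t0) pA).
have -> : convol (gauss t) phi (x + e *: a) = convol (fun z => gauss t (z + e *: a)) phi x.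
  by apply: eq_Rintegral => y _; rewrite addrAC.
rewrite /convol -(RintZ e (convol_L1le x (measurable_dgauss a t) (dgauss_bnd a t0) pA)).
rewrite -(RintB l1 l2) -(RintB (L1leB l1 l2) l3).
apply: L1le_Rintegral.
have -> : ctaylor a t * A * e ^+ 2 = (ctaylor a t * e ^+ 2) * A by ring.
apply: L1le_dom pA => [|y|].
- exact: L1le_measurable (L1leB (L1leB l1 l2) l3).
- rewrite -mulrBl mulrA -mulrBl normrM ler_wpM2r//.
  exact: gauss_taylor.
- by rewrite mulr_ge0 ?sqr_ge0 ?ctaylor_ge0.
Qed.

Lemma derive_convol_gauss a t phi A x : 0 < t -> L1le phi A ->
  'D_a (convol (gauss t) phi) x = convol (dgauss a t) phi x.
Proof.
move=> t0 pA.
have [] := is_derive_taylor (fun e => convol_gauss_taylor a x e t0 pA).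
by move=> _.
Qed.

(** Both sides are the derivative along a of [gauss t] convolved with [gauss s], which is
    [gauss (t + s)]; no integral is computed. *)
Lemma convol_dgauss_gauss a t s : 0 < t -> 0 < s ->
  convol (dgauss a t) (gauss s) = dgauss a (t + s).
Proof.
move=> t0 s0; apply/funext => x.
rewrite -(derive_convol_gauss a x t0 (gauss_L1 s0)) convol_gauss//.
have ts0 : 0 < t + s by rewrite addr_gt0.
by have [] := is_derive_taylor (fun e => gauss_taylor a x e ts0).
Qed.

Lemma bernoulli_le (r : R) m : 0 <= r <= 1 -> 1 - m%:R * (1 - r) <= r ^+ m.
Proof.
move=> /andP[r0 r1]; elim: m => [|m IH]; first by rewrite mul0r subr0 expr0.
rewrite exprS; apply: (@le_trans _ _ (r * (1 - m%:R * (1 - r)))); last by rewrite ler_wpM2l.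
rewrite -natr1; have : 0 <= m%:R * (1 - r) ^+ 2 :> R by rewrite mulr_ge0 ?sqr_ge0.
lra.
Qed.

(** The exponential increases with time, so only the normalization can decrease. Its ratio r^(n/2),
    with r = s / (s + h) <= 1, is at least r^n, to which Bernoulli's inequality applies. A one-sided
    bound is all that [L1le_tv] asks for. *)
Lemma gauss_time_le s h x : 0 < s -> 0 < h ->
  gauss s x - gauss (s + h) x <= n%:R * (h / (s + h)) * gauss s x.
Proof.
move=> s0 h0; have sh0 : 0 < s + h by rewrite addr_gt0.
set r := s / (s + h).
have r0 : 0 < r by rewrite divr_gt0.
have r1 : r <= 1 by rewrite ler_pdivrMr// mul1r lerDl ltW.
have hr : h / (s + h) = 1 - r by rewrite /r; field; lra.
suff : (1 - n%:R * (1 - r)) * gauss s x <= gauss (s + h) x by rewrite hr; lra.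
apply: (@le_trans _ _ (powR r (n%:R / 2) * gauss s x)).
  rewrite ler_wpM2r ?gauss_ge0//.
  apply: (@le_trans _ _ (r ^+ n)); first by apply: bernoulli_le; rewrite (ltW r0).
  rewrite -powR_mulrn ?(ltW r0)// ger_powR ?r0//.
  by rewrite ler_pdivrMr// ler_peMr// ler1n.
rewrite /gauss mulrA; apply: ler_pM.
- by rewrite mulr_ge0 ?powR_ge0.
- exact: expR_ge0.
- rewrite !powRN le_eqVlt; apply/orP; left; apply/eqP.
  rewrite [in RHS](_ : 4 * pi * (s + h) = 4 * pi * s * r^-1); last by rewrite /r; field; lra.
  rewrite [in RHS]powRM ?invr_ge0 ?(ltW r0) ?(ltW (four_pi_t_gt0 s0))//.
  rewrite -[r^-1]powR_inv1 ?(ltW r0)// -powRrM mulN1r powRN invfM invrK mulrC.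
  by [].
- rewrite ler_expR !mulNr lerN2 ler_wpM2l ?sqnorm_ge0// lef_pV2 ?posrE ?mulr_gt0//.
  by rewrite ler_wpM2l// lerDl ltW.
Qed.

(** The natural exponent of h / s is 1. It is lowered to 1/4 because a gradient will add s^(-1/2),
    and s^(-3/4) is still integrable at 0. *)
Lemma gauss_time_L1 s h : 0 < s -> 0 < h ->
  L1le (fun x : 'rV[R]_n => gauss s x - gauss (s + h) x) (2 * n%:R * powR (h / s) 4^-1).
Proof.
move=> s0 h0; have sh0 : 0 < s + h by rewrite addr_gt0.
have hs0 : 0 < h / (s + h) by rewrite divr_gt0.
have nh0 : 0 <= n%:R * (h / (s + h)) by rewrite mulr_ge0 // ltW.
have := L1leZ (n%:R * (h / (s + h))) (@gauss_L1 R n _ s0); rewrite mulr1 ger0_norm// => gL.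
have := L1le_tv (@gauss_L1 R n _ s0) (gauss_L1 sh0) gL.
rewrite !Rint_gauss// => /(_ erefl _ _)/L1le_trans; apply.
- rewrite -mulrA ler_wpM2l// ler_wpM2l//.
  apply: (@le_trans _ _ (powR (h / (s + h)) 4^-1)).
    rewrite ger1_powR//; last by rewrite invf_le1// ler1n.
    by rewrite hs0 ler_pdivrMr// mul1r lerDr ltW.
  rewrite ge0_ler_powR ?nnegrE ?(ltW hs0)//; first by rewrite divr_ge0 ?ltW.
  by rewrite ler_wpM2l ?(ltW h0)// lef_pV2 ?posrE// lerDl ltW.
- by move=> x; rewrite mulr_ge0 ?gauss_ge0.
- by move=> x; exact: gauss_time_le.
Qed.

Lemma sqnorm_le x : sqnorm x <= l1n x ^+ 2.
Proof.
rewrite sqnormE; apply: le_trans (ler_norm _) _.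
have := dot_le x x; rewrite -sqnormE ger0_norm ?sqnorm_ge0// => h.
have [s0|s0] := eqVneq (Num.sqrt (sqnorm x)) 0.
  by rewrite -(sqr_sqrtr (sqnorm_ge0 x)) s0 expr0n/= sqr_ge0.
have sp : 0 < Num.sqrt (sqnorm x) by rewrite lt_neqAle eq_sym s0 sqrtr_ge0.
have : Num.sqrt (sqnorm x) <= l1n x.
  by rewrite -(ler_pM2r sp) -expr2 sqr_sqrtr ?sqnorm_ge0.
by move=> h2; rewrite -[leLHS](sqr_sqrtr (sqnorm_ge0 x)) ler_sqr ?nnegrE ?sqrtr_ge0 ?l1n_ge0.
Qed.

(** If m = l1n y / sqrt t is at least 1, the trivial bound 2 is enough. Otherwise e^z >= 1 + z
    bounds the difference from one side by a multiple of m^2 plus a multiple of m, and m^2 <= m. *)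
Lemma gauss_shift_L1 t y : 0 < t ->
  L1le (fun x => gauss t x - gauss t (x - y))
    (2 * (1 + @cdg R n) * (l1n y * powR t (- 2^-1))).
Proof.
move=> t0; set m := l1n y * powR t (- 2^-1).
have m0 : 0 <= m by rewrite mulr_ge0 ?l1n_ge0 ?powR_ge0.
have c0 := @cdg_ge0 R n.
have gL := @gauss_L1 R n _ t0.
have gsL := L1le_shift (- y) gL.
have [m1|m1] := leP 1 m.
  by apply: L1le_trans (L1leB gL gsL); nra.
have t20 : 0 < 2 * t by rewrite mulr_gt0.
have m2 : m ^+ 2 = l1n y ^+ 2 / t.
  rewrite exprMn powRN powR12_sqrt ?(ltW t0)// exprVn sqr_sqrtr ?(ltW t0)//.
have h1 := L1leZ (sqnorm y / (4 * t)) gL.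
have h2 : L1le (fun x => `|dot y x| / (2 * t) * gauss t x) (m * @cdg R n).
  have := @L1le_dom R n (m * @cdg R n) (fun x => `|dot y x| / (2 * t) * gauss t x) (gauss (2 *
    t)) 1.
  rewrite mulr1; apply.
  - apply: measurable_funM; last exact: measurable_gauss.
    by apply: measurable_funM => //; apply: measurableT_comp => //; exact: measurable_dot.
  - move=> x; rewrite (ger0_norm (gauss_ge0 _ _)).
    rewrite [leLHS]ger0_norm ?mulr_ge0 ?powR_ge0 ?expR_ge0 ?invr_ge0 ?(ltW t20)//.
    rewrite (_ : m * @cdg R n = l1n y * @cdg R n * powR t (- 2^-1)).
      exact: dot_gauss_le.
    by rewrite /m; ring.
  - by rewrite mulr_ge0.
  - exact: gauss_L1.
have t40 : 0 < 4 * t by rewrite mulr_gt0.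
have := L1le_tv gL gsL (L1leD h1 h2).
rewrite (Rint_shift (- y) (@measurable_gauss R n t)) => /(_ erefl _ _)/L1le_trans; apply.
- rewrite mulr1 ger0_norm ?divr_ge0 ?sqnorm_ge0 ?(ltW t40)//.
  have : sqnorm y / (4 * t) <= m ^+ 2 / 4.
    rewrite m2 -mulrA -invfM [t * 4]mulrC ler_wpM2r ?invr_ge0 ?(ltW t40)//; exact: sqnorm_le.
  by nra.
- move=> x; rewrite addr_ge0 ?mulr_ge0 ?powR_ge0 ?expR_ge0 ?sqnorm_ge0 ?invr_ge0 ?(ltW t20)
  ?(ltW t40)//.
- move=> x; rewrite -mulrDl.
  have -> : gauss t (x - y) = gauss t x * expR ((2 * dot y x - sqnorm y) / (4 * t)).
    rewrite /gauss -[RHS]mulrA -expRD; congr (_ * expR _).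
    by rewrite sqnormD sqnormN dotNr dotC; field; lra.
  have := ler_wpM2l (gauss_ge0 t x) (expR_ge1Dx ((2 * dot y x - sqnorm y) / (4 * t))).
  have : - `|dot y x| / (2 * t) <= dot y x / (2 * t).
    by rewrite ler_wpM2r ?invr_ge0 ?(ltW t20)// lerNl -normrN ler_norm.
  move=> /(ler_wpM2l (gauss_ge0 t x)).
  have -> : (2 * dot y x - sqnorm y) / (4 * t) = dot y x / (2 * t) - sqnorm y / (4 * t).
    by field; lra.
  by set G := gauss t x; set E := expR _; set u := dot y x / _; set v := sqnorm y / _;
    set w := `|_| / _; rewrite mulNr -/w; lra.
Qed.

End heat_kernel.

(** * Time integrals *)

Section time_integral.
Context {R : realType} {n : nat}.
Local Notation mu := (leb R n).
Local Notation TR := (measurableTypeR R).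
Local Notation lam := (@lebesgue_measure R).
Implicit Types (F G : R -> 'rV[R]_n -> R) (s t : R) (x y : 'rV[R]_n).

Definition jmeas F := measurable_fun [set: TR * Rn R n] (fun z => F z.1 z.2).

Lemma jmeas_at F s : jmeas F -> measurable_fun [set: Rn R n] (F s).
Proof. by move=> mF; exact: (measurableT_comp mF (pair1_measurable (s : TR))). Qed.

Lemma jmeas_pt F x : jmeas F -> measurable_fun [set: TR] (F ^~ x).
Proof. by move=> mF; exact: (measurableT_comp mF (pair2_measurable (x : Rn R n))). Qed.

Lemma jmeas_comp (f : R -> R) F : measurable_fun setT f -> jmeas F ->
  jmeas (fun s x => f (F s x)).
Proof. by move=> mf mF; exact: (measurableT_comp mf mF). Qed.

Lemma jmeasB F G : jmeas F -> jmeas G -> jmeas (fun s x => F s x - G s x).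
Proof. exact: measurable_funB. Qed.

Lemma jmeasD F G : jmeas F -> jmeas G -> jmeas (fun s x => F s x + G s x).
Proof. exact: measurable_funD. Qed.

(* Cutting the integrand off, instead of restricting the domain of integration, keeps
   the end points available as measurable parameters. *)
Definition win t0 t1 s (c : R) : R := if (t0 < s) && (s < t1) then c else 0.

Lemma measurable_win d (T : measurableType d) (t0 t1 s c : T -> R) :
  measurable_fun setT t0 -> measurable_fun setT t1 -> measurable_fun setT s ->
  measurable_fun setT c ->
  measurable_fun setT (fun z => win (t0 z) (t1 z) (s z) (c z)).
Proof.
move=> m0 m1 ms mc; apply: measurable_fun_ifT => //.
by apply: measurable_and; exact: measurable_fun_ltr.
Qed.

Definition tint (g : R -> 'rV[R]_n -> R) t0 t1 x : R :=
  \int[lam]_s win t0 t1 s (g s x).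

(** The counterpart of [L1le] in time: a majorant together with a bound for its integral. Weights
    that are singular at either end point are handled through this one predicate. *)
Definition tbound t0 t1 (B : R -> R) (Bt : R) :=
  [/\ measurable_fun [set: TR] B, forall s, t0 < s < t1 -> 0 <= B s
    & (\int[lam]_s (win t0 t1 s (B s))%:E <= Bt%:E)%E].

Lemma jmeas_win F t0 t1 : jmeas F -> jmeas (fun s x => win t0 t1 s (F s x)).
Proof. by move=> mF; apply: measurable_win => //; exact: measurable_fst. Qed.

Lemma win_le t0 t1 s (b c : R) : (t0 < s < t1 -> `|b| <= c) ->
  `|win t0 t1 s b| <= win t0 t1 s c.
Proof. by rewrite /win; case: ifP => [st /(_ isT)//|_ _]; rewrite normr0. Qed.

Lemma win_integrable t0 t1 (g B : R -> R) Bt : measurable_fun [set: TR] g ->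
  tbound t0 t1 B Bt -> (forall s, t0 < s < t1 -> `|g s| <= B s) ->
  lam.-integrable [set: TR] (fun s => (win t0 t1 s (g s))%:E).
Proof.
move=> mg [mB B0 BI] gB.
have mw c : measurable_fun [set: TR] c -> measurable_fun [set: TR] (fun s => win t0 t1 s (c s)).
  by move=> mc; exact: measurable_win.
apply/integrableP; split; first by apply/measurable_EFinP; exact: mw.
apply: (@le_lt_trans _ _ Bt%:E); last by rewrite ltry.
apply: le_trans BI; apply: ge0_le_integral => //.
- by apply/measurable_EFinP; apply: measurableT_comp => //; exact: mw.
- by apply/measurable_EFinP; exact: mw.
- by move=> s _; rewrite lee_fin; apply: win_le; exact: gB.
Qed.

Lemma tint_bnd F t0 t1 B Bt x : jmeas F -> tbound t0 t1 B Bt ->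
  (forall s, t0 < s < t1 -> `|F s x| <= B s) -> `|tint F t0 t1 x| <= Bt.
Proof.
move=> mF tB FB; have [mB B0 BI] := tB.
have mFx := jmeas_pt x mF.
have wi := win_integrable mFx tB FB.
rewrite -lee_fin; apply: le_trans BI.
rewrite EFin_normr_Rintegral//.
have mw c : measurable_fun [set: TR] c -> measurable_fun [set: TR] (fun s => win t0 t1 s (c s)).
  by move=> mc; exact: measurable_win.
apply: le_trans (le_abse_integral _ _ _) _ => //; first by apply/measurable_EFinP; exact: mw.
apply: ge0_le_integral => //.
- by apply/measurable_EFinP; apply: measurableT_comp => //; exact: mw.
- by apply/measurable_EFinP; exact: mw.
- by move=> s _; rewrite lee_fin; apply: win_le; exact: FB.
Qed.

Lemma measurable_tint F t0 t1 : jmeas F -> measurable_fun [set: Rn R n] (tint F t0 t1).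
Proof.
move=> mF; have mw := jmeas_win t0 t1 mF.
apply: (measurable_Rintegral_param lam (f := fun z : Rn R n * TR => win t0 t1 z.2 (F z.2 z.1))).
have mswap : measurable_fun setT (fun z : Rn R n * TR => (z.2, z.1)).
  by apply: measurable_fun_pair; [exact: measurable_snd|exact: measurable_fst].
exact: (measurableT_comp mw mswap).
Qed.

Lemma tint_iterated F t0 t1 B Bt : jmeas F -> tbound t0 t1 B Bt ->
  (forall s, t0 < s < t1 -> L1le (F s) (B s)) ->
  (\int[lam]_s \int[mu]_x `|win t0 t1 s (F s x)|%:E <= Bt%:E)%E.
Proof.
move=> mF [mB B0 BI] FB; apply: le_trans BI.
apply: ge0_le_integral => //.
- by move=> s _; exact: integral_ge0.
- apply: (measurable_fun_fubini_tonelli_F (m2 := mu)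
    (fun z : TR * Rn R n => `|win t0 t1 z.1 (F z.1 z.2)|%:E)) => //.
  by apply/measurable_EFinP; apply: measurableT_comp => //; exact: jmeas_win.
- by apply/measurable_EFinP; exact: measurable_win.
- move=> s _; rewrite /win; case: ifP => [st|_]; first by have [] := FB s st.
  by under eq_integral do rewrite normr0; rewrite integral0.
Qed.

Lemma tint_L1 F t0 t1 B Bt : jmeas F -> tbound t0 t1 B Bt ->
  (forall s, t0 < s < t1 -> L1le (F s) (B s)) -> L1le (tint F t0 t1) Bt.
Proof.
move=> mF tB FB; split; first exact: measurable_tint.
apply: le_trans (tint_iterated mF tB FB).
exact: (integral_Rintegral_le lam mu (jmeas_win t0 t1 mF)).
Qed.

Lemma winB t0 t1 s (b c : R) : win t0 t1 s (b - c) = win t0 t1 s b - win t0 t1 s c.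
Proof. by rewrite /win; case: ifP => // _; rewrite subr0. Qed.

Lemma winM t0 t1 s (b c : R) : win t0 t1 s (b * c) = b * win t0 t1 s c.
Proof. by rewrite /win; case: ifP => // _; rewrite mulr0. Qed.

Lemma tintB F G t0 t1 B Bt B' Bt' x : jmeas F -> jmeas G ->
  tbound t0 t1 B Bt -> tbound t0 t1 B' Bt' ->
  (forall s, t0 < s < t1 -> `|F s x| <= B s) -> (forall s, t0 < s < t1 -> `|G s x| <= B' s) ->
  tint (fun s x => F s x - G s x) t0 t1 x = tint F t0 t1 x - tint G t0 t1 x.
Proof.
move=> mF mG tB tB' FB GB.
rewrite /tint -RintegralB//.
- by apply: eq_Rintegral => s _; rewrite winB.
- exact: (win_integrable (jmeas_pt x mF) tB FB).
- exact: (win_integrable (jmeas_pt x mG) tB' GB).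
Qed.

Lemma eq_tint F G t0 t1 x : (forall s, t0 < s < t1 -> F s x = G s x) ->
  tint F t0 t1 x = tint G t0 t1 x.
Proof.
by move=> FG; apply: eq_Rintegral => s _; rewrite /win; case: ifP => // /FG.
Qed.

Lemma tint_split F t0 t1 t2 B Bt x : jmeas F -> t0 <= t1 -> t1 <= t2 ->
  tbound t0 t2 B Bt -> (forall s, t0 < s < t2 -> `|F s x| <= B s) ->
  tint F t0 t2 x = tint F t0 t1 x + tint F t1 t2 x.
Proof.
move=> mF t01 t12 tB FB; have wi := win_integrable (jmeas_pt x mF) tB FB.
have mFx := jmeas_pt x mF.
have wi' s0 s1 : t0 <= s0 -> s1 <= t2 ->
    lam.-integrable [set: TR] (fun s => (win s0 s1 s (F s x))%:E).
  move=> h0 h1; apply: le_integrable wi => //.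
    by apply/measurable_EFinP; exact: measurable_win.
  move=> s _; rewrite lee_fin /win; case: ifPn => [/andP[h2 h3]|_]; last by rewrite normr0.
  by rewrite (le_lt_trans h0 h2) (lt_le_trans h3 h1).
rewrite /tint -RintegralD//; [|exact: wi'|exact: wi'].
congr fine; apply: ae_eq_integral => //.
- by apply/measurable_EFinP; exact: measurable_win.
- by apply/measurable_EFinP; apply: measurable_funD; exact: measurable_win.
(* The cut-offs are strict, so the two sides can differ at s = t1 only. *)
exists [set t1]; split => //.
  by have := lebesgue_measure_set1 t1.
move=> s /=; apply: contra_notP => st1 _; congr EFin; rewrite /win.
have [s1|s1|//] := ltrgtP s t1.
  by rewrite (lt_le_trans s1 t12) !andbT/= addr0.
by rewrite (le_lt_trans t01 s1)/= ?andbF add0r.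
Qed.

Lemma convol_tint k K F t0 t1 B Bt x : measurable_fun [set: Rn R n] k -> bnd k K ->
  jmeas F -> tbound t0 t1 B Bt -> (forall s, t0 < s < t1 -> L1le (F s) (B s)) ->
  convol k (tint F t0 t1) x = tint (fun s => convol k (F s)) t0 t1 x.
Proof.
move=> mk kK mF tB FB; have mw := jmeas_win t0 t1 mF.
have K0 : 0 <= K by exact: le_trans (kK 0).
pose Fn (z : Rn R n * TR) := k (x - z.1) * win t0 t1 z.2 (F z.2 z.1).
have mswap : measurable_fun setT (fun z : Rn R n * TR => (z.2, z.1)).
  by apply: measurable_fun_pair; [exact: measurable_snd|exact: measurable_fst].
have mFn : measurable_fun setT Fn.
  apply: measurable_funM; last exact: (measurableT_comp mw mswap).
  exact: (measurableT_comp (measurableT_comp mk (measurable_subl x)) measurable_fst).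
have mFn' : measurable_fun setT (fun z : TR * Rn R n => Fn (z.2, z.1)).
  apply: (measurableT_comp mFn).
  by apply: measurable_fun_pair; [exact: measurable_snd|exact: measurable_fst].
have bi : (\int[lam]_s \int[mu]_y `|Fn (y, s)|%:E < +oo)%E.
  apply: (@le_lt_trans _ _ (\int[lam]_s (K%:E * \int[mu]_y `|win t0 t1 s (F s y)|%:E))%E).
    have mI : measurable_fun [set: TR] (fun s => \int[mu]_y `|win t0 t1 s (F s y)|%:E)%E.
      apply: (measurable_fun_fubini_tonelli_F (m2 := mu)
        (fun z : TR * Rn R n => `|win t0 t1 z.1 (F z.1 z.2)|%:E)) => //.
      by apply/measurable_EFinP; exact: measurableT_comp.
    apply: ge0_le_integral => //.
    - by move=> s _; exact: integral_ge0.
    - apply: (measurable_fun_fubini_tonelli_F (m2 := mu)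
        (fun z : TR * Rn R n => `|Fn (z.2, z.1)|%:E)) => //.
      by apply/measurable_EFinP; exact: measurableT_comp.
    - exact: emeasurable_funM.
    - move=> s _; have mws := measurableT_comp mw (pair1_measurable (s : TR)).
      rewrite -ge0_integralZl//; last by apply/measurable_EFinP; exact: measurableT_comp.
      apply: ge0_le_integral => //.
      + apply/measurable_EFinP; apply: measurableT_comp => //.
        exact: (measurableT_comp mFn (pair2_measurable (s : TR))).
      + apply/measurable_EFinP; apply: measurable_funM => //; exact: measurableT_comp.
      + by move=> y _; rewrite -EFinM lee_fin normrM ler_wpM2r.
  rewrite ge0_integralZl//.
  - apply: (@le_lt_trans _ _ (K%:E * Bt%:E)%E); last by rewrite -EFinM ltry.
    by rewrite lee_wpmul2l//; exact: tint_iterated mF tB FB.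
  - apply: (measurable_fun_fubini_tonelli_F (m2 := mu)
      (fun z : TR * Rn R n => `|win t0 t1 z.1 (F z.1 z.2)|%:E)) => //.
    by apply/measurable_EFinP; exact: measurableT_comp.
  - by move=> s _; exact: integral_ge0.
(* For almost every y only is the time integral of F at y convergent, so k (x - y) is moved inside
   it almost everywhere. *)
transitivity (\int[mu]_y (\int[lam]_s Fn (y, s))).
  have fi : ((lam \x mu)%E).-integrable setT (fun z : TR * Rn R n => (Fn (z.2, z.1))%:E).
    by apply: (proj2 (integrable12ltyP lam mu _)) => //; exact/measurable_EFinP.
  have mwi : ((lam \x mu)%E).-integrable setT (fun z : TR * Rn R n => (win t0 t1 z.1 (F z.1
    z.2))%:E).
    apply: (proj2 (integrable12ltyP lam mu _)); first exact/measurable_EFinP.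
    apply: le_lt_trans (tint_iterated mF tB FB) _; exact: ltry.
  congr fine; apply: ae_eq_integral => //.
  - apply/measurable_EFinP; apply: measurable_funM; last exact: measurable_tint.
    exact: (measurableT_comp mk (measurable_subl x)).
  - by apply/measurable_EFinP; exact: (measurable_Rintegral_param lam mFn).
  apply: filterS (ae_integrable2 mwi) => y iy _; congr EFin.
  by rewrite /tint /Fn /= RintegralZl.
rewrite (Rintegral_swap mFn).
  apply: eq_Rintegral => s _; rewrite /Fn /= /win; case: ifP => // _.
  under eq_Rintegral do rewrite mulr0.
  by rewrite /Rintegral integral0.
rewrite (fubini_tonelli (m1 := mu) (m2 := lam) (fun z => `|Fn z|%:E))//.
by apply/measurable_EFinP; exact: measurableT_comp.
Qed.

End time_integral.

(** * Power weights in time *)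

Section time_bounds.
Context {R : realType}.
Local Notation TR := (measurableTypeR R).
Local Notation lam := (@lebesgue_measure R).
Implicit Types (f F B : R -> R) (a c d s t : R).

(** f may be singular at c, where F need not extend continuously: the fundamental theorem is applied
    on the intervals [e i, d] and followed by monotone convergence. *)
Lemma ge0_FTC_le f F c d (L : R) : c < d ->
  (forall x : R, c < x -> is_derive x 1 F (f x)) ->
  (forall x : R, c < x -> {for x, continuous f}) ->
  (forall x, c < x -> 0 <= f x) ->
  (forall x, c < x -> x < d -> F d - F x <= L) ->
  (\int[lam]_(s in `]c, d[) (f s)%:E <= L%:E)%E.
Proof.
move=> cd dF cf f0 FL.
(* The denominators start at 2, so that e i lies strictly between c and d for every i. *)
pose e (i : nat) : R := c + (d - c) / i.+2%:R.
have ec i : c < e i by rewrite /e ltrDl divr_gt0 ?subr_gt0.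
have ed i : e i < d.
  by rewrite /e -ltrBrDl ltr_pdivrMr// ltr_pMr ?subr_gt0// ltr1n.
have ce : {homo e : i j / (i <= j)%N >-> j <= i}.
  move=> i j ij; rewrite /e lerD2l ler_wpM2l ?subr_ge0 ?(ltW cd)//.
  by rewrite lef_pV2 ?posrE// ler_nat !ltnS.
pose S i : set TR := `[e i, d]%classic.
have Si i : (\int[lam]_(s in S i) (f s)%:E <= L%:E)%E.
  rewrite (@continuous_FTC2 _ f F).
  - by rewrite -EFinB lee_fin; exact: FL.
  - exact: ed.
  - apply: continuous_in_subspaceT => x; rewrite inE/= in_itv/= => /andP[ex _].
    by apply: cf; exact: lt_le_trans (ec i) ex.
  - have Fc x : c < x -> {for x, continuous F}.
      by move=> cx; apply/differentiable_continuous/derivable1_diffP; have [] := dF x cx.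
    split.
    + move=> x; rewrite in_itv/= => /andP[ex _].
      by have [] := dF x (lt_trans (ec i) ex).
    + by apply: cvg_at_right_filter; exact: Fc.
    + by apply: cvg_at_left_filter; exact: Fc.
  - move=> x; rewrite in_itv/= => /andP[ex _]; rewrite derive1E.
    by have [_ ->] := dF x (lt_trans (ec i) ex).
have Scd : `]c, d[%classic `<=` \bigcup_i S i.
  move=> x /=; rewrite in_itv/= => /andP[cx xd].
  have [N hN] : exists N : nat, (d - c) / (x - c) < N%:R.
    by exists (Num.truncn ((d - c) / (x - c))).+1; exact: truncnS_gt.
  exists N => //; suff : x \in `[e N, d] by [].
  rewrite in_itv/= (ltW xd) andbT /e -lerBrDl ler_pdivrMr//.
  have xc0 : 0 < x - c by rewrite subr_gt0.
  rewrite -ler_pdivrMl// mulrC ltW//; apply: lt_trans hN _.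
  by rewrite ltr_nat.
have mSf i : measurable_fun (S i) (fun s => (f s)%:E).
  apply/measurable_EFinP; apply: (@measurable_funS _ _ _ _ `]c, +oo[%classic) => //.
    move=> x Sx; have : x \in `[e i, d] := Sx.
    by rewrite /= !in_itv/= andbT => /andP[ex _]; exact: lt_le_trans (ec i) ex.
  apply: open_continuous_measurable_fun; first exact: interval_open.
  by move=> x; rewrite inE/= in_itv/= andbT; exact: cf.
have f0S i x : S i x -> (0 <= (f x)%:E)%E.
  move=> Sx; have : x \in `[e i, d] := Sx.
  rewrite in_itv/= lee_fin => /andP[ex _]; apply: f0; exact: lt_le_trans (ec i) ex.
have ndS : nondecreasing_seq S.
  move=> i j ij; apply/subsetPset => x Sx; have : x \in `[e i, d] := Sx.
  move=> xi; rewrite /S /mkset; move: xi; rewrite !in_itv/= => /andP[ex ->].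
  by rewrite andbT; apply: le_trans (ce _ _ ij) ex.
have cvS := @ge0_nondecreasing_set_cvg_integral _ _ _ S _ lam ndS (fun i => measurable_itv _)
  mSf f0S.
apply: (@le_trans _ _ (\int[lam]_(s in \bigcup_i S i) (f s)%:E)%E).
  apply: ge0_subset_integral => //.
  - by apply: bigcup_measurable => i _; exact: measurable_itv.
  - by apply/(measurable_fun_bigcup _ (fun i => measurable_itv `[e i, d])).
  - by move=> x [i _ Six]; exact: f0S Six.
have /cvg_lim <- // := cvS.
apply: lime_le; first by apply/cvg_ex; eexists; exact: cvS.
by apply: nearW => i.
Qed.

Lemma win_integralE t0 t1 (g : R -> R) :
  (\int[lam]_s (win t0 t1 s (g s))%:E = \int[lam]_(s in `]t0, t1[) (g s)%:E)%E.
Proof.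
rewrite [RHS]integral_mkcond; apply: eq_integral => s _.
by rewrite patchE mem_setE in_itv/= /win; case: ifP.
Qed.

Lemma tbound_le t0 t1 B Bt Bt' : Bt <= Bt' -> tbound t0 t1 B Bt -> tbound t0 t1 B Bt'.
Proof. by move=> BB [mB B0 BI]; split=> //; apply: le_trans BI _; rewrite lee_fin. Qed.

Lemma tboundZ k t0 t1 B Bt : 0 <= k -> tbound t0 t1 B Bt ->
  tbound t0 t1 (fun s => k * B s) (k * Bt).
Proof.
move=> k0 [mB B0 BI]; split.
- exact: measurable_funM.
- by move=> s st; rewrite mulr_ge0// B0.
- under eq_integral do rewrite winM EFinM.
  rewrite ge0_integralZl//.
  + by rewrite EFinM lee_wpmul2l// lee_fin.
  + by apply/measurable_EFinP; exact: measurable_win.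
  + by move=> s _; rewrite lee_fin /win; case: ifP => // /B0.
Qed.

Lemma winD t0 t1 s (b c : R) : win t0 t1 s (b + c) = win t0 t1 s b + win t0 t1 s c.
Proof. by rewrite /win; case: ifP => // _; rewrite addr0. Qed.

Lemma tboundD t0 t1 B B' Bt Bt' : tbound t0 t1 B Bt -> tbound t0 t1 B' Bt' ->
  tbound t0 t1 (fun s => B s + B' s) (Bt + Bt').
Proof.
move=> [mB B0 BI] [mB' B0' BI']; split.
- exact: measurable_funD.
- by move=> s st; rewrite addr_ge0 ?B0 ?B0'.
- under eq_integral do rewrite winD EFinD.
  rewrite ge0_integralD//.
  + by rewrite EFinD leeD.
  + by move=> s _; rewrite lee_fin /win; case: ifP => // /B0.
  + by apply/measurable_EFinP; exact: measurable_win.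
  + by move=> s _; rewrite lee_fin /win; case: ifP => // /B0'.
  + by apply/measurable_EFinP; exact: measurable_win.
Qed.

Lemma tbound_dom t0 t1 B B' Bt : measurable_fun [set: TR] B' ->
  (forall s, t0 < s < t1 -> 0 <= B' s <= B s) -> tbound t0 t1 B Bt -> tbound t0 t1 B' Bt.
Proof.
move=> mB' BB [mB B0 BI]; split=> //.
- by move=> s /BB/andP[].
- apply: le_trans BI; apply: ge0_le_integral => //.
  + by move=> s _; rewrite lee_fin /win; case: ifP => // /BB/andP[].
  + by apply/measurable_EFinP; exact: measurable_win.
  + by apply/measurable_EFinP; exact: measurable_win.
  + by move=> s _; rewrite lee_fin /win; case: ifP => // /BB/andP[].
Qed.

Lemma tbound_sub t0 t1 t0' t1' B Bt : t0 <= t0' -> t1' <= t1 ->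
  tbound t0 t1 B Bt -> tbound t0' t1' B Bt.
Proof.
move=> h0 h1 [mB B0 BI].
have imp s : t0' < s < t1' -> t0 < s < t1.
  by move=> /andP[a1 a2]; rewrite (le_lt_trans h0 a1) (lt_le_trans a2 h1).
split=> //; first by move=> s /imp; exact: B0.
apply: le_trans BI; apply: ge0_le_integral => //.
- by move=> s _; rewrite lee_fin /win; case: ifP => // /imp/B0.
- by apply/measurable_EFinP; exact: measurable_win.
- by apply/measurable_EFinP; exact: measurable_win.
- move=> s _; rewrite lee_fin /win; case: ifP => [/imp ->//|_].
  by case: ifP => // /B0.
Qed.

Lemma tbound_cst t0 t1 c : 0 <= c -> t0 <= t1 -> tbound t0 t1 (fun=> c) (c * (t1 - t0)).
Proof.
move=> c0 t01; split=> //; rewrite win_integralE.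
have e := @lebesgue_measure_itv R `]t0, t1[; rewrite /= lte_fin in e.
have -> : (\int[lam]_(x in `]t0, t1[) c%:E = (c * (if (t0 < t1)%R then (t1 - t0)%R else 0))%:E)%E.
  by rewrite integral_cst// EFinM; congr (_ * _)%E; apply: etrans e _; case: ifP.
by case: ifPn => // _; rewrite mulr0 lee_fin mulr_ge0// subr_ge0.
Qed.

Lemma measurable_powRB c (r : R) : measurable_fun [set: TR] (fun s => powR (s - c) r).
Proof.
apply: (@measurableT_comp _ _ _ _ _ _ (@powR R ^~ r)); first exact: measurable_powR.
exact: measurable_funB.
Qed.

Lemma is_derive_powRB c (r x : R) : c < x ->
  is_derive x 1 (fun s => powR (s - c) r) (r * powR (x - c) (r - 1)).
Proof.
move=> cx; have xc0 : 0 < x - c by rewrite subr_gt0.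
have d1 : is_derive x 1 (fun s : R => s - c) 1.
  by apply: is_derive_eq; rewrite subr0.
have d2 := @is_derive1_comp _ (@powR R ^~ r) _ x _ _ (is_derive1_powR r xc0) d1.
by apply: (is_derive_eq d2); rewrite mulr1.
Qed.

Lemma integral_powRB_le c d al L : c < d -> al != 1 ->
  (forall x, c < x -> x < d ->
     (powR (d - c) (1 - al) - powR (x - c) (1 - al)) / (1 - al) <= L) ->
  (\int[lam]_(s in `]c, d[) (powR (s - c) (- al))%:E <= L%:E)%E.
Proof.
move=> cd a1 hL; have a1' : 1 - al != 0 by rewrite subr_eq0 eq_sym.
apply: (@ge0_FTC_le _ (fun s => powR (s - c) (1 - al) / (1 - al))) => //.
- move=> x cx.
  have d1 := is_derive_powRB (1 - al) cx.
  have d2 : is_derive x 1 (fun s : R => powR (s - c) (1 - al) / (1 - al))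
     ((1 - al) * powR (x - c) (1 - al - 1) * (1 - al)^-1).
    by apply: is_derive_eq; rewrite /GRing.scale/=; ring.
  apply: (is_derive_eq d2); rewrite (_ : 1 - al - 1 = - al); last by ring.
  by field.
- move=> x cx; apply/differentiable_continuous/derivable1_diffP.
  by have [] := is_derive_powRB (- al) cx.
- by move=> x _; exact: powR_ge0.
- by move=> x cx xd; rewrite -mulrBl; exact: hL.
Qed.

Lemma tbound_powRl c d al : c <= d -> 0 <= al < 1 ->
  tbound c d (fun s => powR (s - c) (- al)) (powR (d - c) (1 - al) / (1 - al)).
Proof.
move=> cd /andP[a0 a1]; have a1' : 0 < 1 - al by rewrite subr_gt0.
split; first exact: measurable_powRB.
  by move=> s _; exact: powR_ge0.
rewrite win_integralE; move: cd; rewrite le_eqVlt => /orP[/eqP <-|cd].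
  by rewrite set_itv_ge ?integral_set0 ?lee_fin ?divr_ge0 ?powR_ge0 ?(ltW a1')// bnd_simp ltxx.
apply: integral_powRB_le => //; first by rewrite lt_eqF.
by move=> x _ _; rewrite ler_wpM2r ?invr_ge0 ?(ltW a1')// gerBl powR_ge0.
Qed.

Lemma tbound_reflect c d B Bt : measurable_fun [set: TR] B -> (forall s, 0 <= B s) ->
  tbound c d B Bt -> tbound c d (fun s => B (c + d - s)) Bt.
Proof.
move=> mB B0 [_ _ BI]; split=> //.
  by apply: (measurableT_comp mB); exact: measurable_funB.
apply: le_trans BI.
rewrite -(@ge0_integral_reflect1 _ (c + d) (fun s => (win c d s (B s))%:E)).
- rewrite le_eqVlt; apply/orP; left; apply/eqP; apply: eq_integral => s _; congr EFin.
  rewrite /win; congr (if _ then _ else _).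
  by apply/andP/andP => -[? ?]; split; lra.
- by apply/measurable_EFinP; exact: measurable_win.
- by move=> s; rewrite lee_fin /win; case: ifP.
Qed.

Lemma tbound_powRr c d al : c <= d -> 0 <= al < 1 ->
  tbound c d (fun s => powR (d - s) (- al)) (powR (d - c) (1 - al) / (1 - al)).
Proof.
move=> cd al01.
have := tbound_reflect (measurable_powRB c (- al)) (fun s => powR_ge0 _ _) (tbound_powRl cd al01).
by congr tbound; apply/funext => s; congr powR; ring.
Qed.

End time_bounds.

(** * Two singularities: integrals of Beta type *)

Section beta_bounds.
Context {R : realType}.
Local Notation TR := (measurableTypeR R).
Local Notation lam := (@lebesgue_measure R).
Implicit Types (c s t al r : R).

Lemma powR_half t r : 0 <= t -> powR (t / 2) (- r) = powR 2 r * powR t (- r).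
Proof.
move=> t0; rewrite powRM ?invr_ge0// mulrC; congr (_ * _).
by rewrite -powR_inv1// -powRrM mulN1r opprK.
Qed.

Lemma powR_DE t r1 r2 r : 0 < t -> r1 + r2 = r -> powR t r1 * powR t r2 = powR t r.
Proof. by move=> t0 <-; rewrite powRD//; apply/implyP => _; rewrite gt_eqF. Qed.

(** In each half of (c, t) one of the two factors is regular and is bounded by its value at the
    midpoint. *)
Lemma powR_split_le c s t al : 0 <= al -> c < s < t ->
  powR (t - s) (- 2^-1) * powR (s - c) (- al) <=
  powR ((t - c) / 2) (- 2^-1) * powR (s - c) (- al) +
  powR ((t - c) / 2) (- al) * powR (t - s) (- 2^-1).
Proof.
move=> al0 /andP[cs st]; have d0 : 0 < (t - c) / 2 by lra.
have sc0 : 0 < s - c by lra.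
have ts0 : 0 < t - s by lra.
have [h|h] := leP (s - c) ((t - c) / 2).
  apply: ler_wpDr; first by rewrite mulr_ge0 ?powR_ge0.
  by rewrite ler_wpM2r ?powR_ge0// powRN_anti//; lra.
apply: ler_wpDl; first by rewrite mulr_ge0 ?powR_ge0.
by rewrite mulrC ler_wpM2r ?powR_ge0// powRN_anti// ltW.
Qed.

Lemma measurable_powRBl t r : measurable_fun [set: TR] (fun s => powR (t - s) r).
Proof.
apply: (@measurableT_comp _ _ _ _ _ _ (@powR R ^~ r)); first exact: measurable_powR.
exact: measurable_funB.
Qed.

(** The bound I of the weight at c is left as a parameter: for al >= 1 it is finite only on
    intervals that stay away from c. *)
Lemma tbound_split c t0 t1 t al I : c <= t0 -> t0 <= t1 -> t1 <= t -> c < t -> 0 <= al ->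
  tbound t0 t1 (fun s => powR (s - c) (- al)) I ->
  tbound t0 t1 (fun s => powR (t - s) (- 2^-1) * powR (s - c) (- al))
    (powR ((t - c) / 2) (- 2^-1) * I + powR ((t - c) / 2) (- al) * (2 * powR (t - t0) 2^-1)).
Proof.
move=> ct0 t01 t1t ct al0 bI.
have b2 : tbound t0 t1 (fun s => powR (t - s) (- 2^-1)) (2 * powR (t - t0) 2^-1).
  apply: (tbound_sub (lexx _) t1t).
  have := @tbound_powRr R t0 t 2^-1 (le_trans t01 t1t) ltac:(lra).
  by rewrite (_ : 1 - 2^-1 = 2^-1 :> R) ?invrK; [rewrite mulrC|lra].
apply: tbound_dom (tboundD (tboundZ (powR_ge0 ((t - c) / 2) (- 2^-1)) bI)
  (tboundZ (powR_ge0 ((t - c) / 2) (- al)) b2)).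
  apply: measurable_funM; first exact: measurable_powRBl.
  exact: measurable_powRB.
move=> s /andP[h1 h2]; rewrite mulr_ge0 ?powR_ge0//=; apply: powR_split_le => //.
by rewrite (le_lt_trans ct0 h1) (lt_le_trans h2 t1t).
Qed.

(** An upper bound for the Beta function B(1/2, 1 - al), one summand for each half of the
    interval. *)
Definition cbeta al : R := powR 2 2^-1 / (1 - al) + powR 2 al * 2.

Lemma tbound_beta c t al : c < t -> 0 <= al < 1 ->
  tbound c t (fun s => powR (t - s) (- 2^-1) * powR (s - c) (- al))
    (cbeta al * powR (t - c) (2^-1 - al)).
Proof.
move=> ct al01; have /andP[al0 al1] := al01.
have := tbound_split (lexx c) (ltW ct) (lexx t) ct al0 (tbound_powRl (ltW ct) al01).
have d0 : 0 < t - c by rewrite subr_gt0.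
apply: tbound_le; rewrite !powR_half ?(ltW d0)// /cbeta le_eqVlt; apply/orP; left; apply/eqP.
rewrite [RHS]mulrDl; congr (_ + _).
  rewrite -(@powR_DE (t - c) (- 2^-1) (1 - al) (2^-1 - al))//; last by lra.
  by ring.
rewrite -(@powR_DE (t - c) (- al) 2^-1 (2^-1 - al))//; last by ring.
by ring.
Qed.

End beta_bounds.

(** * The heat semigroup and its derivative along a *)

Section heat_operators.
Context {R : realType} {n : nat} (a : 'rV[R]_n).
Local Notation mu := (leb R n).
Local Notation TR := (measurableTypeR R).
Local Notation lam := (@lebesgue_measure R).
Implicit Types (phi psi : 'rV[R]_n -> R) (s t h A B : R) (F : R -> 'rV[R]_n -> R).

(* [Eop t] is e^(t Delta) and [Dop t] is a . grad e^(t Delta), for t > 0. *)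
Definition Eop t phi := convol (gauss t) phi.
Definition Dop t phi := convol (dgauss a t) phi.
Definition cD : R := l1n a * @cdg R n.
Local Notation w t := (powR t (- 2^-1)).
Local Notation pn t := (powR t (- (n%:R / 2))).

Lemma cD_ge0 : 0 <= cD. Proof. by rewrite mulr_ge0 ?l1n_ge0 ?cdg_ge0. Qed.

Lemma cDw_ge0 t : 0 <= cD * w t. Proof. by rewrite mulr_ge0 ?cD_ge0 ?powR_ge0. Qed.

Lemma E_L1 t phi A : 0 < t -> L1le phi A -> L1le (Eop t phi) A.
Proof. by move=> t0 pA; have := convol_L1 (gauss_L1 t0) pA; rewrite mul1r. Qed.

Lemma E_bnd t phi B : 0 < t -> measurable_fun [set: Rn R n] phi -> bnd phi B -> bnd (Eop t phi) B.
Proof. by move=> t0 mp pB; have := convol_bnd (gauss_L1 t0) mp pB; rewrite mulr1. Qed.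

Lemma E_L1bnd t phi A : 0 < t -> L1le phi A -> bnd (Eop t phi) (pn t * A).
Proof. move=> t0; exact: convol_sup (@measurable_gauss R n t) (gauss_le t0). Qed.

Lemma D_L1 t phi A : 0 < t -> L1le phi A -> L1le (Dop t phi) (cD * w t * A).
Proof. by move=> t0 pA; exact: convol_L1 (dgauss_L1 a t0) pA. Qed.

Lemma D_bnd t phi B : 0 < t -> measurable_fun [set: Rn R n] phi -> bnd phi B ->
  bnd (Dop t phi) (cD * w t * B).
Proof. by move=> t0 mp pB; have := convol_bnd (dgauss_L1 a t0) mp pB; rewrite mulrC. Qed.

Lemma D_L1bnd t phi A : 0 < t -> L1le phi A -> bnd (Dop t phi) (cD * w t * pn t * A).
Proof. move=> t0; exact: convol_sup (@measurable_dgauss R n a t) (dgauss_bnd a t0). Qed.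

Lemma EE t s phi A : 0 < t -> 0 < s -> L1le phi A -> Eop t (Eop s phi) = Eop (t + s) phi.
Proof.
move=> t0 s0 pA; apply/funext => x.
by rewrite /Eop (convolA x (gauss_L1 t0) (gauss_le t0) (gauss_L1 s0) (gauss_le s0) pA)
  convol_gauss.
Qed.

Lemma DE t s phi A : 0 < t -> 0 < s -> L1le phi A -> Dop t (Eop s phi) = Dop (t + s) phi.
Proof.
move=> t0 s0 pA; apply/funext => x.
rewrite /Dop /Eop (convolA x (dgauss_L1 a t0) (dgauss_bnd a t0) (gauss_L1 s0) (gauss_le s0) pA).
by rewrite convol_dgauss_gauss.
Qed.

Lemma ED t s phi A : 0 < t -> 0 < s -> L1le phi A -> Eop t (Dop s phi) = Dop (t + s) phi.
Proof.
move=> t0 s0 pA; apply/funext => x.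
rewrite /Dop /Eop (convolA x (gauss_L1 t0) (gauss_le t0) (dgauss_L1 a s0) (dgauss_bnd a s0) pA).
rewrite (convolC (@measurable_gauss R n t) (@measurable_dgauss R n a s)).
by rewrite (convol_dgauss_gauss a s0 t0) (addrC s t).
Qed.

Lemma E_B t phi psi A B : 0 < t -> L1le phi A -> L1le psi B ->
  Eop t (fun y => phi y - psi y) = fun x => Eop t phi x - Eop t psi x.
Proof. move=> t0; exact: convolBr (@measurable_gauss R n t) (gauss_le t0). Qed.

Lemma D_B t phi psi A B : 0 < t -> L1le phi A -> L1le psi B ->
  Dop t (fun y => phi y - psi y) = fun x => Dop t phi x - Dop t psi x.
Proof. move=> t0; exact: convolBr (@measurable_dgauss R n a t) (dgauss_bnd a t0). Qed.

Definition cE : R := 2 * n%:R.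

Lemma Ediff s h phi A : 0 < s -> 0 < h -> L1le phi A ->
  (fun x => Eop s phi x - Eop (s + h) phi x) =
  convol (fun x => gauss s x - gauss (s + h) x) phi.
Proof.
move=> s0 h0 pA; have sh0 : 0 < s + h by rewrite addr_gt0.
by rewrite (convolBl (@measurable_gauss R n s) (gauss_le s0)
  (@measurable_gauss R n (s + h)) (gauss_le sh0) pA).
Qed.

Lemma Ediff_L1 s h phi A : 0 < s -> 0 < h -> L1le phi A ->
  L1le (fun x => Eop s phi x - Eop (s + h) phi x) (cE * powR (h / s) 4^-1 * A).
Proof.
by move=> s0 h0 pA; rewrite (Ediff s0 h0 pA); exact: convol_L1 (gauss_time_L1 s0 h0) pA.
Qed.

Lemma Ediff_bnd s h phi A B : 0 < s -> 0 < h -> L1le phi A -> bnd phi B ->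
  bnd (fun x => Eop s phi x - Eop (s + h) phi x) (cE * powR (h / s) 4^-1 * B).
Proof.
move=> s0 h0 pA pB; rewrite (Ediff s0 h0 pA) mulrC.
exact: convol_bnd (gauss_time_L1 s0 h0) (L1le_measurable pA) pB.
Qed.

(** Half of the time is reserved for the derivative, which reduces time increments of [Dop] to those
    of [Eop]. *)
Lemma Ddiff s h phi A : 0 < s -> 0 < h -> L1le phi A ->
  (fun x => Dop s phi x - Dop (s + h) phi x) =
  Dop (s / 2) (fun x => Eop (s / 2) phi x - Eop (s / 2 + h) phi x).
Proof.
move=> s0 h0 pA; have s20 : 0 < s / 2 by rewrite divr_gt0.
have sh0 : 0 < s / 2 + h by rewrite addr_gt0.
rewrite (D_B s20 (E_L1 s20 pA) (E_L1 sh0 pA)) (DE s20 s20 pA) (DE s20 sh0 pA).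
have -> : s / 2 + s / 2 = s by lra.
by have -> : s / 2 + (s / 2 + h) = s + h by lra.
Qed.

Definition cDE : R := cD * powR 2 2^-1 * (cE * powR 2 4^-1).

Lemma cE_ge0 : 0 <= cE. Proof. by rewrite mulr_ge0. Qed.

Lemma cDE_ge0 : 0 <= cDE. Proof. by apply: mulr_ge0; apply: mulr_ge0;
  rewrite ?cD_ge0 ?cE_ge0 ?powR_ge0. Qed.

Lemma cDE_eq s h : 0 < s -> 0 < h ->
  cD * w (s / 2) * (cE * powR (h / (s / 2)) 4^-1) =
  cDE * (powR h 4^-1 * powR s (- (3 / 4))).
Proof.
move=> s0 h0; rewrite powR_half ?(ltW s0)// /cDE.
rewrite (_ : h / (s / 2) = 2 * (h * s^-1)); last by field; lra.
rewrite powRM ?mulr_ge0 ?invr_ge0 ?(ltW s0) ?(ltW h0)//.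
rewrite powRM ?invr_ge0 ?(ltW s0) ?(ltW h0)//.
rewrite -[s^-1]powR_inv1 ?(ltW s0)// -powRrM mulN1r.
rewrite -(@powR_DE _ s (- 2^-1) (- 4^-1) (- (3 / 4)))//; last by lra.
by ring.
Qed.

Lemma Ddiff_L1 s h phi A : 0 < s -> 0 < h -> L1le phi A ->
  L1le (fun x => Dop s phi x - Dop (s + h) phi x)
    (cDE * (powR h 4^-1 * powR s (- (3 / 4))) * A).
Proof.
move=> s0 h0 pA; have s20 : 0 < s / 2 by rewrite divr_gt0.
rewrite (Ddiff s0 h0 pA) -cDE_eq// -mulrA.
exact: D_L1 s20 (Ediff_L1 s20 h0 pA).
Qed.

(** Two derivatives cost the power -1 of time in total. Charging only 1/8 of it to h leaves
    r^(-7/8), which is integrable at r = 0. *)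
Lemma DD_bnd h r phi A B : 0 < h -> 0 < r -> L1le phi A -> bnd phi B ->
  bnd (Dop h (Dop r phi))
    (cD ^+ 2 * powR 2 (7 / 8) * (powR h (- 8^-1) * powR r (- (7 / 8))) * B).
Proof.
move=> h0 r0 pA pB; have r20 : 0 < r / 2 by rewrite divr_gt0.
have hr0 : 0 < h + r / 2 by rewrite addr_gt0.
have pr := D_L1 r20 pA.
have -> : Dop h (Dop r phi) = Dop (h + r / 2) (Dop (r / 2) phi).
  by rewrite -(DE h0 r20 pr) (ED r20 r20 pA) -splitr.
have B0 : 0 <= B by exact: le_trans (pB 0).
have b := D_bnd hr0 (L1le_measurable pr) (D_bnd r20 (L1le_measurable pA) pB).
move=> x; apply: le_trans (b x) _.
rewrite [leLHS](_ : _ = cD ^+ 2 * (w (h + r / 2) * w (r / 2)) * B); last by ring.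
apply: ler_wpM2r => //; rewrite -mulrA; apply: ler_wpM2l; first by rewrite sqr_ge0.
apply: (@le_trans _ _ (powR h (- 8^-1) * powR (r / 2) (- (3 / 8)) * w (r / 2))).
  apply: ler_wpM2r; first exact: powR_ge0.
  rewrite -(@powR_DE _ (h + r / 2) (- 8^-1) (- (3 / 8)) (- 2^-1))//; last by lra.
  by apply: ler_pM; rewrite ?powR_ge0// powRN_anti//; lra.
rewrite -mulrA (@powR_DE _ (r / 2) (- (3 / 8)) (- 2^-1) (- (7 / 8)))//; last by lra.
by rewrite powR_half ?(ltW r0)// mulrCA.
Qed.

(* For s in the first half of (c, t) the smoothing of [Dop] from L^1 to L^oo is used,
   for s in the second half the sup bound on [phi]. *)
Lemma D_mixed (c s t b : R) phi : c < s < t -> L1le phi b -> bnd phi (pn (s - c) * b) ->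
  bnd (Dop (t - s) phi) (cD * pn ((t - c) / 2) * (w (t - s) * b)).
Proof.
move=> /andP[cs st] pb pB x; have ts0 : 0 < t - s by rewrite subr_gt0.
have sc0 : 0 < s - c by rewrite subr_gt0.
have b0 := L1le_ge0 pb.
have n20 : 0 <= n%:R / 2 :> R by rewrite divr_ge0.
have [h|h] := leP (s - c) ((t - c) / 2).
  apply: le_trans (D_L1bnd ts0 pb x) _.
  rewrite [leRHS](_ : _ = cD * w (t - s) * pn ((t - c) / 2) * b); last by ring.
  rewrite ler_wpM2r// ler_wpM2l ?cDw_ge0// powRN_anti//; lra.
apply: le_trans (D_bnd ts0 (L1le_measurable pb) pB x) _.
rewrite [leRHS](_ : _ = cD * w (t - s) * (pn ((t - c) / 2) * b)); last by ring.
rewrite ler_wpM2l ?cDw_ge0// ler_wpM2r// powRN_anti//; lra.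
Qed.

(** Integration by parts, in the form that [dgauss] is odd. *)
Lemma D_dual t phi psi A B : 0 < t -> L1le phi A -> L1le psi B ->
  \int[mu]_x (Dop t phi x * psi x) = - \int[mu]_x (phi x * Dop t psi x).
Proof.
move=> t0 pA qB.
rewrite /Dop (convol_dual (@measurable_dgauss R n a t) (dgauss_bnd a t0) pA qB).
have -> : (fun y : 'rV[R]_n => dgauss a t (- y)) = fun y => (-1) * dgauss a t y.
  by apply/funext => y; rewrite dgaussN mulN1r.
have pD := L1leM pA (L1le_measurable (D_L1 t0 qB)) (D_L1bnd t0 qB).
rewrite -[RHS]mulN1r -(RintZ (-1) pD).
apply: eq_Rintegral => x _; rewrite mulrCA; congr (_ * _).
rewrite -(RintZ (-1) (convol_L1le x (@measurable_dgauss R n a t) (dgauss_bnd a t0) qB)).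
by apply: eq_Rintegral => y _; rewrite mulrA.
Qed.

Lemma E_dual t phi psi A B : 0 < t -> L1le phi A -> L1le psi B ->
  \int[mu]_x (Eop t phi x * psi x) = \int[mu]_x (phi x * Eop t psi x).
Proof.
move=> t0 pA qB.
rewrite /Eop (convol_dual (@measurable_gauss R n t) (gauss_le t0) pA qB).
have -> : (fun y : 'rV[R]_n => gauss t (- y)) = gauss t by apply/funext => y; exact: gaussN.
by [].
Qed.

End heat_operators.

(** * Duhamel integrals *)

Section duhamel_integral.
Context {R : realType} {n : nat} (a : 'rV[R]_n).
Local Notation mu := (leb R n).
Local Notation TR := (measurableTypeR R).
Local Notation lam := (@lebesgue_measure R).
Local Notation w t := (powR t (- 2^-1)).
Local Notation pn t := (powR t (- (n%:R / 2))).
Implicit Types (F G : R -> 'rV[R]_n -> R) (s t : R) (x : 'rV[R]_n) (b : R -> R).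

Lemma measurable_gauss_jt :
  measurable_fun [set: TR * Rn R n] (fun z => gauss (z.1 : R) (z.2 : 'rV[R]_n)).
Proof. exact: measurable_gauss_joint. Qed.

Lemma measurable_dgauss_jt :
  measurable_fun [set: TR * Rn R n] (fun z => dgauss a (z.1 : R) (z.2 : 'rV[R]_n)).
Proof.
apply: measurable_funM; last exact: measurable_gauss_jt.
apply: measurable_funN; apply: measurable_funM.
  exact: (measurableT_comp (measurable_dot a) measurable_snd).
apply: (@measurableT_comp _ _ _ _ _ _ (fun x : R => x^-1)); first exact: measurable_invr.
by apply: measurable_funM => //; exact: measurable_fst.
Qed.

(** The time of the kernel, the time of F and the point are independent measurable parameters, so
    that this covers Duhamel integrands both at a fixed and at a variable final time. *)
Lemma measurable_convol_family d (S : measurableType d) (ker : R -> 'rV[R]_n -> R)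
    F (tau s : S -> TR) (x : S -> Rn R n) :
  measurable_fun [set: TR * Rn R n] (fun z => ker z.1 z.2) -> jmeas F ->
  measurable_fun setT tau -> measurable_fun setT s -> measurable_fun setT x ->
  measurable_fun setT (fun z => convol (ker (tau z)) (F (s z)) (x z)).
Proof.
move=> mk mF mtau ms mx.
apply: (measurable_Rintegral_param mu
  (f := fun z : S * Rn R n => ker (tau z.1) ((x z.1 : 'rV[R]_n) - z.2) * F (s z.1) z.2)).
have m1 : measurable_fun setT (fun z : S * Rn R n => (tau z.1, ((x z.1 : 'rV[R]_n) - z.2 :
  'rV[R]_n) : Rn R n)).
  apply: measurable_fun_pair; first exact: (measurableT_comp mtau measurable_fst).
  apply: measurable_sub2; last exact: measurable_snd.
  exact: (measurableT_comp mx measurable_fst).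
have m2 : measurable_fun setT (fun z : S * Rn R n => (s z.1, z.2)).
  apply: measurable_fun_pair; last exact: measurable_snd.
  exact: (measurableT_comp ms measurable_fst).
by apply: measurable_funM; [exact: (measurableT_comp mk m1)|exact: (measurableT_comp mF m2)].
Qed.

Lemma jmeas_D F t : jmeas F -> jmeas (fun s => Dop a (t - s) (F s)).
Proof.
move=> mF; apply: (measurable_convol_family measurable_dgauss_jt mF).
- by apply: measurable_funB => //; exact: measurable_fst.
- exact: measurable_fst.
- exact: measurable_snd.
Qed.

Lemma jmeas_E (phi : 'rV[R]_n -> R) : measurable_fun [set: Rn R n] phi ->
  jmeas (fun t => Eop t phi).
Proof.
move=> mp; apply: (measurable_convol_family (F := fun=> phi) measurable_gauss_jt).
- exact: (measurableT_comp mp measurable_snd).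
- exact: measurable_fst.
- exact: measurable_fst.
- exact: measurable_snd.
Qed.

Definition duh F t0 t1 t : 'rV[R]_n -> R := tint (fun s => Dop a (t - s) (F s)) t0 t1.

Lemma jmeas_tint_param (G : R -> R -> 'rV[R]_n -> R) (t0 t1 : R -> R) :
  measurable_fun [set: TR] t0 -> measurable_fun [set: TR] t1 ->
  measurable_fun [set: (TR * Rn R n) * TR] (fun z => G z.1.1 z.2 z.1.2) ->
  jmeas (fun t => tint (G t) (t0 t) (t1 t)).
Proof.
move=> m0 m1 mG.
apply: (measurable_Rintegral_param lam
  (f := fun z : (TR * Rn R n) * TR => win (t0 z.1.1) (t1 z.1.1) z.2 (G z.1.1 z.2 z.1.2))).
have mf : measurable_fun [set: (TR * Rn R n) * TR] (fun z => z.1.1).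
  exact: (measurableT_comp measurable_fst measurable_fst).
apply: measurable_win => //.
- exact: (measurableT_comp m0 mf).
- exact: (measurableT_comp m1 mf).
Qed.

Lemma jmeas_duh F (t0 t1 : R -> R) : jmeas F ->
  measurable_fun [set: TR] t0 -> measurable_fun [set: TR] t1 ->
  jmeas (fun t => duh F (t0 t) (t1 t) t).
Proof.
move=> mF m0 m1; apply: (jmeas_tint_param (G := fun t s => Dop a (t - s) (F s))) => //.
have mf : measurable_fun [set: (TR * Rn R n) * TR] (fun z => z.1.1).
  exact: (measurableT_comp measurable_fst measurable_fst).
apply: (measurable_convol_family measurable_dgauss_jt mF).
- by apply: measurable_funB => //; exact: measurable_snd.
- exact: measurable_snd.
- exact: (measurableT_comp measurable_snd measurable_fst).
Qed.

Lemma duh_L1 F t0 t1 t b Bt : jmeas F -> t1 <= t ->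
  (forall s, t0 < s < t1 -> L1le (F s) (b s)) ->
  tbound t0 t1 (fun s => w (t - s) * b s) Bt -> L1le (duh F t0 t1 t) (cD a * Bt).
Proof.
move=> mF t1t FB tB; apply: (tint_L1 (jmeas_D t mF) (tboundZ (cD_ge0 a) tB)) => s st.
have ts0 : 0 < t - s by case/andP: st => _ st1; rewrite subr_gt0 (lt_le_trans st1).
by rewrite mulrA; exact: D_L1 (FB s st).
Qed.

Lemma duh_bnd F t0 t1 t b Bt : jmeas F -> t1 <= t ->
  (forall s, t0 < s < t1 -> bnd (F s) (b s)) ->
  tbound t0 t1 (fun s => w (t - s) * b s) Bt -> bnd (duh F t0 t1 t) (cD a * Bt).
Proof.
move=> mF t1t FB tB x; apply: (tint_bnd (jmeas_D t mF) (tboundZ (cD_ge0 a) tB)) => s st.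
have ts0 : 0 < t - s by case/andP: st => _ st1; rewrite subr_gt0 (lt_le_trans st1).
by rewrite mulrA; apply: D_bnd (FB s st) x => //; exact: jmeas_at.
Qed.

(** c is the time from which decay is counted: the restart time in the bootstrap for the decay, and
    0 in the comparison with the profiles. *)
Lemma duh_mixed F c t0 t1 t b Bt : jmeas F -> c <= t0 -> t1 <= t ->
  (forall s, t0 < s < t1 -> L1le (F s) (b s)) ->
  (forall s, t0 < s < t1 -> bnd (F s) (pn (s - c) * b s)) ->
  tbound t0 t1 (fun s => w (t - s) * b s) Bt ->
  bnd (duh F t0 t1 t) (cD a * pn ((t - c) / 2) * Bt).
Proof.
move=> mF ct0 t1t FB FB' tB x.
have c0 : 0 <= cD a * pn ((t - c) / 2) by rewrite mulr_ge0 ?cD_ge0 ?powR_ge0.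
apply: (tint_bnd (jmeas_D t mF) (tboundZ c0 tB)) => s st.
have cst : c < s < t.
  by case/andP: st => st0 st1; rewrite (le_lt_trans ct0 st0) (lt_le_trans st1).
exact: D_mixed cst (FB s st) (FB' s st) x.
Qed.

Lemma E_duh F t0 t1 t h b Bt : jmeas F -> t1 <= t -> 0 < h ->
  (forall s, t0 < s < t1 -> L1le (F s) (b s)) ->
  tbound t0 t1 (fun s => w (t - s) * b s) Bt ->
  Eop h (duh F t0 t1 t) = duh F t0 t1 (t + h).
Proof.
move=> mF t1t h0 FB tB; apply/funext => x.
have ts0 s : t0 < s < t1 -> 0 < t - s.
  by case/andP => _ st1; rewrite subr_gt0 (lt_le_trans st1).
rewrite /Eop /duh (convol_tint x (@measurable_gauss R n h) (gauss_le h0) (jmeas_D t mF)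
  (tboundZ (cD_ge0 a) tB)).
  apply: eq_tint => s st; rewrite -/(Eop h _) (ED a h0 (ts0 s st) (FB s st)).
  by rewrite addrA [h + t]addrC.
move=> s st; rewrite mulrA; exact: D_L1 (ts0 s st) (FB s st).
Qed.

Lemma D_duh F t0 t1 t h b Bt x : jmeas F -> t1 <= t -> 0 < h ->
  (forall s, t0 < s < t1 -> L1le (F s) (b s)) ->
  tbound t0 t1 (fun s => w (t - s) * b s) Bt ->
  Dop a h (duh F t0 t1 t) x = tint (fun s => Dop a h (Dop a (t - s) (F s))) t0 t1 x.
Proof.
move=> mF t1t h0 FB tB.
have ts0 s : t0 < s < t1 -> 0 < t - s.
  by case/andP => _ st1; rewrite subr_gt0 (lt_le_trans st1).
rewrite /Dop /duh (convol_tint x (@measurable_dgauss R n a h) (dgauss_bnd a h0) (jmeas_D t mF)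
  (tboundZ (cD_ge0 a) tB))// => s st.
by rewrite mulrA; exact: D_L1 (ts0 s st) (FB s st).
Qed.

End duhamel_integral.

(** * Truncation *)

Section clip.
Context {R : realType}.
Implicit Types (K z : R).

Definition clip K z : R := Num.max (- K) (Num.min K z).

Lemma clip_le K z : 0 <= K -> `|clip K z| <= K.
Proof. by move=> K0; rewrite /clip ler_norml le_max lexx /= ge_max ge_min lexx /=; lra. Qed.

Lemma clip_id K z : `|z| <= K -> clip K z = z.
Proof.
by rewrite ler_norml => /andP[h1 h2]; rewrite /clip (min_idPr h2) (max_idPr h1).
Qed.

Lemma clip_lip K z z' : `|clip K z - clip K z'| <= `|z - z'|.
Proof.
rewrite /clip !maxElt !minElt; repeat case: ifPn; rewrite -?leNgt => *;
  rewrite ler_norml; have := ler_norm (z - z'); have := ler_norm (- (z - z'));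
  rewrite normrN => *; apply/andP; split; lra.
Qed.

Lemma clip_norm K z : 0 <= K -> `|clip K z| <= `|z|.
Proof.
move=> K0; have := clip_lip K z 0; rewrite (clip_id (z := 0)) ?normr0// !subr0//.
Qed.

Lemma measurable_clip K : measurable_fun [set: R] (clip K).
Proof. by apply: measurable_maxr => //; exact: measurable_minr. Qed.

End clip.

(** * The given norms and equality almost everywhere *)

Section lq_norms.
Context {R : realType} {n : nat}.
Local Notation mu := (leb R n).
Implicit Types (f g : 'rV[R]_n -> R) (A K : R).

Lemma Lq_norm1E f : measurable_fun [set: Rn R n] f ->
  Lq_norm 1%E f = (\int[mu]_x `|f x|%:E)%E.
Proof.
move=> mf; rewrite /Lq_norm invr1 poweRe1; last first.
  rewrite (ge0_iintE (f := fun x : Rn R n => (powR `|f x| 1)%:E)).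
  - by apply: integral_ge0 => x _; rewrite lee_fin powR_ge0.
  - apply/measurable_EFinP.
    apply: (@measurableT_comp _ _ _ _ _ _ (@powR R ^~ 1)); first exact: measurable_powR.
    exact: measurableT_comp.
  - by move=> x; rewrite lee_fin powR_ge0.
rewrite -(ge0_iintE (f := fun x : Rn R n => `|f x|%:E))//; last first.
  by apply/measurable_EFinP; exact: measurableT_comp.
by congr iint; apply/funext => x; rewrite powRr1.
Qed.

Lemma L1le_Lq f A : measurable_fun [set: Rn R n] f ->
  (Lq_norm 1%E f <= A%:E)%E -> L1le f A.
Proof. by move=> mf; rewrite Lq_norm1E. Qed.

Lemma in_L1_L1le f : in_Lq 1%E f -> exists A, L1le f A.
Proof.
move=> [/borel_funP mf]; rewrite Lq_norm1E// => fy.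
exists (\int[mu]_x `|f x|); split=> //.
by rewrite /Rintegral fineK// ge0_fin_numE//; exact: integral_ge0.
Qed.

Lemma lmeasE (A : set (Rn R n)) : measurable A -> lmeas A = mu A.
Proof.
move=> mA; rewrite /lmeas (ge0_iintE (f := fun x : Rn R n => (\1_A x)%:E)).
- by rewrite integral_indic// setIT.
- by apply/measurable_EFinP; exact: measurable_indic.
- by move=> x; rewrite lee_fin.
Qed.

Lemma ae_eqP f g : measurable_fun [set: Rn R n] f -> measurable_fun [set: Rn R n] g ->
  Defs.ae_eq f g -> {ae mu, forall x, f x = g x}.
Proof.
move=> mf mg fg; exists [set x | f x != g x]; split.
- have := measurable_neg (measurable_fun_eqr mf mg) => /(_ measurableT [set true] I).
  by rewrite setTI; congr measurable; apply/seteqP; split=> x /=; case: (f x == g x).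
- move: fg; rewrite /Defs.ae_eq lmeasE//.
  have := measurable_neg (measurable_fun_eqr mf mg) => /(_ measurableT [set true] I).
  by rewrite setTI; congr measurable; apply/seteqP; split=> x /=; case: (f x == g x).
- by move=> x /= fgx; apply/eqP.
Qed.

(** The slack 1 provides an admissible level below K + 1, so a single null set is enough and no
    countable union is formed. *)
Lemma esssup_ae f K : measurable_fun [set: Rn R n] f -> 0 <= K ->
  (Lq_norm +oo%E f <= K%:E)%E -> {ae mu, forall x, `|f x| <= K + 1}.
Proof.
move=> mf K0 fK.
have : (Lq_norm +oo%E f < (K + 1)%:E)%E.
  by apply: le_lt_trans fK _; rewrite lte_fin; lra.
rewrite /Lq_norm /esssup_abs => /ereal_inf_lt[M [M0 MA] MK].
have mA : measurable ([set x : Rn R n | (M < `|f x|%:E)%E]).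
  have mE : measurable_fun [set: Rn R n] (fun x => `|f x|%:E).
    by apply/measurable_EFinP; exact: measurableT_comp.
  have := emeasurable_fun_o_infty measurableT mE M.
  by rewrite setTI.
exists [set x | (M < `|f x|%:E)%E]; split=> //; first by rewrite -lmeasE.
move=> x /=; apply: contra_notP => /negP; rewrite -leNgt => fM.
by rewrite -lee_fin; apply: le_trans fM (ltW MK).
Qed.

Lemma L1le_ae f g A : measurable_fun [set: Rn R n] g -> {ae mu, forall x, f x = g x} ->
  L1le f A -> L1le g A.
Proof.
move=> mg fg [mf fA]; split=> //; apply: le_trans fA.
rewrite le_eqVlt; apply/orP; left; apply/eqP; apply: ae_eq_integral => //.
- by apply/measurable_EFinP; exact: measurableT_comp.
- by apply/measurable_EFinP; exact: measurableT_comp.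
- by case: fg => N [mN N0 sN]; exists N; split=> // x /= h; apply: sN => /= e; apply: h => _;
  rewrite e.
Qed.

Lemma ae_trans f g h : {ae mu, forall x, f x = g x} -> {ae mu, forall x, g x = h x} ->
  {ae mu, forall x, f x = h x}.
Proof.
move=> [N [mN N0 sN]] [N' [mN' N0' sN']]; exists (N `|` N'); split.
- exact: measurableU.
- by rewrite measureU0.
- move=> x /= xh; have [e|e] := eqVneq (f x) (g x).
    by right; apply: sN' => /= e'; apply: xh; rewrite e.
  by left; apply: sN => /=; apply/eqP.
Qed.

Lemma ae_imp f g (P : 'rV[R]_n -> Prop) : {ae mu, forall x, P x} ->
  (forall x, P x -> f x = g x) -> {ae mu, forall x, f x = g x}.
Proof.
by move=> [N [mN N0 sN]] Pfg; exists N; split=> // x /= xh; apply: sN => /= /Pfg.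
Qed.

Lemma ae_sym f g : {ae mu, forall x, f x = g x} -> {ae mu, forall x, g x = f x}.
Proof. by move=> fg; apply: (ae_imp fg) => x ->. Qed.

End lq_norms.

(** * Functions that are piecewise constant in time *)

Section step_approximation.
Context {R : realType} {n : nat} (a : 'rV[R]_n).
Local Notation mu := (leb R n).
Local Notation TR := (measurableTypeR R).

Lemma measurable_nat_case d (S : measurableType d) (N : S -> nat) (h : nat -> S -> R) :
  (forall j, measurable (N @^-1` [set j])) -> (forall j, measurable_fun setT (h j)) ->
  measurable_fun setT (fun z => h (N z) z).
Proof.
move=> mN mh _ B mB; rewrite setTI.
have -> : (fun z => h (N z) z) @^-1` B =
    \bigcup_j (N @^-1` [set j] `&` (h j) @^-1` B).
  apply/seteqP; split=> z /=; first by exists (N z).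
  by move=> [j _ [/= -> ]].
apply: bigcupT_measurable => j; apply: measurableI => //.
by rewrite -[_ @^-1` _]setTI; exact: mh.
Qed.

(** By monotonicity of the truncation the preimage is an interval. *)
Lemma measurable_truncn (c : R) (j : nat) : 0 < c ->
  measurable ((fun s : TR => Num.truncn ((s : R) * c)) @^-1` [set j]).
Proof.
move=> c0; apply: is_interval_measurable => x y /= xj yj z /andP[xz zy]; apply/eqP.
rewrite eqn_leq -{1}yj -xj; apply/andP; split; apply: Num.Theory.le_truncn;
  by rewrite ler_wpM2r// ltW.
Qed.

End step_approximation.

(* The solution is only continuous in time with values in L^1, so its joint measurability
   is not given; it is recovered for the heat-smoothed flux as a limit of functions that
   are piecewise constant in time. *)
Section weak_curve.
Context {R : realType} {n : nat} (a : 'rV[R]_n).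
Local Notation mu := (leb R n).
Local Notation TR := (measurableTypeR R).
Local Notation lam := (@lebesgue_measure R).
Local Notation w t := (powR t (- 2^-1)).
Local Notation pn t := (powR t (- (n%:R / 2))).

(** The next point after s of the grid of mesh 1 / (k + 1). Rounding upwards keeps it positive,
    where the curve is controlled. *)
Definition step_up (k : nat) (s : R) : R := (Num.truncn (s * k.+1%:R)).+1%:R / k.+1%:R.

Lemma step_up_itv k s : 0 < s -> s < step_up k s <= s + k.+1%:R^-1.
Proof.
move=> s0; have sk0 : 0 <= s * k.+1%:R by rewrite mulr_ge0// ltW.
have /andP[h1 h2] := truncn_itv sk0.
rewrite /step_up ltr_pdivlMr// h2/= ler_pdivrMr// mulrDl mulVf ?pnatr_eq0// -natr1.
by rewrite lerD2r.
Qed.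

Lemma measurable_D_weak (g : R -> 'rV[R]_n -> R) A :
  (forall s, 0 < s -> L1le (g s) A) ->
  (forall s0, 0 < s0 -> forall e, 0 < e -> exists2 d, 0 < d &
    forall s, 0 < s -> `|s - s0| < d -> L1le (fun x => g s x - g s0 x) e) ->
  measurable_fun [set: (TR * Rn R n) * TR]
    (fun z => win 0 z.1.1 z.2 (Dop a (z.1.1 - z.2) (g z.2) z.1.2)).
Proof.
move=> gA gc.
pose h (k : nat) (z : (TR * Rn R n) * TR) : R :=
  win 0 z.1.1 z.2 (Dop a (z.1.1 - z.2) (g (step_up k z.2)) z.1.2).
have mf : measurable_fun [set: (TR * Rn R n) * TR] (fun z => z.1.1).
  exact: (measurableT_comp measurable_fst measurable_fst).
apply: (measurable_fun_cvg (h := h)) => [k|z _].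
  have mgk : jmeas (fun s => g (step_up k s)).
    apply: (@measurable_nat_case R _ _ (fun z : TR * Rn R n => Num.truncn ((z.1 : R) * k.+1%:R))
      (fun j z => g (j.+1%:R / k.+1%:R) z.2)) => j.
      rewrite -[X in measurable X]setTI.
      exact: (@measurable_fst _ _ TR (Rn R n) measurableT _ (measurable_truncn j (ltr0Sn R k))).
    have jk0 : 0 < j.+1%:R / k.+1%:R :> R by rewrite divr_gt0.
    exact: (measurableT_comp (L1le_measurable (gA _ jk0)) measurable_snd).
  apply: measurable_win; [exact: measurable_cst|exact: mf|exact: measurable_snd|].
  apply: (measurable_convol_family (measurable_dgauss_jt a) mgk).
  - by apply: measurable_funB => //; exact: measurable_snd.
  - exact: measurable_snd.
  - exact: (measurableT_comp measurable_snd measurable_fst).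
case: z => -[t x] s; rewrite /h /=.
have [/andP[s0 st]|nst] := boolP ((0 < s) && (s < t)); last first.
  rewrite /win (negbTE nst); exact: cvg_cst.
rewrite /win s0 st /=.
have ts0 : 0 < t - s by rewrite subr_gt0.
(* The norm of [Dop a (t - s)] from L^1 to L^oo; it turns continuity of g in L^1 into convergence at
   every point x. *)
set c := cD a * w (t - s) * pn (t - s).
have c0 : 0 <= c by apply: mulr_ge0; [exact: cDw_ge0|exact: powR_ge0].
apply/cvgrPdist_le => e e0.
have e10 : 0 < e / (c + 1) by rewrite divr_gt0// ltr_wpDl.
have [d d0 hd] := gc s s0 _ e10.
near=> k.
have /andP[k1 k2] := step_up_itv k s0.
have sk0 := lt_trans s0 k1.
have kd : k.+1%:R^-1 < d.
  near: k; have /cvgrPdist_lt /(_ d d0) := @cvg_harmonic R.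
  by apply: filterS => k; rewrite sub0r normrN /harmonic/= ger0_norm// invr_ge0.
have hb : `|step_up k s - s| < d by rewrite ger0_norm ?subr_ge0 ?(ltW k1)// ltrBlDl (le_lt_trans
  k2)// ltrD2l.
have hL := hd _ sk0 hb.
have := D_L1bnd a ts0 hL x; rewrite (D_B a ts0 (gA _ sk0) (gA _ s0)) distrC => /le_trans; apply.
rewrite -/c mulrA ler_pdivrMr ?ltr_wpDl// mulrC ler_wpM2l ?(ltW e0)//; lra.
Unshelve. all: by end_near. Qed.

End weak_curve.

(** * Representatives of the solution *)

Section regularization.
Context {R : realType} {n : nat} (a : 'rV[R]_n).
Local Notation mu := (leb R n).
Local Notation TR := (measurableTypeR R).
Local Notation lam := (@lebesgue_measure R).

Lemma heatE tau (phi : 'rV[R]_n -> R) A : 0 < tau -> L1le phi A ->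
  heat tau phi = Eop tau phi.
Proof.
move=> t0 pA; rewrite /heat gt_eqF//; apply/funext => x; rewrite /rint /Eop /convol.
congr fine; apply: (iintE (f := fun y : Rn R n => (gauss tau (x - y) * phi y)%:E)).
exact: L1le_integrable (convol_L1le x (@measurable_gauss R n tau) (gauss_le t0) pA).
Qed.

(** [duhamel] integrates over a closed interval, [duh] over an open one. The end points are
    discarded because at s = t the operator [heat 0] is the identity and the derivative is not under
    control. *)
Lemma duhamelE (f : R -> R) (v F : R -> 'rV[R]_n -> R) t0 t1 t x :
  (forall s, t0 < s < t1 -> 'D_a (heat (t - s) (f \o v s)) x = Dop a (t - s) (F s) x) ->
  measurable_fun [set: TR] (fun s => win t0 t1 s (Dop a (t - s) (F s) x)) ->
  duhamel a f v t0 t1 t x = duh a F t0 t1 t x.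
Proof.
move=> vF mF; rewrite /duhamel; congr fine.
have eqw s : t0 < s < t1 ->
    ('D_a (heat (t - s) (f \o v s)) x)%:E = (win t0 t1 s (Dop a (t - s) (F s) x))%:E.
  by move=> st; rewrite vF// /win st.
rewrite (@integral_itv_bndoo R).
  rewrite [LHS]integral_mkcond; apply: eq_integral => s _; rewrite patchE mem_setE in_itv/=.
  by case: ifPn => [st|st]; [exact: eqw|rewrite /win (negbTE st)].
apply: (eq_measurable_fun (fun s => (win t0 t1 s (Dop a (t - s) (F s) x))%:E)).
  by move=> s; rewrite inE/= in_itv/= => st; rewrite -eqw.
by apply: measurable_funTS; exact/measurable_EFinP.
Qed.

Lemma derive_heat tau (phi : 'rV[R]_n -> R) A x : 0 < tau -> L1le phi A ->
  'D_a (heat tau phi) x = Dop a tau phi x.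
Proof. by move=> t0 pA; rewrite (heatE t0 pA); exact: derive_convol_gauss t0 pA. Qed.

Lemma lip_local (f : R -> R) (C p K : R) : 1 < p -> 0 <= K ->
  (forall xi eta, `|f xi - f eta| <=
      C * (powR `|xi| (p - 1) + powR `|eta| (p - 1)) * `|xi - eta|) ->
  forall xi eta, `|xi| <= K -> `|eta| <= K ->
    `|f xi - f eta| <= `|C| * (2 * powR K (p - 1)) * `|xi - eta|.
Proof.
move=> p1 K0 flip xi eta xK eK; apply: le_trans (flip xi eta) _.
apply: ler_wpM2r => //.
apply: (@le_trans _ _ (`|C| * (powR `|xi| (p - 1) + powR `|eta| (p - 1)))).
  by rewrite ler_wpM2r ?addr_ge0 ?powR_ge0 ?ler_norm.
rewrite ler_wpM2l// mulr2n mulrDl mul1r lerD// ge0_ler_powR ?nnegrE//; lra.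
Qed.

Lemma L1le_lip (f : R -> R) K L A (phi : 'rV[R]_n -> R) : measurable_fun setT f ->
  f 0 = 0 -> 0 <= K -> 0 <= L ->
  (forall xi eta, `|xi| <= K -> `|eta| <= K -> `|f xi - f eta| <= L * `|xi - eta|) ->
  bnd phi K -> L1le phi A -> L1le (f \o phi) (L * A).
Proof.
move=> mf f0 K0 L0 lip pK pA; apply: (L1le_dom _ _ L0 pA).
  exact: (measurableT_comp mf (L1le_measurable pA)).
by move=> x; have := lip (phi x) 0 (pK x); rewrite f0 !subr0 normr0; exact.
Qed.

(* [U] is given by the Duhamel formula at every point, and [V] is its truncation to
   [-K, K]; both agree almost everywhere with the solution. *)
Definition mild (f : R -> R) (u0 : 'rV[R]_n -> R) (K M : R)
    (U V : R -> 'rV[R]_n -> R) : Prop :=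
  [/\ jmeas V, (forall t, 0 < t -> L1le (V t) M), (forall t x, `|V t x| <= K),
   (forall t x, `|V t x| <= `|U t x|) & (forall t t' x, `|V t x - V t' x| <= `|U t x - U t' x|)]
     /\
  [/\ jmeas U, (forall t, 0 < t -> {ae mu, forall x, V t x = U t x}) &
   (forall t x, 0 < t -> U t x = Eop t u0 x + duh a (fun s => f \o V s) 0 t t x)].

Lemma solution_mild (f : R -> R) (C p : R) (u0 : 'rV[R]_n -> R) (u : R -> 'rV[R]_n -> R) :
  measurable_fun setT f -> f 0 = 0 -> 1 < p ->
  (forall xi eta, `|f xi - f eta| <=
      C * (powR `|xi| (p - 1) + powR `|eta| (p - 1)) * `|xi - eta|) ->
  in_Lq 1%E u0 -> global_solution a f u0 u ->
  exists K M U V, [/\ 0 <= K, mild f u0 K M U V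
    & forall t, 0 < t -> {ae mu, forall x, u t x = V t x}].
Proof.
move=> mf f0 p1 flip u0L [H1 [H2 [_ [H4 [[M HM] [_ [[K0 HK] H8]]]]]]].
have [A0 u0A] := in_L1_L1le u0L.
have mu_ t : 0 <= t -> measurable_fun [set: Rn R n] (u t).
  by move=> t0; have [/borel_funP] := H1 t t0.
(* The added 1 is the slack of [esssup_ae]. *)
pose K := `|K0| + 1; have K0' : 0 <= K by rewrite addr_ge0.
have uK t : 0 < t -> {ae mu, forall x, `|u t x| <= K}.
  move=> t0; apply: (@esssup_ae _ _ _ `|K0|) => //; first by apply: mu_; exact: ltW.
  by apply: le_trans (HK t t0) _; rewrite lee_fin ler_norm.
(* Almost everywhere equal to u but bounded by K everywhere, so that the local Lipschitz bound
   applies at every point. *)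
pose cu t x := clip K (u t x).
have cuE t : 0 < t -> {ae mu, forall x, u t x = cu t x}.
  by move=> t0; apply: (ae_imp (uK t t0)) => x /clip_id.
have mcu t : 0 < t -> measurable_fun [set: Rn R n] (cu t).
  by move=> /ltW t0; exact: (measurableT_comp (measurable_clip K) (mu_ t t0)).
have uL t : 0 < t -> L1le (u t) M.
  by move=> /ltW t0; apply: L1le_Lq (HM t t0); exact: mu_.
have cuL t : 0 < t -> L1le (cu t) M by move=> t0; exact: L1le_ae (mcu t t0) (cuE t t0) (uL t t0).
have cuK t : bnd (cu t) K by move=> x; exact: clip_le.
pose L := `|C| * (2 * powR K (p - 1)).
have L0 : 0 <= L by rewrite /L; apply: mulr_ge0 => //; apply: mulr_ge0; rewrite ?powR_ge0.
have lip := lip_local p1 K0' flip.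
pose g s : 'rV[R]_n -> R := f \o cu s.
have gL s : 0 < s -> L1le (g s) (L * M).
  by move=> s0; apply: (L1le_lip mf f0 K0' L0 lip (cuK s) (cuL s s0)).
have gc s0 : 0 < s0 -> forall e, 0 < e -> exists2 d, 0 < d &
    forall s, 0 < s -> `|s - s0| < d -> L1le (fun x => g s x - g s0 x) e.
  move=> s00 e e0; have e1 : 0 < e / (L + 1) by rewrite divr_gt0// ltr_wpDl.
  have [d d0 hd] := H4 s0 (ltW s00) _ e1; exists d => // s s1 sd.
  have muB : measurable_fun [set: Rn R n] (fun x => u s x - u s0 x).
    by apply: measurable_funB; apply: mu_; exact: ltW.
  have h := L1le_Lq muB (ltW (hd s (ltW s1) sd)).
  apply: (L1le_trans (A := L * (e / (L + 1)))).
    by rewrite mulrA ler_pdivrMr ?ltr_wpDl// mulrC ler_wpM2l ?(ltW e0)// lerDl.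
  apply: (L1le_dom _ _ L0 h).
  - by apply: measurable_funB; [exact: L1le_measurable (gL s s1)|exact: L1le_measurable (gL s0
    s00)].
  - move=> x; apply: le_trans (lip _ _ (cuK s x) (cuK s0 x)) _.
    by rewrite ler_wpM2l//; exact: clip_lip.
have mw := measurable_D_weak a gL gc.
(* The value 0 for t <= 0 is arbitrary; it makes U a function on all times, jointly measurable. *)
pose U t x := if 0 < t then Eop t u0 x + tint (fun s => Dop a (t - s) (g s)) 0 t x else 0.
have jU : jmeas U.
  have c0 : measurable_fun [set: TR * Rn R n] (fun z : TR * Rn R n => 0 < (z.1 : R)).
    by apply: measurable_fun_ltr => //; exact: measurable_fst.
  apply: (@measurable_fun_ifT _ _ _ _ _ _ (fun z : TR * Rn R n => 0 < (z.1 : R)) c0) => //.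
  apply: measurable_funD; first by apply: jmeas_E; exact: L1le_measurable u0A.
  exact: (measurable_Rintegral_param lam (f := fun z : (TR * Rn R n) * TR =>
    win 0 z.1.1 z.2 (Dop a (z.1.1 - z.2) (g z.2) z.1.2))).
pose V t x := clip K (U t x).
have jV : jmeas V by exact: jmeas_comp (measurable_clip K) jU.
have uU t : 0 < t -> {ae mu, forall x, u t x = U t x}.
  move=> t0.
  (* Equality at every x, because the convolution does not distinguish the flux of u from that of
     its truncation. *)
  have E x : (heat t u0 \+ duhamel a f u 0 t t) x = U t x.
    rewrite /U t0 /= (heatE t0 u0A); congr (_ + _).
    apply: (duhamelE (F := g)) => [s /andP[s0 st]|].
      have ts0 : 0 < t - s by rewrite subr_gt0.
      have mfu : measurable_fun [set: Rn R n] (f \o u s).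
        exact: (measurableT_comp mf (mu_ s (ltW s0))).
      have fug : {ae mu, forall x, (f \o u s) x = g s x}.
        by apply: (ae_imp (cuE s s0)) => y e; rewrite /g/= -e.
      rewrite (derive_heat x ts0 (L1le_ae mfu (ae_sym fug) (gL s s0))) /Dop.
      by rewrite (convol_ae (@measurable_dgauss R n a (t - s)) mfu (L1le_measurable (gL s s0))
        fug).
    exact: (measurableT_comp mw (pair1_measurable ((t : TR), (x : Rn R n)))).
  apply: ae_eqP; [apply: mu_; exact: ltW|exact: jmeas_at|].
  have Ef : (heat t u0 \+ duhamel a f u 0 t t) = U t by apply/funext.
  by have := H8 t t0; rewrite Ef.
have uV t : 0 < t -> {ae mu, forall x, u t x = V t x}.
  move=> t0; apply: (ae_trans (cuE t t0)).
  by apply: (ae_imp (uU t t0)) => x e; rewrite /cu /V e.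
have mV t := jmeas_at t jV.
exists K, M, U, V; split=> //; split; split=> //.
- by move=> t t0; exact: L1le_ae (mV t) (uV t t0) (uL t t0).
- by move=> t x; exact: clip_le.
- by move=> t x; exact: clip_norm.
- by move=> t t' x; exact: clip_lip.
- by move=> t t0; exact: ae_trans (ae_sym (uV t t0)) (uU t t0).
- move=> t x t0.
  have -> : U t x = Eop t u0 x + tint (fun s => Dop a (t - s) (g s)) 0 t x by rewrite /U t0.
  apply: (congr1 (fun z => Eop t u0 x + z)); apply: eq_tint => s /andP[s0 st].
  rewrite /Dop (convol_ae (psi := f \o V s) (@measurable_dgauss R n a (t - s)) (L1le_measurable
    (gL s s0)))//.
  - exact: (measurableT_comp mf (mV s)).
  - apply: (ae_imp (ae_trans (ae_sym (cuE s s0)) (uV s s0))) => y e.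
    by rewrite /g/= e.
Qed.

End regularization.

(** * Decay of the solution in sup norm *)

Section mild_solution.
Context {R : realType} {n : nat} (a : 'rV[R]_n) (f : R -> R) (L K M M0 : R)
  (u0 : 'rV[R]_n -> R) (U V : R -> 'rV[R]_n -> R).
Context (mf : measurable_fun setT f) (f0 : f 0 = 0) (K0 : 0 <= K) (L0 : 0 <= L)
  (lip : forall xi eta, `|xi| <= K -> `|eta| <= K -> `|f xi - f eta| <= L * `|xi - eta|)
  (u0A : L1le u0 M0) (HM : mild a f u0 K M U V).
Local Notation mu := (leb R n).
Local Notation TR := (measurableTypeR R).
Local Notation lam := (@lebesgue_measure R).
Local Notation w t := (powR t (- 2^-1)).
Implicit Types (s t h tau : R) (x : 'rV[R]_n).

Definition flux (s : R) : 'rV[R]_n -> R := f \o V s.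

Lemma mild_jV : jmeas V. Proof. by case: HM => [[]]. Qed.
Lemma mild_VL t : 0 < t -> L1le (V t) M. Proof. by case: HM => [[_ h _ _ _] _]; exact: h. Qed.
Lemma mild_VK t : bnd (V t) K. Proof. by case: HM => [[_ _ h _ _] _]; exact: h. Qed.
Lemma mild_VU t x : `|V t x| <= `|U t x|. Proof. by case: HM => [[_ _ _ h _] _]. Qed.
Lemma mild_VUB t t' x : `|V t x - V t' x| <= `|U t x - U t' x|.
Proof. by case: HM => [[_ _ _ _ h] _]. Qed.
Lemma mild_jU : jmeas U. Proof. by case: HM => [_ []]. Qed.
Lemma mild_ae t : 0 < t -> {ae mu, forall x, V t x = U t x}.
Proof. by case: HM => [_ [_ h _]]; exact: h. Qed.
Lemma mild_U t : 0 < t -> U t = fun x => Eop t u0 x + duh a flux 0 t t x.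
Proof. by case: HM => [_ [_ _ h]] t0; apply/funext => x; exact: h. Qed.

Let mV t : measurable_fun [set: Rn R n] (V t) := jmeas_at t mild_jV.
Let mU t : measurable_fun [set: Rn R n] (U t) := jmeas_at t mild_jU.

Lemma mild_UL t : 0 < t -> L1le (U t) M.
Proof. by move=> t0; exact: L1le_ae (mU t) (mild_ae t0) (mild_VL t0). Qed.

Lemma flux_jmeas : jmeas flux.
Proof. exact: jmeas_comp mf mild_jV. Qed.

Lemma flux_L1 s : 0 < s -> L1le (flux s) (L * M).
Proof. by move=> s0; exact: L1le_lip mf f0 K0 L0 lip (mild_VK s) (mild_VL s0). Qed.

Lemma flux_bnd s : bnd (flux s) (L * K).
Proof.
move=> x; have := lip (mild_VK s x) (eta := 0); rewrite normr0 f0 !subr0 => /(_ K0)/le_trans;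
  apply.
by rewrite ler_wpM2l// mild_VK.
Qed.

Lemma M_ge0 : 0 <= M. Proof. exact: L1le_ge0 (mild_VL ltr01). Qed.

Lemma tbound_wcst t0 t1 t c : 0 <= c -> t0 <= t1 -> t1 <= t ->
  tbound t0 t1 (fun s => w (t - s) * c) (c * (2 * powR (t - t0) 2^-1)).
Proof.
move=> c0 t01 t1t.
have := tboundZ c0 (tbound_sub (lexx t0) t1t (@tbound_powRr R t0 t 2^-1 (le_trans t01 t1t)
  ltac:(lra))).
rewrite (_ : 1 - 2^-1 = 2^-1 :> R) ?invrK; last by lra.
rewrite [_ * 2]mulrC.
by rewrite (_ : (fun s => c * _) = (fun s => w (t - s) * c))//; apply/funext => s; rewrite mulrC.
Qed.

Lemma E_Vae t tau : 0 < t -> Eop tau (V t) = Eop tau (U t).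
Proof. by move=> t0; exact: convol_ae (@measurable_gauss R n tau) (mV t) (mU t) (mild_ae t0). Qed.

Lemma D_Vae t tau : 0 < t -> Dop a tau (V t) = Dop a tau (U t).
Proof. by move=> t0; exact: convol_ae (@measurable_dgauss R n a tau) (mV t) (mU t) (mild_ae t0).
  Qed.

Lemma convolDr (k phi psi : 'rV[R]_n -> R) A B C : measurable_fun [set: Rn R n] k -> bnd k C ->
  L1le phi A -> L1le psi B ->
  convol k (fun y => phi y + psi y) = fun x => convol k phi x + convol k psi x.
Proof.
move=> mk kK pA pB; apply/funext => x.
rewrite /convol -(RintD (convol_L1le x mk kK pA) (convol_L1le x mk kK pB)).
by apply: eq_Rintegral => y _; rewrite mulrDr.
Qed.

Let LM0 : 0 <= L * M. Proof. by rewrite mulr_ge0// M_ge0. Qed.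
Let LK0 : 0 <= L * K. Proof. by rewrite mulr_ge0. Qed.

Lemma flux_duh_L1 t0 t1 t : 0 <= t0 -> t0 <= t1 -> t1 <= t ->
  L1le (duh a flux t0 t1 t) (cD a * (L * M * (2 * powR (t - t0) 2^-1))).
Proof.
move=> h0 h1 h2; apply: (duh_L1 a (b := fun=> L * M) flux_jmeas h2 _ (tbound_wcst (c := L * M)
  LM0 h1 h2)) => s /andP[st _].
exact/flux_L1/(le_lt_trans h0).
Qed.

Lemma flux_duh_bnd t0 t1 t : t0 <= t1 -> t1 <= t ->
  bnd (duh a flux t0 t1 t) (cD a * (L * K * (2 * powR (t - t0) 2^-1))).
Proof.
move=> h1 h2; apply: (duh_bnd a (b := fun=> L * K) flux_jmeas h2 _ (tbound_wcst LK0 h1 h2)) => s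
  _.
exact: flux_bnd.
Qed.

Lemma E_flux_duh t0 t1 t h : 0 <= t0 -> t0 <= t1 -> t1 <= t -> 0 < h ->
  Eop h (duh a flux t0 t1 t) = duh a flux t0 t1 (t + h).
Proof.
move=> h0 h1 h2 hh; apply: (E_duh a (b := fun=> L * M) flux_jmeas h2 hh _ (tbound_wcst (c := L *
  M) LM0 h1 h2)) => s /andP[st _].
exact/flux_L1/(le_lt_trans h0).
Qed.

(** By the semigroup law e^((t'-t) Delta) carries the Duhamel integral over (0, t) to the final time
    t', and the rest of the integral is that over (t, t'). The datum may be V t, since the heat flow
    sees no difference from U t. *)
Lemma mild_restart t t' : 0 < t -> t < t' ->
  U t' = fun x => Eop (t' - t) (V t) x + duh a flux t t' t' x.
Proof.
move=> t0 tt'; have t'0 := lt_trans t0 tt'; have d0 : 0 < t' - t by rewrite subr_gt0.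
rewrite (mild_U t'0) (E_Vae _ t0) (mild_U t0).
rewrite /Eop (convolDr (@measurable_gauss R n (t' - t)) (gauss_le d0) (E_L1 t0 u0A)
  (flux_duh_L1 (lexx 0) (ltW t0) (lexx t))).
rewrite -/(Eop (t' - t) (Eop t u0)) -/(Eop (t' - t) (duh a flux 0 t t)) -/(Eop _ _).
rewrite (EE d0 t0 u0A) (E_flux_duh (lexx 0) (ltW t0) (lexx t) d0).
have -> : t + (t' - t) = t' by ring.
have -> : t' - t + t = t' by ring.
apply/funext => x; rewrite -addrA; congr (_ + _).
apply: (tint_split (jmeas_D a t' flux_jmeas) (ltW t0) (ltW tt')
  (tboundZ (cD_ge0 a) (tbound_wcst LK0 (ltW t'0) (lexx t')))) => s /andP[_ st].
have ts0 : 0 < t' - s by rewrite subr_gt0.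
by have := D_bnd a ts0 (jmeas_at s flux_jmeas) (@flux_bnd s) x; rewrite -mulrA.
Qed.

Lemma tbound_wpow t al c : 0 <= c -> 0 <= al < 1 ->
  tbound (t - 1) t (fun s => powR (t - s) (- al) * c) (c * (1 - al)^-1).
Proof.
move=> c0 al01.
have := tboundZ c0 (@tbound_powRr R (t - 1) t al ltac:(lra) al01).
rewrite (_ : t - (t - 1) = 1) ?powR1 ?mul1r; last by ring.
by rewrite (_ : (fun s => c * _) = (fun s => powR (t - s) (- al) * c))//; apply/funext => s;
  rewrite mulrC.
Qed.

(** The 4 is the integral of s^(-3/4) over (0, 1). *)
Definition chol1 : R := @cE R n + cDE a * (4 * L).

Lemma chol1_ge0 : 0 <= chol1.
Proof. by rewrite addr_ge0 ?cE_ge0// mulr_ge0 ?cDE_ge0// mulr_ge0. Qed.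

(** The solution is restarted one unit of time earlier, so the smoothing has time 1 to act and the
    resulting bounds do not depend on t. *)
Lemma holder1_eq t tau : 1 < t -> 0 < tau -> forall x,
  U t x - Eop tau (V t) x =
  (Eop 1 (V (t - 1)) x - Eop (1 + tau) (V (t - 1)) x) +
  tint (fun s x => Dop a (t - s) (flux s) x - Dop a (t - s + tau) (flux s) x) (t - 1) t x.
Proof.
move=> t1 tau0 x; have t0 : 0 < t by lra.
have t10 : 0 < t - 1 by lra.
have tt : t - 1 < t by lra.
have e1 : t - (t - 1) = 1 by ring.
rewrite (E_Vae _ t0) (mild_restart t10 tt) e1.
rewrite /Eop (convolDr (@measurable_gauss R n tau) (gauss_le tau0) (E_L1 ltr01 (mild_VL t10))
  (flux_duh_L1 (ltW t10) (ltW tt) (lexx t))).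
rewrite -/(Eop tau (Eop 1 (V (t - 1)))) -/(Eop tau (duh a flux (t - 1) t t)) -/(Eop _ _).
rewrite (EE tau0 ltr01 (mild_VL t10)) (E_flux_duh (ltW t10) (ltW tt) (lexx t) tau0).
rewrite (tintB (jmeas_D a t flux_jmeas) (G := fun s => Dop a (t - s + tau) (flux s))
  _ (tboundZ (cD_ge0 a) (tbound_wcst LK0 (ltW tt) (lexx t)))
    (tboundZ (cD_ge0 a) (tbound_wcst LK0 (ltW tt) (lexx t)))).
- have -> : duh a flux (t - 1) t (t + tau) x =
      tint (fun s => Dop a (t - s + tau) (flux s)) (t - 1) t x.
    by apply: eq_tint => s _; rewrite addrAC.
  by rewrite [tau + 1]addrC opprD addrACA.
- rewrite (_ : (fun s => _) = fun s => Dop a (t + tau - s) (flux s));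
  first exact: jmeas_D flux_jmeas.
  by apply/funext => s; rewrite addrAC.
- move=> s /andP[_ st]; have ts0 : 0 < t - s by rewrite subr_gt0.
  by have := D_bnd a ts0 (jmeas_at s flux_jmeas) (@flux_bnd s) x; rewrite -mulrA.
- move=> s /andP[_ st]; have ts0 : 0 < t - s by rewrite subr_gt0.
  have ts0' : 0 < t - s + tau by rewrite addr_gt0.
  apply: le_trans (D_bnd a ts0' (jmeas_at s flux_jmeas) (@flux_bnd s) x) _.
  rewrite -mulrA; apply: ler_wpM2l; first exact: cD_ge0.
  apply: ler_wpM2r; first exact: LK0.
  by apply: powRN_anti => //; rewrite lerDl ltW.
Qed.

Let jdiff t tau : jmeas (fun s x => Dop a (t - s) (flux s) x - Dop a (t - s + tau) (flux s) x).
Proof.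
apply: jmeasB; first exact: jmeas_D flux_jmeas.
rewrite (_ : (fun s x => _) = fun s => Dop a (t + tau - s) (flux s));
  first exact: jmeas_D flux_jmeas.
by apply/funext => s; rewrite addrAC.
Qed.

Lemma holder1_L1 t tau : 1 < t -> 0 < tau ->
  L1le (fun x => U t x - Eop tau (V t) x) (chol1 * powR tau 4^-1 * M).
Proof.
move=> t1 tau0; have t10 : 0 < t - 1 by lra.
rewrite (funext (holder1_eq t1 tau0)).
have h1 := Ediff_L1 ltr01 tau0 (mild_VL t10).
have c0 : 0 <= cDE a * powR tau 4^-1 * (L * M).
  by apply: mulr_ge0; [apply: mulr_ge0; [exact: cDE_ge0|exact: powR_ge0]|exact: LM0].
have h2 := tint_L1 (jdiff t tau) (tbound_wpow t c0 (al := 3 / 4) ltac:(lra)).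
apply: (L1le_trans _ (L1leD h1 (h2 _))).
  by rewrite divr1 le_eqVlt; apply/orP; left; apply/eqP; rewrite /chol1; field.
move=> s /andP[ts st]; have ts0 : 0 < t - s by rewrite subr_gt0.
have s0 : 0 < s by lra.
have := Ddiff_L1 a ts0 tau0 (flux_L1 s0); congr (L1le _ _); ring.
Qed.

Definition chol2 : R := chol1 + cD a * (2 * L).

Lemma chol2_ge0 : 0 <= chol2.
Proof. by rewrite addr_ge0 ?chol1_ge0// mulr_ge0 ?cD_ge0// mulr_ge0. Qed.

Lemma pow_quarter tau : 0 < tau -> tau <= 1 -> powR tau 2^-1 <= powR tau 4^-1.
Proof. by move=> t0 t1; rewrite ger_powR ?t0//; lra. Qed.

Lemma holder2_eq t tau x : 0 < t -> 0 < tau ->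
  U (t + tau) x - U t x = duh a flux t (t + tau) (t + tau) x - (U t x - Eop tau (V t) x).
Proof.
move=> t0 tau0; have tt : t < t + tau by rewrite ltrDl.
by rewrite (mild_restart t0 tt) (_ : t + tau - t = tau); ring.
Qed.

(** Hoelder continuity in time: [Eop tau (V t)] is inserted between the two times, which leaves
    [holder1_L1] and a Duhamel integral of order tau^(1/2) over (t, t + tau). *)
Lemma holder2_L1 t tau : 1 < t -> 0 < tau -> tau <= 1 ->
  L1le (fun x => V (t + tau) x - V t x) (chol2 * powR tau 4^-1 * M).
Proof.
move=> t1 tau0 tau1; have t0 : 0 < t by lra.
have tt : t <= t + tau by rewrite lerDl ltW.
have h := L1leB (flux_duh_L1 (ltW t0) tt (lexx _)) (holder1_L1 t1 tau0).
rewrite (_ : t + tau - t = tau) in h; last by ring.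
have {}h : L1le (fun x => U (t + tau) x - U t x) (chol2 * powR tau 4^-1 * M).
  rewrite (funext (fun x => holder2_eq x t0 tau0)); apply: L1le_trans h.
  have := pow_quarter tau0 tau1; have := cD_ge0 a; have := LM0; rewrite /chol2 => p1 p2 p3.
  have := ler_wpM2l (mulr_ge0 p2 p1) p3; lra.
have := @L1le_dom _ _ 1 (fun x => V (t + tau) x - V t x) _ _ _ _ ler01 h; rewrite mul1r; apply.
  by apply: measurable_funB; exact: mV.
by move=> x; rewrite mul1r; exact: mild_VUB.
Qed.

(** The 8 is the integral of s^(-7/8) over (0, 1). *)
Definition cgrad : R := cD a + cD a ^+ 2 * powR 2 (7 / 8) * (8 * L).

(** Boundedness of V alone would give h^(-1/2). With the Duhamel formula from time t - 1 and
    [DD_bnd] only h^(-1/8) is lost, less than the h^(1/4) that [holder1_L1] gains. *)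
Lemma grad_bnd t h : 1 < t -> 0 < h -> h <= 1 ->
  bnd (Dop a h (V t)) (cgrad * powR h (- 8^-1) * K).
Proof.
move=> t1 h0 h1 x; have t0 : 0 < t by lra.
have t10 : 0 < t - 1 by lra.
have tt : t - 1 < t by lra.
have e1 : t - (t - 1) = 1 by ring.
rewrite (D_Vae _ t0) (mild_restart t10 tt) e1.
rewrite /Dop (convolDr (@measurable_dgauss R n a h) (dgauss_bnd a h0) (E_L1 ltr01 (mild_VL t10))
  (flux_duh_L1 (ltW t10) (ltW tt) (lexx t))).
rewrite -/(Dop a h (Eop 1 (V (t - 1)))) -/(Dop a h (duh a flux (t - 1) t t)).
rewrite (DE a h0 ltr01 (mild_VL t10)).
have h10 : 0 < h + 1 by rewrite addr_gt0.
have b1 := D_bnd a h10 (mV (t - 1)) (@mild_VK (t - 1)) x.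
have FL s : t - 1 < s < t -> L1le (flux s) (L * M).
  by move=> /andP[st _]; apply: flux_L1; lra.
rewrite (D_duh a (b := fun=> L * M) x flux_jmeas (lexx t) h0 FL (tbound_wcst LM0 (ltW tt) (lexx
  t))).
have c0 : 0 <= cD a ^+ 2 * powR 2 (7 / 8) * powR h (- 8^-1) * (L * K).
  by apply: mulr_ge0; [apply: mulr_ge0; [apply: mulr_ge0;
    [exact: sqr_ge0|exact: powR_ge0]|exact: powR_ge0]|exact: LK0].
have jDD : jmeas (fun s => Dop a h (Dop a (t - s) (flux s))).
  have mcst : measurable_fun [set: TR * Rn R n] (fun z => dgauss a h z.2).
    exact: (measurableT_comp (@measurable_dgauss R n a h) measurable_snd).
  apply: (measurable_convol_family (ker := fun=> dgauss a h) mcst (jmeas_D a t flux_jmeas)).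
  - exact: measurable_fst.
  - exact: measurable_fst.
  - exact: measurable_snd.
have h2 := tint_bnd (x := x) jDD (tbound_wpow t c0 (al := 7 / 8) ltac:(lra)).
apply: le_trans (ler_normD _ _) _; apply: le_trans (lerD b1 (h2 _)) _; last first.
  rewrite /cgrad [leRHS](_ : _ = cD a * powR h (- 8^-1) * K +
    cD a ^+ 2 * powR 2 (7 / 8) * (8 * L) * powR h (- 8^-1) * K); last by ring.
  apply: lerD.
    apply: ler_wpM2r => //; apply: ler_wpM2l; first exact: cD_ge0.
    apply: (@le_trans _ _ 1).
      by have := @powRN_anti R 2^-1 1 (h + 1); rewrite powR1; apply; lra.
    by have := @powRN_anti R 8^-1 h 1; rewrite powR1; apply; lra.
  by rewrite le_eqVlt; apply/orP; left; apply/eqP; field.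
move=> s st; have /andP[ts ts'] := st; have ts0 : 0 < t - s by rewrite subr_gt0.
have := DD_bnd a h0 ts0 (FL s st) (@flux_bnd s) x.
by congr (_ <= _); ring.
Qed.

End mild_solution.


(** * A primitive of the nonlinearity *)

Section primitive.
Context {R : realType}.
Local Notation lam := (@lebesgue_measure R).

Lemma lip_continuous (g : R -> R) (C : R) :
  (forall x y, `|g x - g y| <= C * `|x - y|) -> continuous g.
Proof.
move=> gC x; apply/cvgrPdist_le => e e0.
have C1 : 0 < `|C| + 1 by rewrite ltr_wpDl.
near=> y; apply: le_trans (gC x y) _.
apply: (@le_trans _ _ ((`|C| + 1) * `|x - y|)).
  by rewrite ler_wpM2r//; have := ler_norm C; lra.
rewrite -ler_pdivlMl// mulrC; near: y.
apply: cvgr_dist_le; first exact: cvg_id.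
by rewrite divr_gt0.
Unshelve. all: by end_near. Qed.

Lemma norm_between (K x y z : R) : `|x| <= K -> `|y| <= K -> x <= z -> z <= y -> `|z| <= K.
Proof. by rewrite !ler_norml => /andP[? ?] /andP[? ?] ? ?; apply/andP; split; lra. Qed.

Lemma primitive_taylor (f : R -> R) (K L : R) : 0 <= K -> 0 <= L -> continuous f ->
  (forall xi eta, `|xi| <= K -> `|eta| <= K -> `|f xi - f eta| <= L * `|xi - eta|) ->
  exists2 Phi : R -> R, measurable_fun [set: R] Phi &
    forall xi eta, `|xi| <= K -> `|eta| <= K ->
      `|Phi eta - Phi xi - f xi * (eta - xi)| <= L * `|eta - xi| ^+ 2.
Proof.
move=> K0 L0 cf lip.
(* The base point lies strictly below -K, so that the fundamental theorem covers all of [-K, K]. *)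
pose G x := (\int[lam]_(s in `[- K - 1, x]) f s)%R.
have dG (x : R) : `|x| <= K -> is_derive x 1 G (f x).
  rewrite ler_norml => /andP[x1 x2].
  have [] := @continuous_FTC1_closed R f (- K - 1) x (K + 1).
  - lra.
  - apply: continuous_compact_integrable; first exact: segment_compact.
    exact: continuous_subspaceT.
  - lra.
  - exact: cf.
  - by rewrite derive1E -/G => d1 d2; split.
have mvt xi eta : `|xi| <= K -> `|eta| <= K -> xi <= eta ->
    exists2 c, xi <= c <= eta & G eta - G xi = f c * (eta - xi).
  move=> xK eK h; have [||c] := @MVT_segment R G f xi eta h.
  - move=> x; rewrite in_itv/= => /andP[h1 h2].
    exact: dG (norm_between xK eK (ltW h1) (ltW h2)).
  - apply: derivable_within_continuous => x; rewrite in_itv/= => /andP[h1 h2].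
    by have [] := dG x (norm_between xK eK h1 h2).
  - by rewrite in_itv/= => cx e; exists c.
have T xi eta : `|xi| <= K -> `|eta| <= K ->
    exists2 c, `|c - xi| <= `|eta - xi| /\ `|c| <= K & G eta - G xi = f c * (eta - xi).
  move=> xK eK; have [h|/ltW h] := leP xi eta.
    have [c /andP[c1 c2] e] := mvt _ _ xK eK h; exists c => //.
    by split; [rewrite !ger0_norm; lra|exact: norm_between xK eK c1 c2].
  have [c /andP[c1 c2] e] := mvt _ _ eK xK h; exists c; last by rewrite -[LHS]opprB e; ring.
  by split; [rewrite !ler0_norm; lra|exact: norm_between eK xK c1 c2].
(* Truncation makes the primitive Lipschitz on the whole line, hence measurable, without changing it
   on [-K, K]. *)
pose Phi x := G (clip K x).
have PhiE x : `|x| <= K -> Phi x = G x by move=> xK; rewrite /Phi clip_id.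
have PhiT xi eta : `|xi| <= K -> `|eta| <= K ->
    `|Phi eta - Phi xi - f xi * (eta - xi)| <= L * `|eta - xi| ^+ 2.
  move=> xK eK; rewrite !PhiE//; have [c [c1 c2] ->] := T _ _ xK eK.
  rewrite -mulrBl normrM expr2 mulrA ler_wpM2r//.
  by apply: le_trans (lip _ _ c2 xK) _; rewrite ler_wpM2l.
exists Phi => //; apply: continuous_measurable_fun.
apply: (@lip_continuous _ (`|f 0| + L * K)) => y x.
have xK := clip_le x K0; have yK := clip_le y K0.
have [c [c1 c2] e] := T _ _ xK yK.
rewrite /Phi e normrM; apply: ler_pM => //; last exact: clip_lip.
have := lip c 0 c2; rewrite normr0 subr0 => /(_ K0) h.
rewrite -[f c](subrK (f 0)); apply: le_trans (ler_normD _ _) _.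
by rewrite addrC lerD2l; apply: le_trans h _; rewrite ler_wpM2l.
Qed.

End primitive.

(** * Orthogonality of the flux to the gradient *)

Section flux_orthogonality.
Context {R : realType} {n : nat} (a : 'rV[R]_n) (f : R -> R) (L K : R).
Context (cf : continuous f) (f0 : f 0 = 0) (K0 : 0 <= K) (L0 : 0 <= L)
  (lip : forall xi eta, `|xi| <= K -> `|eta| <= K -> `|f xi - f eta| <= L * `|xi - eta|).
Local Notation mu := (leb R n).

(* With Phi a primitive of f, the integral of Phi(W(x + e a)) - Phi(W x) vanishes by
   translation invariance, and it equals e int f(W) d + O(e^2). *)
Lemma shift_orthogonal (W d : 'rV[R]_n -> R) (A B D cs ct : R) :
  L1le W A -> bnd W K -> L1le d D -> bnd d B -> 0 <= ct ->
  (forall x e, `|W (x + e *: a) - W x - e * d x| <= ct * e ^+ 2) ->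
  (forall e, 0 < e -> L1le (fun x => W (x + e *: a) - W x) (cs * e)) ->
  \int[mu]_x (f (W x) * d x) = 0.
Proof.
move=> WA WK dA dB ct0 WT WL; have mf := continuous_measurable_fun cf.
have mW := L1le_measurable WA.
have fWA : L1le (fun x => f (W x)) (L * A) by exact: L1le_lip WK WA.
have B0 : 0 <= B by exact: le_trans (dB 0).
(* Subtracting Phi 0 makes the primitive integrable along W: as f 0 = 0 it is O(|W|^2), and W is
   bounded and integrable. *)
have [Psi PsiA PsiT] : exists2 Psi, L1le Psi (L * K * A) & forall x y,
    `|Psi y - Psi x - f (W x) * (W y - W x)| <= L * `|W y - W x| ^+ 2.
  have [Phi mPhi PhiT] := primitive_taylor K0 L0 cf lip.
  exists (fun x => Phi (W x) - Phi 0) => [|x y]; last first.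
    by rewrite opprB addrA subrK; exact: PhiT.
  apply: (L1le_dom _ _ _ WA).
  - by apply: measurable_funB => //; exact: measurableT_comp mPhi mW.
  - move=> x; have := PhiT 0 (W x); rewrite normr0 f0 mul0r !subr0 => /(_ K0 (WK x)).
    move=> /le_trans; apply; rewrite expr2 mulrA ler_wpM2r// ler_wpM2l//; exact: WK.
  - by rewrite mulr_ge0.
set J := (X in X = 0).
have fdL : L1le (fun x => f (W x) * d x) (B * (L * A)).
  exact: L1leM fWA (L1le_measurable dA) dB.
pose c := L * (B + ct) * cs + ct * (L * A).
have step e : 0 < e -> e <= 1 -> e * `|J| <= c * e ^+ 2.
  move=> e0 e1; have := WT ^~ e; have := WL e e0.
  have [del delE] : exists del, del = fun x => W (x + e *: a) - W x by eexists.
  have delx x : W (x + e *: a) - W x = del x by rewrite delE.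
  rewrite -delE => delL delT'.
  have delT x : `|del x - e * d x| <= ct * e ^+ 2 by rewrite -delx.
  have {}PsiT x : `|Psi (x + e *: a) - Psi x - f (W x) * del x| <= L * `|del x| ^+ 2.
    by rewrite -delx.
  have delB x : `|del x| <= (B + ct) * e.
    rewrite -[del x](subrK (e * d x)); apply: le_trans (ler_normD _ _) _.
    rewrite mulrDl addrC lerD//.
      by rewrite normrM gtr0_norm// mulrC ler_wpM2r ?(ltW e0)//; exact: dB.
    apply: le_trans (delT x) _; rewrite ler_wpM2l// expr2 ler_piMl// ltW//.
  have PsA := L1le_shift (e *: a) PsiA.
  have sL := L1leB PsA PsiA.
  have i0 : \int[mu]_x (Psi (x + e *: a) - Psi x) = 0.
    rewrite (RintB PsA PsiA); apply/eqP; rewrite subr_eq0; apply/eqP.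
    exact: Rint_shift (L1le_measurable PsiA).
  have r1 : L1le (fun x => Psi (x + e *: a) - Psi x - f (W x) * del x)
      (L * (B + ct) * e * (cs * e)).
    apply: (L1le_dom _ _ _ delL).
    - apply: measurable_funB; first exact: L1le_measurable sL.
      apply: measurable_funM; first exact: L1le_measurable fWA.
      exact: L1le_measurable delL.
    - move=> x; apply: le_trans (PsiT x) _; rewrite expr2 mulrA.
      by rewrite ler_wpM2r// -mulrA ler_wpM2l.
    - by apply: mulr_ge0; [apply: mulr_ge0 => //; apply: addr_ge0|exact: ltW].
  have r2 : L1le (fun x => f (W x) * (del x - e * d x)) (ct * e ^+ 2 * (L * A)).
    apply: L1leM fWA _ delT; apply: measurable_funB; first exact: L1le_measurable delL.
    by apply: measurable_funM => //; exact: L1le_measurable dA.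
  have r3 := L1leD r1 r2.
  have eJ : \int[mu]_x (e * (f (W x) * d x)) =
     \int[mu]_x (Psi (x + e *: a) - Psi x) - \int[mu]_x
       ((Psi (x + e *: a) - Psi x - f (W x) * del x) + f (W x) * (del x - e * d x)).
    rewrite -(RintB sL r3); apply: eq_Rintegral => x _.
    by ring.
  rewrite (RintZ e fdL) -/J i0 sub0r in eJ.
  rewrite -[X in X * _ <= _](gtr0_norm e0) -normrM eJ normrN.
  apply: le_trans (L1le_Rintegral r3) _.
  by rewrite le_eqVlt; apply/orP; left; apply/eqP; rewrite /c; ring.
(* The inequality e |J| <= c e^2 for all small e > 0 forces J = 0. *)
apply/eqP; rewrite -normr_eq0; apply/eqP/le_anti; rewrite normr_ge0 andbT.
have c0 : 0 <= c by have := step 1 ltr01 (lexx 1); rewrite expr1n mulr1 mul1r; exact: le_trans.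
apply/ler_addgt0Pr => e e0; rewrite add0r.
pose e' := Num.min 1 (e / (c + 1)).
have c1 : 0 < c + 1 by rewrite ltr_wpDl.
have e'0 : 0 < e' by rewrite lt_min ltr01/= divr_gt0.
have := step e' e'0; rewrite ge_min lexx/= => /(_ isT).
rewrite expr2 mulrA [c * e']mulrC -mulrA ler_pM2l// => /le_trans; apply.
apply: (@le_trans _ _ (c * (e / (c + 1)))); first by rewrite ler_wpM2l// ge_min lexx orbT.
by rewrite mulrCA ler_piMr ?(ltW e0)// ler_pdivrMr// mul1r lerDl.
Qed.

Lemma heat_shift_L1 h (phi : 'rV[R]_n -> R) A e : 0 < h -> L1le phi A -> 0 < e ->
  L1le (fun x => Eop h phi (x + e *: a) - Eop h phi x)
    (2 * (1 + @cdg R n) * (l1n (- a) * powR h (- 2^-1)) * A * e).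
Proof.
move=> h0 pA e0; have sh := convol_L1 (gauss_shift_L1 (- (e *: a)) h0) pA.
have le : l1n (- (e *: a)) = e * l1n (- a).
  rewrite /l1n mulr_sumr; apply: eq_bigr => i _.
  by rewrite !mxE !normrN normrM gtr0_norm.
have ml := L1le_measurable (L1le_shift (- - (e *: a)) (gauss_L1 h0)).
have bl : bnd (fun z : 'rV[R]_n => gauss h (z - - (e *: a))) (powR h (- (n%:R / 2))).
  by move=> z; exact: gauss_le.
rewrite (convolBl (@measurable_gauss R n h) (gauss_le h0) ml bl pA) in sh.
apply: L1le_trans; last first.
  suff -> : (fun x => Eop h phi (x + e *: a) - Eop h phi x) = fun x => - (convol (gauss h) phi x -
      convol (fun z => gauss h (z - - (e *: a))) phi x) by exact: L1leN sh.
  apply/funext => x; rewrite opprB; apply: (congr1 (fun z => z - Eop h phi x)).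
  by apply: eq_Rintegral => y _; rewrite opprK addrAC.
by rewrite le_eqVlt; apply/orP; left; apply/eqP; rewrite le; ring.
Qed.

Lemma flux_orthogonal h (phi : 'rV[R]_n -> R) A : 0 < h -> L1le phi A -> bnd phi K ->
  \int[mu]_x (f (Eop h phi x) * Dop a h phi x) = 0.
Proof.
move=> h0 pA pK; have mphi := L1le_measurable pA.
apply: (shift_orthogonal (E_L1 h0 pA) (E_bnd h0 mphi pK) (D_L1 a h0 pA) (D_bnd a h0 mphi pK)
  (ct := ctaylor a h * A) _ _ (fun e => heat_shift_L1 h0 pA)).
  by rewrite mulr_ge0 ?ctaylor_ge0// (L1le_ge0 pA).
by move=> x e; exact: convol_gauss_taylor.
Qed.

End flux_orthogonality.


(** * The energy balance over one time step *)

Section energy.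
Context {R : realType} {n : nat} (a : 'rV[R]_n) (f : R -> R) (L K M M0 : R)
  (u0 : 'rV[R]_n -> R) (U V : R -> 'rV[R]_n -> R).
Context (cf : continuous f) (f0 : f 0 = 0) (K0 : 0 <= K) (L0 : 0 <= L)
  (lip : forall xi eta, `|xi| <= K -> `|eta| <= K -> `|f xi - f eta| <= L * `|xi - eta|)
  (u0A : L1le u0 M0) (HM : mild a f u0 K M U V).
Local Notation mu := (leb R n).
Local Notation TR := (measurableTypeR R).
Local Notation w t := (powR t (- 2^-1)).
Local Notation F := (flux f V).
Implicit Types (s t h tau : R) (x : 'rV[R]_n).

Let mf : measurable_fun [set: R] f := continuous_measurable_fun cf.
Let FL s (s0 : 0 < s) : L1le (F s) (L * M) := flux_L1 mf f0 K0 L0 lip HM s0.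
Let FK s : bnd (F s) (L * K) := flux_bnd f0 K0 L0 lip HM s.
Let jF : jmeas F := flux_jmeas mf HM.
Let VL t (t0 : 0 < t) : L1le (V t) M := mild_VL HM t0.
Let VK t : bnd (V t) K := mild_VK HM t.
Let M_ge0' : 0 <= M := M_ge0 HM.
Let mV t : measurable_fun [set: Rn R n] (V t) := jmeas_at t (mild_jV HM).
Let LM : 0 <= L * M. Proof. exact: mulr_ge0. Qed.
Let LK : 0 <= L * K. Proof. exact: mulr_ge0. Qed.

Lemma E_mild_step t tau h : 0 < t -> 0 < tau -> 0 < h ->
  Eop h (V (t + tau)) = fun x => Eop (tau + h) (V t) x + duh a F t (t + tau) (t + tau + h) x.
Proof.
move=> t0 tau0 h0; have tt : t < t + tau by rewrite ltrDl.
have t'0 : 0 < t + tau by rewrite addr_gt0.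
rewrite (E_Vae HM h t'0) (mild_restart mf f0 K0 L0 lip u0A HM t0 tt).
have -> : t + tau - t = tau by ring.
rewrite /Eop (convolDr (@measurable_gauss R n h) (gauss_le h0) (E_L1 tau0 (VL t0))
  (flux_duh_L1 mf f0 K0 L0 lip HM (ltW t0) (ltW tt) (lexx _))).
rewrite -/(Eop h (Eop tau (V t))) -/(Eop h (duh a F t (t + tau) (t + tau))) -/(Eop _ _).
rewrite (EE h0 tau0 (VL t0)) [h + tau]addrC.
by rewrite (E_flux_duh mf f0 K0 L0 lip HM (ltW t0) (ltW tt) (lexx _) h0).
Qed.

(** The extra smoothing time h removes the singularity at the end of the step, so the contribution
    is O(tau) instead of O(tau^(1/2)). *)
Lemma late_duh_L1 t tau h : 0 < t -> 0 < tau -> 0 < h ->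
  L1le (duh a F t (t + tau) (t + tau + h)) (cD a * w h * (L * M) * tau).
Proof.
move=> t0 tau0 h0; have tt : t <= t + tau by rewrite lerDl ltW.
have c0 : 0 <= cD a * w h * (L * M) by apply: mulr_ge0 => //; exact: cDw_ge0.
have tb := tbound_cst c0 tt; rewrite [t + tau - t]addrAC subrr add0r in tb.
apply: (tint_L1 (jmeas_D a _ jF) tb) => s /andP[ts st].
have r0 : 0 < t + tau + h - s by lra.
apply: L1le_trans (D_L1 a r0 (FL (lt_trans t0 ts))).
by apply: ler_wpM2r => //; apply: ler_wpM2l; [exact: cD_ge0|apply: powRN_anti; lra].
Qed.

Lemma late_duh_bnd t tau h : 0 < t -> 0 < tau -> 0 < h ->
  bnd (duh a F t (t + tau) (t + tau + h)) (cD a * w h * (L * K) * tau).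
Proof.
move=> t0 tau0 h0; have tt : t <= t + tau by rewrite lerDl ltW.
have c0 : 0 <= cD a * w h * (L * K) by apply: mulr_ge0 => //; exact: cDw_ge0.
have tb := tbound_cst c0 tt; rewrite [t + tau - t]addrAC subrr add0r in tb.
move=> x; apply: (tint_bnd (jmeas_D a _ jF) tb) => s /andP[ts st].
have r0 : 0 < t + tau + h - s by lra.
apply: le_trans (D_bnd a r0 (jmeas_at s jF) (@FK s) x) _.
by apply: ler_wpM2r => //; apply: ler_wpM2l; [exact: cD_ge0|apply: powRN_anti; lra].
Qed.

Lemma tint_cst (g : 'rV[R]_n -> R) t tau x : 0 < tau ->
  tint (fun=> g) t (t + tau) x = tau * g x.
Proof.
move=> tau0; rewrite /tint /Rintegral (win_integralE t (t + tau) (fun=> g x)).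
rewrite -/(Rintegral _ _ _) Rintegral_cst//= lebesgue_measure_itv/= lte_fin ltrDl tau0.
by rewrite -EFinB/= [t + tau - t]addrAC subrr add0r mulrC.
Qed.

Definition clate h : R := cD a * w h * (L * (chol2 a L * M)) +
  cDE a * powR h (- (3 / 4)) * (L * M).

(** The flux is frozen at time t, at a cost given by [holder2_L1], and the time of the kernel at h,
    at a cost given by [Ddiff_L1]. These are the two summands of [clate], and each gains
    tau^(1/4). *)
Lemma late_duh_approx t tau h : 1 < t -> 0 < tau -> tau <= 1 -> 0 < h ->
  L1le (fun x => duh a F t (t + tau) (t + tau + h) x - tau * Dop a h (F t) x)
    (clate h * powR tau 4^-1 * tau).
Proof.
move=> t1 tau0 tau1 h0; have t0 : 0 < t by lra.
have tt : t <= t + tau by rewrite lerDl ltW.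
have mD := L1le_measurable (D_L1 a h0 (FL t0)).
have cq : 0 <= powR tau 4^-1 by exact: powR_ge0.
have c2 := @chol2_ge0 R n a L L0.
have c0 : 0 <= clate h.
  apply: addr_ge0; apply: mulr_ge0 => //; first exact: cDw_ge0.
  - by apply: mulr_ge0 => //; apply: mulr_ge0.
  - by apply: mulr_ge0; [exact: cDE_ge0|exact: powR_ge0].
have c0' : 0 <= clate h * powR tau 4^-1 by exact: mulr_ge0.
have tbc (c : R) : 0 <= c -> tbound t (t + tau) (fun=> c) (c * tau).
  by move=> cp; have := tbound_cst cp tt; rewrite [t + tau - t]addrAC subrr add0r.
have jc : jmeas (fun _ : R => Dop a h (F t)).
  exact: (measurableT_comp mD measurable_snd).
have jD := jmeas_D a (t + tau + h) jF.
have -> : (fun x => duh a F t (t + tau) (t + tau + h) x - tau * Dop a h (F t) x) =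
  tint (fun s x => Dop a (t + tau + h - s) (F s) x - Dop a h (F t) x) t (t + tau).
  apply/funext => x; rewrite -(tint_cst (Dop a h (F t)) t x tau0).
  have b1 := mulr_ge0 (cDw_ge0 a h) LK.
  rewrite (tintB jD jc (tbc _ b1) (tbc _ b1))//.
  - move=> s /andP[ts st]; have r0 : 0 < t + tau + h - s by lra.
    apply: le_trans (D_bnd a r0 (jmeas_at s jF) (@FK s) x) _.
    by apply: ler_wpM2r => //; apply: ler_wpM2l; [exact: cD_ge0|apply: powRN_anti; lra].
  - move=> s _; exact: (D_bnd a h0 (jmeas_at t jF) (@FK t) x).
apply: (tint_L1 (jmeasB jD jc) (tbc _ c0')) => s /andP[ts st].
pose r := t + tau - s; have r0 : 0 < r by rewrite /r; lra.
have rt : r <= tau by rewrite /r; lra.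
have -> : t + tau + h - s = h + r by rewrite /r; ring.
have hr0 : 0 < h + r by lra.
have s0 : 0 < s by lra.
pose d := s - t; have d0 : 0 < d by rewrite /d; lra.
have dt : d <= tau by rewrite /d; lra.
have FF : L1le (fun x => F s x - F t x) (L * (chol2 a L * M * powR tau 4^-1)).
  have hol : L1le (fun x => V s x - V t x) (chol2 a L * M * powR tau 4^-1).
    have -> : s = t + d by rewrite /d; ring.
    apply: L1le_trans (holder2_L1 mf f0 K0 L0 lip u0A HM t1 d0 (le_trans dt tau1)).
    rewrite [leRHS](_ : _ = chol2 a L * powR tau 4^-1 * M); last by ring.
    apply: ler_wpM2r => //; apply: ler_wpM2l => //.
    by apply: ge0_ler_powR => //; rewrite ?nnegrE ?(ltW d0) ?(ltW tau0)//; lra.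
  apply: (L1le_dom _ _ L0 hol) => [|x]; last by apply: lip; exact: VK.
  by apply: measurable_funB; exact: jmeas_at.
have h1 := D_L1 a hr0 FF; rewrite (D_B a hr0 (FL s0) (FL t0)) in h1.
have h2 := L1leN (Ddiff_L1 a h0 r0 (FL t0)).
apply: (L1le_trans (A := cD a * w (h + r) * (L * (chol2 a L * M * powR tau 4^-1)) +
  cDE a * (powR r 4^-1 * powR h (- (3 / 4))) * (L * M))).
  rewrite /clate [leRHS]mulrDl; apply: lerD.
    rewrite [leRHS](_ : _ = cD a * w h * (L * (chol2 a L * M * powR tau 4^-1))); last by ring.
    apply: ler_wpM2r; first by apply: mulr_ge0 => //; apply: mulr_ge0 => //; apply: mulr_ge0.
    by apply: ler_wpM2l; [exact: cD_ge0|apply: powRN_anti; lra].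
  rewrite [leRHS](_ : _ = cDE a * (powR tau 4^-1 * powR h (- (3 / 4))) * (L * M)); last by ring.
  apply: ler_wpM2r => //; apply: ler_wpM2l; first exact: cDE_ge0.
  apply: ler_wpM2r; first exact: powR_ge0.
  by apply: ge0_ler_powR => //; rewrite ?nnegrE ?(ltW r0) ?(ltW tau0)//; lra.
suff -> : (fun x => Dop a (h + r) (F s) x - Dop a h (F t) x) = fun x =>
  (Dop a (h + r) (F s) x - Dop a (h + r) (F t) x) + - (Dop a h (F t) x - Dop a (h + r) (F t) x).
  exact: L1leD h1 h2.
have aux (x y z : R) : x - y = (x - z) + - (y - z) by ring.
by apply/funext => x; exact: aux.
Qed.

Definition cdrift : R := cgrad a L * K * (L * (chol1 a L * M)).

(* By [flux_orthogonal] the integral vanishes with [Eop h (V t)] in place of [V t] inside f;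
   the exponent is 1/4 - 1/8, from [holder1_L1] and [grad_bnd]. *)
Lemma drift_small t h : 1 < t -> 0 < h -> h <= 1 ->
  `|\int[mu]_x (Dop a h (V t) x * F t x)| <= cdrift * powR h 8^-1.
Proof.
move=> t1 h0 h1; have t0 : 0 < t by lra.
have gb := grad_bnd mf f0 K0 L0 lip u0A HM t1 h0 h1.
have mD := L1le_measurable (D_L1 a h0 (VL t0)).
have VE : L1le (fun x => V t x - Eop h (V t) x) (chol1 a L * powR h 4^-1 * M).
  have := holder1_L1 mf f0 K0 L0 lip u0A HM t1 h0; apply: L1le_ae.
    by apply: measurable_funB => //; exact: L1le_measurable (E_L1 h0 (VL t0)).
  by apply: (ae_imp (ae_sym (mild_ae HM t0))) => x ->.
have EK : bnd (Eop h (V t)) K := E_bnd h0 (mV t) (@VK t).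
have mE := L1le_measurable (E_L1 h0 (VL t0)).
have FE : L1le (fun x => F t x - f (Eop h (V t) x)) (L * (chol1 a L * powR h 4^-1 * M)).
  apply: (L1le_dom _ _ L0 VE) => [|x]; last by apply: lip; [exact: VK|exact: EK].
  by apply: measurable_funB; [exact: jmeas_at|exact: measurableT_comp mf mE].
have fE : L1le (fun x => f (Eop h (V t) x)) (L * M).
  exact: L1le_lip mf f0 K0 L0 lip EK (E_L1 h0 (VL t0)).
have l1 := L1leM (FL t0) mD gb.
have l2 := L1leM fE mD gb.
have o := flux_orthogonal a cf f0 K0 L0 lip h0 (VL t0) (@VK t).
have -> : \int[mu]_x (Dop a h (V t) x * F t x) =
    \int[mu]_x ((F t x - f (Eop h (V t) x)) * Dop a h (V t) x).
  rewrite -[LHS]subr0 -o.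
  have -> : (fun x => Dop a h (V t) x * F t x) = fun x => F t x * Dop a h (V t) x.
    by apply/funext => x; rewrite mulrC.
  by rewrite -(RintB l1 l2); apply: eq_Rintegral => x _; rewrite mulrBl.
apply: le_trans (L1le_Rintegral (L1leM FE mD gb)) _.
rewrite le_eqVlt; apply/orP; left; apply/eqP.
rewrite -(@powR_DE _ h (- 8^-1) 4^-1 8^-1)//; last by lra.
by rewrite /cdrift; ring.
Qed.

Definition energy h t : R := \int[mu]_x (Eop h (V t) x ^+ 2).

(** The errors of freezing the flux, of replacing e^((tau+h) Delta) V by e^(h Delta) V, and of the
    square of the Duhamel part. The constant depends on h but not on tau, which is chosen later. *)
Definition cenergy h : R := K * clate h + (@cE R n * K * powR h (- 4^-1)) * (cD a * w h * (L *
  M)) +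
  cD a * w h * (L * K) * (cD a * w h * (L * M)).

(** With p the heat part and q the Duhamel part, (p + q)^2 is expanded. The square of q is O(tau^2).
    In the cross term q is close to tau [Dop a h] of the flux and p to [Eop h (V t)]; by duality
    both smoothings fall on V t, which gives [Dop a (h + h) (V t)] and explains h + h in
    [drift_small]. *)
Lemma energy_step t tau h : 1 < t -> 0 < tau -> tau <= 1 -> 0 < h -> h + h <= 1 ->
  energy h (t + tau) <= \int[mu]_x (Eop tau (Eop h (V t)) x ^+ 2) +
    2 * tau * (cdrift * powR (h + h) 8^-1 + cenergy h * powR tau 4^-1).
Proof.
move=> t1 tau0 tau1 h0 hh1; have t0 : 0 < t by lra.
have th0 : 0 < tau + h by lra.
have hh0 : 0 < h + h by lra.
have q1 := late_duh_L1 t0 tau0 h0.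
have q2 := late_duh_bnd t0 tau0 h0.
have q3 := late_duh_approx t1 tau0 tau1 h0.
have pL := E_L1 th0 (VL t0).
have pK : bnd (Eop (tau + h) (V t)) K := E_bnd th0 (mV t) (@VK t).
have vL := E_L1 h0 (VL t0).
have dL := D_L1 a h0 (FL t0).
have pv := Ediff_bnd h0 tau0 (VL t0) (@VK t).
rewrite [h + tau]addrC in pv.
rewrite /energy (E_mild_step t0 tau0 h0) (EE tau0 h0 (VL t0)).
move: q1 q2 q3 pL pK pv.
move: (duh _ _ _ _ _) (Eop (tau + h) (V t)) => q p q1 q2 q3 pL pK pv.
have mp := L1le_measurable pL; have mq := L1le_measurable q1.
have pp := L1leM pL mp pK.
have qp := L1leM q1 mp pK.
have qq := L1leM q1 mq q2.
have -> : \int[mu]_x ((p x + q x) ^+ 2) =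
    \int[mu]_x (p x ^+ 2) + (2 * \int[mu]_x (q x * p x) + \int[mu]_x (q x * q x)).
  rewrite -(RintZ 2 qp) -(RintD (L1leZ 2 qp) qq).
  have -> : (fun x => p x ^+ 2) = fun x => p x * p x by [].
  by rewrite -(RintD pp (L1leD (L1leZ 2 qp) qq)); apply: eq_Rintegral => x _; ring.
apply: lerD => //.
(* The quadratic term, of order tau^2, is weakened so as to share the factor tau^(1/4). *)
have tq : tau <= powR tau 4^-1.
  by rewrite -[leLHS]powRr1 ?(ltW tau0)// ger_powR ?tau0//; lra.
have cD0 := cDw_ge0 a h.
have e2 : \int[mu]_x (q x * q x) <=
    2 * tau * (cD a * w h * (L * K) * (cD a * w h * (L * M)) * powR tau 4^-1).
  apply: le_trans (ler_norm _) (le_trans (L1le_Rintegral qq) _).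
  rewrite [leLHS](_ : _ = tau * (cD a * w h * (L * K) * (cD a * w h * (L * M)) * tau));
    last by ring.
  have c0 : 0 <= cD a * w h * (L * K) * (cD a * w h * (L * M)).
    by apply: mulr_ge0; apply: mulr_ge0.
  have := ler_wpM2l (ltW tau0) (ler_wpM2l c0 tq).
  have : 0 <= tau * (cD a * w h * (L * K) * (cD a * w h * (L * M)) * powR tau 4^-1).
    by apply: mulr_ge0; [exact: ltW|apply: mulr_ge0 => //; exact: powR_ge0].
  lra.
have dp := L1leM dL mp pK.
have dv := L1leM dL (L1le_measurable vL) (E_bnd h0 (mV t) (@VK t)).
have e1 : \int[mu]_x (q x * p x) <= tau * (cdrift * powR (h + h) 8^-1 +
    (K * clate h + (@cE R n * K * powR h (- 4^-1)) * (cD a * w h * (L * M))) * powR tau 4^-1).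
  have q3p := L1leM q3 mp pK.
  have -> : \int[mu]_x (q x * p x) = \int[mu]_x ((q x - tau * Dop a h (F t) x) * p x) +
      tau * \int[mu]_x (Dop a h (F t) x * p x).
    rewrite -(RintZ tau dp) -(RintD q3p (L1leZ tau dp)).
    by apply: eq_Rintegral => x _; ring.
  have i1 := le_trans (ler_norm _) (L1le_Rintegral q3p).
  have dpv := L1leM dL (L1le_measurable (L1leB vL pL)) pv.
  have i2 : \int[mu]_x (Dop a h (F t) x * p x) <= cdrift * powR (h + h) 8^-1 +
      (@cE R n * K * powR h (- 4^-1)) * (cD a * w h * (L * M)) * powR tau 4^-1.
    have -> : \int[mu]_x (Dop a h (F t) x * p x) = \int[mu]_x (Dop a h (F t) x * Eop h (V t) x)
        - \int[mu]_x (Dop a h (F t) x * (Eop h (V t) x - p x)).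
      by rewrite -(RintB dv dpv); apply: eq_Rintegral => x _; ring.
    apply: lerD.
      rewrite (D_dual a h0 (FL t0) vL) (DE a h0 h0 (VL t0)).
      apply: le_trans (ler_norm _) _; rewrite normrN.
      have -> : \int[mu]_x (F t x * Dop a (h + h) (V t) x) =
          \int[mu]_x (Dop a (h + h) (V t) x * F t x).
        by apply: eq_Rintegral => x _; rewrite mulrC.
      exact: drift_small.
    apply: le_trans (ler_norm _) _; rewrite normrN; apply: le_trans (L1le_Rintegral dpv) _.
    rewrite le_eqVlt; apply/orP; left; apply/eqP.
    rewrite powRM ?(ltW tau0) ?invr_ge0 ?(ltW h0)// -(powR_inv1 (ltW h0)) -powRrM mulN1r.
    by ring.
  have := ler_wpM2l (ltW tau0) i2; move: i1; lra.
by rewrite /cenergy; move: e1 e2; lra.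
Qed.

End energy.


(** * The L^2 norm along the heat flow *)

Section heat_energy.
Context {R : realType} {n : nat}.
Local Notation mu := (leb R n).
Local Notation pn t := (powR t (- (n%:R / 2))).
Implicit Types (v g : 'rV[R]_n -> R) (A B tau : R).

Lemma sqr_L1le g A B : L1le g A -> bnd g B -> L1le (fun x => g x ^+ 2) (B * A).
Proof. by move=> gA gB; exact: L1leM gA (L1le_measurable gA) gB. Qed.

Lemma sqr_L1le_int g A B : L1le g A -> bnd g B ->
  L1le (fun x => g x ^+ 2) (\int[mu]_x (g x ^+ 2)).
Proof.
move=> gA gB; have := integrable_L1le (L1le_integrable (sqr_L1le gA gB)).
rewrite (_ : \int[mu]_x `|g x ^+ 2| = \int[mu]_x (g x ^+ 2))//.
by apply: eq_Rintegral => x _; rewrite ger0_norm// sqr_ge0.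
Qed.

Lemma int_sqr_ge0 g A B : L1le g A -> bnd g B -> 0 <= \int[mu]_x (g x ^+ 2).
Proof. by move=> gA gB; exact: L1le_ge0 (sqr_L1le_int gA gB). Qed.

Lemma int_sqr_le g A B : L1le g A -> bnd g B -> \int[mu]_x (g x ^+ 2) <= B * A.
Proof.
by move=> gA gB; exact: le_trans (ler_norm _) (L1le_Rintegral (sqr_L1le gA gB)).
Qed.

(** By symmetry the middle term is the integral of g times its second iterate, so the claim says
    that the integral of the square of their difference is nonnegative. *)
Lemma heat_sqr_midconvex g A B tau : 0 < tau -> L1le g A -> bnd g B ->
  2 * \int[mu]_x (Eop tau g x ^+ 2) <=
  \int[mu]_x (g x ^+ 2) + \int[mu]_x (Eop tau (Eop tau g) x ^+ 2).
Proof.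
move=> t0 gA gB; have EA := E_L1 t0 gA; have EB := E_bnd t0 (L1le_measurable gA) gB.
have EEA := E_L1 t0 EA; have EEB := E_bnd t0 (L1le_measurable EA) EB.
have -> : \int[mu]_x (Eop tau g x ^+ 2) = \int[mu]_x (g x * Eop tau (Eop tau g) x).
  by rewrite -(E_dual t0 gA EA); apply: eq_Rintegral => x _; rewrite expr2.
have gE := L1leM gA (L1le_measurable EEA) EEB.
rewrite -subr_ge0 -(RintZ 2 gE) -(RintD (sqr_L1le gA gB) (sqr_L1le EEA EEB)).
rewrite -(RintB (L1leD (sqr_L1le gA gB) (sqr_L1le EEA EEB)) (L1leZ 2 gE)).
apply: Rintegral_ge0 => x _.
have -> : forall p q : R, p ^+ 2 + q ^+ 2 - 2 * (p * q) = (p - q) ^+ 2 by move=> p q; ring.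
exact: sqr_ge0.
Qed.

Lemma midconvex_drop (c : nat -> R) : (forall m, 2 * c m.+1 <= c m + c m.+2) ->
  forall m, c 0%N - c m <= m%:R * (c 0%N - c 1%N).
Proof.
move=> cc; have dec m : c m - c m.+1 <= c 0%N - c 1%N.
  by elim: m => // m IH; have := cc m; lra.
elim=> [|m IH]; first by rewrite subrr mul0r.
by have := dec m; rewrite -natr1 mulrDl mul1r; lra.
Qed.

Lemma iter_heat v A tau m : 0 < tau -> L1le v A ->
  iter m.+1 (Eop tau) v = Eop (m.+1%:R * tau) v.
Proof.
move=> t0 vA; elim: m => [|m IH]; first by rewrite mul1r.
have p : 0 < m.+1%:R * tau by rewrite mulr_gt0.
rewrite iterS IH (EE t0 p vA).
by rewrite -[m.+2%:R]natr1 mulrDl mul1r addrC.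
Qed.

(* The squared L^2 norm is midpoint convex along the heat flow, so that its first drop is
   at least the average one. *)
Lemma heat_sqr_drop v A B tau N : 0 < tau -> (0 < N)%N -> L1le v A -> bnd v B ->
  \int[mu]_x (Eop tau v x ^+ 2) <= \int[mu]_x (v x ^+ 2) -
    (\int[mu]_x (v x ^+ 2) - pn (N%:R * tau) * A * A) / N%:R.
Proof.
move=> t0 N0 vA vB.
have vm m : L1le (iter m (Eop tau) v) A /\ bnd (iter m (Eop tau) v) B.
  elim: m => //= m [hA hB]; split; first exact: E_L1.
  exact: E_bnd (L1le_measurable hA) hB.
pose c m := \int[mu]_x (iter m (Eop tau) v x ^+ 2).
have cc m : 2 * c m.+1 <= c m + c m.+2.
  by have [hA hB] := vm m; exact: heat_sqr_midconvex t0 hA hB.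
have h := midconvex_drop cc N.
have cN : c N <= pn (N%:R * tau) * A * A.
  case: N N0 {h} => // N _; rewrite /c (iter_heat N t0 vA).
  have Nt : 0 < N.+1%:R * tau by rewrite mulr_gt0.
  exact: int_sqr_le (E_L1 Nt vA) (E_L1bnd Nt vA).
have Np : 0 < N%:R :> R by rewrite ltr0n.
have : (c 0%N - pn (N%:R * tau) * A * A) / N%:R <= c 0%N - c 1%N.
  rewrite ler_pdivrMr// [leRHS]mulrC; move: h cN; lra.
by rewrite /c /=; lra.
Qed.

(** The weighted inequality |pq| <= lm p^2 + q^2 / lm replaces Cauchy-Schwarz; the weight is fixed
    by the caller. The square of the kernel integrates to at most s^(-n/2). *)
Lemma E_L2_sup s v A B lm x : 0 < s -> 0 < lm -> L1le v A -> bnd v B ->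
  `|Eop s v x| <= lm * pn s + \int[mu]_x (v x ^+ 2) / lm.
Proof.
move=> s0 l0 vA vB.
have gA := L1le_reflect x (@gauss_L1 R n s s0).
have gB : bnd (fun y : 'rV[R]_n => gauss s (x - y)) (pn s) by move=> y; exact: gauss_le.
have h1 := L1leZ lm (sqr_L1le gA gB).
have h2 := L1leZ lm^-1 (sqr_L1le_int vA vB).
have := L1leD h1 h2; rewrite mulr1 gtr0_norm// gtr0_norm ?invr_gt0// [lm^-1 * _]mulrC => h.
have := L1le_Rintegral (f := fun y => gauss s (x - y) * v y); apply.
rewrite -[X in L1le _ X]mul1r; apply: (L1le_dom _ _ _ h) => //.
- by apply: measurable_funM; [exact: L1le_measurable gA|exact: L1le_measurable vA].
- move=> y; rewrite mul1r; apply: le_trans (ler_norm _).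
  rewrite normrM -(@real_normK _ (v y)) ?num_real// (ger0_norm (gauss_ge0 _ _)).
  move: (gauss s (x - y)) (`|v y|) (gauss_ge0 s (x - y)) (normr_ge0 (v y)) => p q p0 q0.
  rewrite -(ler_pM2l l0).
  have -> : lm * (lm * p ^+ 2 + lm^-1 * q ^+ 2) = (lm * p) ^+ 2 + q ^+ 2.
    by field; rewrite gt_eqF.
  by have := sqr_ge0 (lm * p - q); have := mulr_ge0 (ltW l0) (mulr_ge0 p0 q0); nra.
Qed.

End heat_energy.

Section reals.
Context {R : realType}.

(** While y stays above eps, each step lowers it by at least eps / (4 N), which cannot go on forever
    as y is nonnegative. *)
Lemma linear_decay (y : nat -> R) (eps N : R) : 0 < eps -> 0 < N -> (forall j, 0 <= y j) ->
  (forall j, y j.+1 <= y j - (y j - 3 * eps / 4) / N) -> exists j, y j <= eps.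
Proof.
move=> e0 N0 y0 step; apply: contrapT => H.
have big j : eps < y j by rewrite ltNge; apply/negP => yj; apply: H; exists j.
have p0 : 0 < eps / 4 / N by rewrite !divr_gt0.
have lin j : y j <= y 0%N - j%:R * (eps / 4 / N).
  elim: j => [|j IH]; first by rewrite mul0r subr0.
  apply: le_trans (step j) _; rewrite -[j.+1%:R]natr1 [(_ + 1) * _]mulrDl mul1r.
  have h : eps / 4 / N <= (y j - 3 * eps / 4) / N.
    by rewrite ler_pM2r ?invr_gt0//; have := big j; lra.
  by rewrite opprD addrA; apply: lerB.
have := lin (Num.truncn (y 0%N / (eps / 4 / N))).+1.
have := Num.Theory.truncnS_gt (y 0%N / (eps / 4 / N)); rewrite ltr_pdivrMr// => h3 h4.
have := le_trans (y0 _) h4; rewrite subr_ge0 => h5.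
by have := lt_le_trans h3 h5; rewrite ltxx.
Qed.

Lemma powR_small (c e r : R) : 0 <= c -> 0 < e -> 0 < r ->
  exists2 d : R, 0 < d & forall x, 0 < x -> x <= d -> c * powR x r <= e.
Proof.
move=> c0 e0 r0; have c1 : 0 < c + 1 by rewrite ltr_wpDl.
have ec : 0 < e / (c + 1) by rewrite divr_gt0.
exists (powR (e / (c + 1)) r^-1) => [|x x0 xd]; first exact: powR_gt0.
have : powR x r <= e / (c + 1).
  have -> : e / (c + 1) = powR (powR (e / (c + 1)) r^-1) r.
    by rewrite -powRrM mulVf ?lt0r_neq0// powRr1 ?(ltW ec).
  by apply: ge0_ler_powR; rewrite ?nnegrE ?powR_ge0 ?(ltW r0) ?(ltW x0).
rewrite ler_pdivlMr// mulrC mulrDl mul1r => h; apply: le_trans h.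
by rewrite lerDl powR_ge0.
Qed.

End reals.

(** * Smallness of the solution at some time *)

Section smallness.
Context {R : realType} {n : nat} (a : 'rV[R]_n) (f : R -> R) (L K M M0 : R)
  (u0 : 'rV[R]_n -> R) (U V : R -> 'rV[R]_n -> R).
Context (n0 : (0 < n)%N) (cf : continuous f) (f0 : f 0 = 0) (K0 : 0 <= K) (L0 : 0 <= L)
  (lip : forall xi eta, `|xi| <= K -> `|eta| <= K -> `|f xi - f eta| <= L * `|xi - eta|)
  (u0A : L1le u0 M0) (HM : mild a f u0 K M U V).
Local Notation mu := (leb R n).
Local Notation w t := (powR t (- 2^-1)).
Local Notation pn t := (powR t (- (n%:R / 2))).

Let mf : measurable_fun [set: R] f := continuous_measurable_fun cf.
Let VL t (t0 : 0 < t) : L1le (V t) M := mild_VL HM t0.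
Let VK t : bnd (V t) K := mild_VK HM t.
Let M_ge0' : 0 <= M := M_ge0 HM.
Let mV t : measurable_fun [set: Rn R n] (V t) := jmeas_at t (mild_jV HM).

(** Three errors of size eps / 4 make up the 3 eps / 4 of [linear_decay]: what the heat flow leaves
    after time T, the drift, fixed by h, and the step error, fixed by tau = T / N once h is
    known. *)
Lemma energy_small (eps h0 : R) : 0 < eps -> 0 < h0 ->
  exists h t, [/\ 0 < h, h <= h0, 2 <= t & energy V h t <= eps].
Proof.
move=> e0 hh0; have n20 : 0 < n%:R / 2 :> R by rewrite divr_gt0// ltr0n.
have e4 : 0 < eps / 4 by rewrite divr_gt0.
have [d d0 hd] := @powR_small R (M * M) (eps / 4) (n%:R / 2) (mulr_ge0 M_ge0' M_ge0') e4 n20.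
(* With this choice T^(-n/2) = d^(n/2), so [powR_small] bounds what the heat flow alone leaves after
   time T. *)
pose T := d^-1; have T0 : 0 < T by rewrite invr_gt0.
have QT : pn T * M * M <= eps / 4.
  have := hd d d0 (lexx d); rewrite /T -(powR_inv1 (ltW d0)) -powRrM mulN1r opprK.
  by rewrite mulrC mulrA.
have cd0 : 0 <= 2 * T * cdrift a L K M.
  have := @chol1_ge0 R n a L L0; have : 0 <= cgrad a L.
    apply: addr_ge0; first exact: cD_ge0.
    by apply: mulr_ge0; [apply: mulr_ge0; [exact: sqr_ge0|exact: powR_ge0]|exact: mulr_ge0].
  move=> p1 p2; apply: mulr_ge0; first by apply: mulr_ge0 => //; exact: ltW.
  apply: mulr_ge0; first by apply: mulr_ge0.
  by apply: mulr_ge0 => //; apply: mulr_ge0.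
have [d1 d10 hd1] := @powR_small R _ (eps / 4) 8^-1 cd0 e4 ltac:(lra).
(* The drift is taken at h + h, hence d1 / 2; the entry 1/2 keeps h + h <= 1. *)
pose h := Num.min h0 (Num.min (d1 / 2) 2^-1).
have h_gt0 : 0 < h by rewrite !lt_min hh0 divr_gt0//=; lra.
have hh0' : h <= h0 by rewrite ge_min lexx.
have h1 : h <= d1 / 2 by rewrite !ge_min lexx orbT.
have h2 : h <= 2^-1 by rewrite !ge_min lexx !orbT.
have hd1' := hd1 (h + h) ltac:(lra) ltac:(lra).
have [d2 d20 hd2] := @powR_small R (`|2 * T * cenergy a L K M h|) (eps / 4) 4^-1
  (normr_ge0 _) e4 ltac:(lra).
pose m := Num.min 1 d2; have m0 : 0 < m by rewrite lt_min ltr01.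
pose N := (Num.truncn (T / m)).+1.
have Np : 0 < N%:R :> R by rewrite ltr0n.
pose tau := T / N%:R; have tau0 : 0 < tau by rewrite divr_gt0.
have taum : tau <= m.
  rewrite /tau ler_pdivrMr// mulrC -ler_pdivrMr//.
  by apply: ltW; exact: Num.Theory.truncnS_gt.
have tau1 : tau <= 1 by apply: le_trans taum _; rewrite ge_min lexx.
have tau2 : tau <= d2 by apply: le_trans taum _; rewrite ge_min lexx orbT.
have NT : N%:R * tau = T by rewrite /tau mulrC divfK// gt_eqF.
have c2 : 2 * T * (cenergy a L K M h * powR tau 4^-1) <= eps / 4.
  apply: le_trans (hd2 tau tau0 tau2); rewrite mulrA ler_wpM2r ?powR_ge0//.
  exact: ler_norm.
pose y j := energy V h (2 + j%:R * tau).
have t1 j : 1 < 2 + j%:R * tau.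
  by apply: (@lt_le_trans _ _ 2); [lra|rewrite lerDl mulr_ge0// ltW].
have t0 j : 0 < 2 + j%:R * tau by exact: lt_trans (t1 j).
have vL j := E_L1 h_gt0 (VL (t0 j)).
have vB j := E_bnd h_gt0 (mV (2 + j%:R * tau)) (@VK (2 + j%:R * tau)).
have y0 j : 0 <= y j by exact: int_sqr_ge0 (vL j) (vB j).
have step j : y j.+1 <= y j - (y j - 3 * eps / 4) / N%:R.
  have := @energy_step R n a f L K M M0 u0 U V cf f0 K0 L0 lip u0A HM _ tau h (t1 j) tau0 tau1
    h_gt0 ltac:(lra).
  have -> : 2 + j%:R * tau + tau = 2 + j.+1%:R * tau by rewrite -natr1; ring.
  move=> /le_trans; apply.
  have := heat_sqr_drop (N := N) tau0 isT (vL j) (vB j); rewrite NT.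
  rewrite -/(energy V h (2 + j%:R * tau)) -/(y j) => hdrop.
  apply: le_trans (lerD hdrop (lexx _)) _.
  rewrite -addrA lerD2l -subr_ge0.
  have -> : - ((y j - 3 * eps / 4) / N%:R) - (- ((y j - pn T * M * M) / N%:R) + 2 * tau *
     (cdrift a L K M * powR (h + h) 8^-1 + cenergy a L K M h * powR tau 4^-1)) =
     (3 * eps / 4 - pn T * M * M - 2 * T * cdrift a L K M * powR (h + h) 8^-1
        - 2 * T * (cenergy a L K M h * powR tau 4^-1)) / N%:R.
    by rewrite {1}/tau; field; rewrite gt_eqF.
  by apply: divr_ge0; [lra|exact: ltW].
have [j yj] := linear_decay e0 Np y0 step.
by exists h, (2 + j%:R * tau); split=> //; rewrite lerDl mulr_ge0// ltW.
Qed.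

(** From a time of small energy the solution runs for a short time d, chosen first so that the
    Duhamel part is at most eta / 2. The smoothing time h is kept below d / 2, so that e^(d Delta) V
    = e^((d-h) Delta) e^(h Delta) V and [E_L2_sup] applies with the energy. *)
Lemma sup_small (eta : R) : 0 < eta -> exists2 t, 2 <= t & bnd (U t) eta.
Proof.
move=> e0; have e2 : 0 < eta / 2 by rewrite divr_gt0.
have cc0 : 0 <= cD a * (L * K * 2).
  by apply: mulr_ge0; [exact: cD_ge0|apply: mulr_ge0 => //; exact: mulr_ge0].
have [d d0 hd] := @powR_small R _ (eta / 2) 2^-1 cc0 e2 ltac:(lra).
have pd0 : 0 < pn (d / 2) by rewrite powR_gt0// divr_gt0.
(* This weight makes the kernel term of [E_L2_sup] at most eta / 4, and an energy below eta / 4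
   times lm does the same for the other term. *)
pose lm := eta / 4 / pn (d / 2); have lm0 : 0 < lm by rewrite !divr_gt0.
have el0 : 0 < eta / 4 * lm by rewrite mulr_gt0// divr_gt0.
have d20 : 0 < d / 2 by rewrite divr_gt0.
have [h [t [h0 hh t2 ht]]] := energy_small el0 d20.
have t0 : 0 < t by lra.
exists (t + d); first lra.
have tt : t < t + d by rewrite ltrDl.
have dh : 0 < d - h by lra.
have td : t + d - t = d by ring.
move=> x; rewrite (mild_restart mf f0 K0 L0 lip u0A HM t0 tt) td.
apply: le_trans (ler_normD _ _) _.
have b2 := flux_duh_bnd mf f0 K0 L0 lip HM (ltW tt) (lexx (t + d)) x; rewrite td in b2.
have b3 := hd d d0 (lexx d).
have b1 := E_L2_sup x dh lm0 (E_L1 h0 (VL t0)) (E_bnd h0 (mV t) (@VK t)).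
rewrite (EE dh h0 (VL t0)) subrK -/(energy V h t) in b1.
have c1 : lm * pn (d - h) <= eta / 4.
  apply: (@le_trans _ _ (lm * pn (d / 2))).
    by rewrite ler_pM2l//; apply: powRN_anti; rewrite ?divr_ge0//; lra.
  by rewrite /lm divfK// gt_eqF.
have c2 : energy V h t / lm <= eta / 4 by rewrite ler_pdivrMr.
move: b2; rewrite (_ : cD a * (L * K * (2 * powR d 2^-1)) = cD a * (L * K * 2) * powR d 2^-1);
  last by ring.
by lra.
Qed.

End smallness.


(** * Ingredients of the decay bootstrap *)

Section decay.
Context {R : realType} {n : nat} (a : 'rV[R]_n) (f : R -> R) (C p L K M M0 : R)
  (u0 : 'rV[R]_n -> R) (U V : R -> 'rV[R]_n -> R).
Context (n0 : (0 < n)%N) (cf : continuous f) (f0 : f 0 = 0) (K0 : 0 <= K) (L0 : 0 <= L)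
  (lip : forall xi eta, `|xi| <= K -> `|eta| <= K -> `|f xi - f eta| <= L * `|xi - eta|)
  (p1 : 1 + n%:R^-1 < p) (C0 : 0 <= C)
  (flip : forall xi eta, `|f xi - f eta| <=
      C * (powR `|xi| (p - 1) + powR `|eta| (p - 1)) * `|xi - eta|)
  (u0A : L1le u0 M0) (HM : mild a f u0 K M U V).
Local Notation mu := (leb R n).
Local Notation w t := (powR t (- 2^-1)).
Local Notation pn t := (powR t (- (n%:R / 2))).
Local Notation F := (flux f V).

Let mf : measurable_fun [set: R] f := continuous_measurable_fun cf.
Let jF : jmeas F := flux_jmeas mf HM.
Let VL t (t0 : 0 < t) : L1le (V t) M := mild_VL HM t0.
Let VK t : bnd (V t) K := mild_VK HM t.
Let M_ge0' : 0 <= M := M_ge0 HM.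
Let mV t : measurable_fun [set: Rn R n] (V t) := jmeas_at t (mild_jV HM).
Let np0 : 0 < n%:R^-1 :> R. Proof. by rewrite invr_gt0 ltr0n. Qed.
Let nh0 : 0 <= n%:R / 2 :> R. Proof. by rewrite divr_ge0. Qed.

Lemma geometric_squeeze (y c k : R) :
  0 <= k -> (forall j : nat, y <= c + 10^-1 ^+ j * k) -> y <= c.
Proof.
move=> k0 h; apply/ler_addgt0Pr => e e0.
have k1 : 0 < k + 1 by rewrite ltr_wpDl.
have small j : 10^-1 ^+ j * (j%:R + 1) <= 1 :> R.
  elim: j => [|j IH]; first by rewrite expr0 add0r mulr1.
  have p0 : 0 <= 10^-1 ^+ j :> R by rewrite exprn_ge0// invr_ge0.
  have q0 : 0 <= j%:R :> R by [].
  rewrite -[j.+1%:R]natr1 exprS; move: p0 q0 IH; move: (10^-1 ^+ j) (j%:R) => P q p0 q0 IH.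
  by have := mulr_ge0 p0 q0; nra.
pose j := Num.truncn (k / e).
have tj : k / e < j%:R + 1 by rewrite natr1; exact: Num.Theory.truncnS_gt.
rewrite ltr_pdivrMr// in tj.
apply: le_trans (h j) _; rewrite lerD2l.
have p0 : 0 <= 10^-1 ^+ j :> R by rewrite exprn_ge0// invr_ge0.
apply: (@le_trans _ _ (10^-1 ^+ j * ((j%:R + 1) * e))); first by rewrite ler_wpM2l// ltW.
by rewrite mulrA -[leRHS]mul1r ler_wpM2r// ltW.
Qed.

(** Inserting a bound m for V into the Duhamel formula returns N + m / 10. Iterated from the a
    priori bound K this converges to N / (1 - 1/10) = 10 N / 9. The lemma takes the place of
    continuity in time of the sup norm in the bootstrap. *)
Lemma short_time_growth s d N : 0 < s -> 0 <= N -> bnd (V s) N ->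
  cD a * (L * 2) * powR d 2^-1 <= 10^-1 ->
  forall r, 0 < r -> r <= d -> bnd (U (s + r)) (10 / 9 * N).
Proof.
move=> s0 N0 VN hd.
have step m : 0 <= m -> (forall r, 0 < r -> r <= d -> bnd (V (s + r)) m) ->
    forall r, 0 < r -> r <= d -> bnd (U (s + r)) (N + 10^-1 * m).
  move=> m0 Vm r r0 rd x.
  have sr : s < s + r by rewrite ltrDl.
  have e : s + r - s = r by ring.
  rewrite (mild_restart mf f0 K0 L0 lip u0A HM s0 sr) e.
  apply: le_trans (ler_normD _ _) _; apply: lerD.
    exact: E_bnd r0 (mV s) VN x.
  have Lm0 : 0 <= L * m by rewrite mulr_ge0.
  have b := duh_bnd a (b := fun=> L * m) jF (lexx (s + r)) _ (tbound_wcst Lm0 (ltW sr) (lexx _))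
    x.
  apply: le_trans (b _) _.
    move=> s' /andP[ss s'r] y; have := lip (VK s' y) (eta := 0); rewrite normr0 f0 !subr0.
    move=> /(_ K0)/le_trans; apply; rewrite ler_wpM2l//.
    have -> : s' = s + (s' - s) by ring.
    by apply: Vm; lra.
  rewrite e [leLHS](_ : _ = cD a * (L * 2) * powR r 2^-1 * m); last by ring.
  apply: ler_wpM2r => //; apply: le_trans hd.
  apply: ler_wpM2l; first by apply: mulr_ge0; [exact: cD_ge0|exact: mulr_ge0].
  apply: ge0_ler_powR => //; rewrite ?nnegrE ?(ltW r0)//; lra.
have iter_step j r : 0 < r -> r <= d -> bnd (U (s + r)) (10 / 9 * N + 10^-1 ^+ j * K).
  elim: j r => [|j IH] r r0 rd x.
    have := step K K0 (fun r _ _ => @VK (s + r)) r r0 rd x; move=> /le_trans; apply.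
    by rewrite expr0 mul1r; move: N0 K0; lra.
  have m0 : 0 <= 10 / 9 * N + 10^-1 ^+ j * K.
    by apply: addr_ge0; apply: mulr_ge0.
  have := step _ m0 _ r r0 rd x; move=> /(_ _)/le_trans; apply.
    by move=> r' r'0 r'd y; apply: le_trans (mild_VU HM _ _) (IH _ r'0 r'd y).
  by rewrite exprS le_eqVlt; apply/orP; left; apply/eqP; field.
by move=> r r0 rd x; apply: (geometric_squeeze K0) => j; exact: iter_step.
Qed.

Lemma f_pow z : `|f z| <= C * powR `|z| (p - 1) * `|z|.
Proof.
have := flip z 0; rewrite f0 !subr0 normr0 powR0 ?addr0//.
by have := np0; move: p1 => h1 h2; rewrite subr_eq0 gt_eqF//; lra.
Qed.

(** Write |z|^(p-1) as |z|^(p-1-1/n) |z|^(1/n) and use the decay in the second factor only: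
    (r^(-n/2))^(1/n) = r^(-1/2). The exponent of B is positive because p > 1 + 1/n. *)
Lemma pow_mix (z B m r : R) : 0 <= B -> 0 <= m -> 0 < r -> `|z| <= B -> `|z| <= m * pn r ->
  powR `|z| (p - 1) <= powR B (p - 1 - n%:R^-1) * powR m n%:R^-1 * w r.
Proof.
move=> B0 m0 r0 zB zm.
have [->|z0] := eqVneq z 0.
  rewrite normr0 powR0; first by apply: mulr_ge0; [apply: mulr_ge0|]; exact: powR_ge0.
  by have := np0; move: p1 => h1 h2; rewrite subr_eq0 gt_eqF//; lra.
rewrite -(@powR_DE _ _ (p - 1 - n%:R^-1) n%:R^-1) ?normr_gt0//; last by ring.
rewrite -mulrA; apply: ler_pM; rewrite ?powR_ge0//.
  by apply: ge0_ler_powR; rewrite ?nnegrE//; move: p1; lra.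
have -> : w r = powR (pn r) n%:R^-1.
  rewrite -powRrM; congr (powR _ _); field.
  by rewrite pnatr_eq0 -lt0n.
rewrite -powRM ?powR_ge0//.
by apply: ge0_ler_powR; rewrite ?nnegrE ?(ltW np0)//; apply: mulr_ge0 => //; exact: powR_ge0.
Qed.

(* [pow_mix] makes the flux O(r^(-1/2)) times a constant that is small with B. *)
Lemma decay_improve t1 th B m : 0 < t1 -> 0 < th -> 0 <= B -> M <= m ->
  cD a * (C * powR (2 * B) (p - 1 - n%:R^-1) * powR (2 * m) n%:R^-1) *
    cbeta 2^-1 * 2 * powR 2 (n%:R / 2) <= 4^-1 ->
  bnd (V t1) B ->
  (forall r, 0 < r -> r < th -> bnd (V (t1 + r)) (2 * B) /\ bnd (V (t1 + r)) (2 * m * pn r)) ->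
  bnd (U (t1 + th)) (5 / 4 * B) /\ bnd (U (t1 + th)) (5 / 4 * m * pn th).
Proof.
move=> t10 th0 B0 Mm small V1 VV.
have m0 : 0 <= m by exact: le_trans Mm.
set be := C * _ * _ in small.
have be0 : 0 <= be by apply: mulr_ge0; [apply: mulr_ge0|]; rewrite ?powR_ge0.
have tt : t1 < t1 + th by rewrite ltrDl.
have e : t1 + th - t1 = th by ring.
have cb0 : 0 <= cbeta 2^-1 :> R.
  rewrite /cbeta; apply: addr_ge0; last by rewrite mulr_ge0// powR_ge0.
  by apply: divr_ge0; [exact: powR_ge0|lra].
have tb (k : R) : 0 <= k -> tbound t1 (t1 + th)
    (fun s => w (t1 + th - s) * (k * w (s - t1))) (k * cbeta 2^-1).
  (* For al = 1/2 the Beta integral does not depend on the length th of the interval; this is what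
     makes the weight r^(-1/2) admissible for all times. *)
  move=> k0; have := tboundZ k0 (@tbound_beta R t1 (t1 + th) 2^-1 tt ltac:(lra)).
  rewrite subrr powRr0 mulr1.
  by congr (tbound _ _ _ _); apply/funext => s; ring.
have Fs s x : t1 < s < t1 + th -> `|F s x| <= be * w (s - t1) * `|V s x|.
  move=> /andP[s1 s2]; have r0 : 0 < s - t1 by lra.
  have [h1 h2] := VV (s - t1) r0 ltac:(lra).
  have es : t1 + (s - t1) = s by ring.
  rewrite es in h1 h2.
  apply: le_trans (f_pow _) _; apply: ler_wpM2r => //.
  rewrite /be -!mulrA; apply: ler_wpM2l => //; rewrite mulrA.
  by apply: pow_mix => //; exact: mulr_ge0.
have FB s : t1 < s < t1 + th -> bnd (F s) (be * (2 * B) * w (s - t1)).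
  move=> st x; apply: le_trans (Fs s x st) _.
  rewrite [leRHS](_ : _ = be * w (s - t1) * (2 * B)); last by ring.
  apply: ler_wpM2l; first by apply: mulr_ge0 => //; exact: powR_ge0.
  have /andP[s1 s2] := st; have [h1 _] := VV (s - t1) ltac:(lra) ltac:(lra).
  by have := h1 x; rewrite (_ : t1 + (s - t1) = s)//; ring.
have FL s : t1 < s < t1 + th -> L1le (F s) (be * (2 * m) * w (s - t1)).
  move=> st; have /andP[s1 s2] := st; have s0 : 0 < s by lra.
  have bw : 0 <= be * w (s - t1) by apply: mulr_ge0 => //; exact: powR_ge0.
  apply: L1le_trans (L1le_dom (jmeas_at s jF) (fun x => Fs s x st) bw (VL s0)).
  rewrite [leRHS](_ : _ = be * w (s - t1) * (2 * m)); last by ring.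
  by apply: ler_wpM2l => //; lra.
have FM s : t1 < s < t1 + th -> bnd (F s) (pn (s - t1) * (be * (2 * m) * w (s - t1))).
  move=> st x; apply: le_trans (Fs s x st) _.
  rewrite [leRHS](_ : _ = be * w (s - t1) * (2 * m * pn (s - t1))); last by ring.
  apply: ler_wpM2l; first by apply: mulr_ge0 => //; exact: powR_ge0.
  have /andP[s1 s2] := st; have [_ h2] := VV (s - t1) ltac:(lra) ltac:(lra).
  by have := h2 x; rewrite (_ : t1 + (s - t1) = s)//; ring.
have kB : 0 <= be * (2 * B) by rewrite mulr_ge0// mulr_ge0.
have km : 0 <= be * (2 * m) by rewrite mulr_ge0// mulr_ge0.
have b1 := duh_bnd a jF (lexx (t1 + th)) FB (tb _ kB).
have b2 := duh_mixed a jF (lexx t1) (lexx (t1 + th)) FL FM (tb _ km).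
have p2 : 1 <= powR 2 (n%:R / 2) :> R.
  by rewrite -[leLHS](powRr0 2) ler_powR//; lra.
rewrite (mild_restart mf f0 K0 L0 lip u0A HM t10 tt) e; split=> x.
  apply: le_trans (ler_normD _ _) _.
  apply: le_trans (lerD (E_bnd th0 (mV t1) V1 x) (b1 x)) _.
  have x0 : 0 <= cD a * be * cbeta 2^-1 * 2.
    by apply: mulr_ge0 => //; apply: mulr_ge0 => //; apply: mulr_ge0 => //; exact: cD_ge0.
  have h : cD a * be * cbeta 2^-1 * 2 <= 4^-1.
    by apply: le_trans small; rewrite ler_peMr.
  have := ler_wpM2r B0 h; lra.
apply: le_trans (ler_normD _ _) _.
apply: le_trans (lerD (E_L1bnd th0 (VL t10) x) (b2 x)) _.
rewrite e (powR_half (n%:R / 2) (ltW th0)).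
have q0 : 0 <= pn th by exact: powR_ge0.
have h := ler_wpM2r (mulr_ge0 m0 q0) small.
have h' := ler_wpM2l q0 Mm.
by lra.
Qed.

End decay.


(** * The bootstrap and the decay for all times *)

Section global_decay.
Context {R : realType} {n : nat} (a : 'rV[R]_n) (f : R -> R) (C p L K M M0 : R)
  (u0 : 'rV[R]_n -> R) (U V : R -> 'rV[R]_n -> R).
Context (n0 : (0 < n)%N) (cf : continuous f) (f0 : f 0 = 0) (K0 : 0 <= K) (L0 : 0 <= L)
  (lip : forall xi eta, `|xi| <= K -> `|eta| <= K -> `|f xi - f eta| <= L * `|xi - eta|)
  (p1 : 1 + n%:R^-1 < p) (C0 : 0 <= C)
  (flip : forall xi eta, `|f xi - f eta| <=
      C * (powR `|xi| (p - 1) + powR `|eta| (p - 1)) * `|xi - eta|)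
  (u0A : L1le u0 M0) (HM : mild a f u0 K M U V).
Local Notation pn t := (powR t (- (n%:R / 2))).

Let mf : measurable_fun [set: R] f := continuous_measurable_fun cf.
Let VK t : bnd (V t) K := mild_VK HM t.
Let M_ge0' : 0 <= M := M_ge0 HM.

Lemma mild_bnd t N : bnd (U t) N -> bnd (V t) N.
Proof. by move=> UN x; exact: le_trans (mild_VU HM t x) (UN x). Qed.

(** The admissible ratio r / th is g with g^(n/2) = 4/3. The number 4/3 is such that 5/4, 10/9 and
    4/3 have a product below 2, which closes the bootstrap. *)
Lemma decay_ratio : exists2 d : R, 0 < d & forall th r, 0 < th -> 0 < r -> r <= th * (1 + 2 * d)
  ->
  pn th <= 4 / 3 * pn r.
Proof.
have nn : 0 < n%:R / 2 :> R by rewrite divr_gt0// ltr0n.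
pose g := powR (4 / 3) (n%:R / 2)^-1 : R.
have g1 : 1 < g.
  have s0 : 0 < (n%:R / 2)^-1 :> R by rewrite invr_gt0.
  have h : (1 : R) < 4 / 3 by lra.
  by have := gt0_ltr_powR s0 _ _ h; rewrite powR1; apply; rewrite nnegrE; lra.
exists ((g - 1) / 2) => [|th r th0 r0 rt]; first by rewrite divr_gt0// subr_gt0.
have e1 : 1 + 2 * ((g - 1) / 2) = g by field.
rewrite e1 in rt.
have g0 : 0 < g by lra.
have pg : powR g (n%:R / 2) = 4 / 3.
  by rewrite /g -powRrM mulVf ?gt_eqF// powRr1//; lra.
have h := powRN_anti (ltW nn) r0 rt.
rewrite powRM ?(ltW th0) ?(ltW g0)// [powR g _]powRN pg in h.
have : 4 / 3 * (pn th * (4 / 3)^-1) <= 4 / 3 * pn r by rewrite ler_pM2l//; lra.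
by rewrite mulrCA mulfV ?mulr1//; lra.
Qed.

(** Induction over time intervals of length d: up to th the bounds with constant 2 improve to 5/4 by
    [decay_improve], and [short_time_growth] carries them a further d with the factor 10/9. *)
Lemma late_decay : exists2 t1, 2 <= t1 &
  forall r, 0 < r -> bnd (V (t1 + r)) (2 * (M + 1) * pn r).
Proof.
have np : 0 < n%:R^-1 :> R by rewrite invr_gt0 ltr0n.
have nh : 0 <= n%:R / 2 :> R by rewrite divr_ge0.
pose c := cD a * (C * powR (2 * (M + 1)) n%:R^-1) * cbeta 2^-1 * 2 * powR 2 (n%:R / 2).
have cb0 : 0 <= cbeta 2^-1 :> R.
  rewrite /cbeta; apply: addr_ge0; last by rewrite mulr_ge0// powR_ge0.
  by apply: divr_ge0; [exact: powR_ge0|lra].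
have c0 : 0 <= c.
  have c1 := cD_ge0 a; have c2 := @powR_ge0 R (2 * (M + 1)) n%:R^-1.
  have c3 := @powR_ge0 R 2 (n%:R / 2).
  rewrite /c; apply: mulr_ge0 => //; apply: mulr_ge0 => //; apply: mulr_ge0 => //.
  by apply: mulr_ge0 => //; apply: mulr_ge0.
have q4 : 0 < 4^-1 :> R by rewrite invr_gt0.
have q10 : 0 < 10^-1 :> R by rewrite invr_gt0.
have pp : 0 < p - 1 - n%:R^-1 by rewrite -addrA -opprD subr_gt0.
have [d0 d00 hd0] := @powR_small R c 4^-1 (p - 1 - n%:R^-1) c0 q4 pp.
pose B := Num.min 1 (d0 / 2).
have B0 : 0 < B by rewrite lt_min ltr01 divr_gt0.
have B1 : B <= 1 by rewrite ge_min lexx.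
have Bd : B <= d0 / 2 by rewrite ge_min lexx orbT.
have small : cD a * (C * powR (2 * B) (p - 1 - n%:R^-1) * powR (2 * (M + 1)) n%:R^-1) *
    cbeta 2^-1 * 2 * powR 2 (n%:R / 2) <= 4^-1.
  apply: le_trans (hd0 (2 * B) ltac:(lra) ltac:(lra)).
  by rewrite le_eqVlt; apply/orP; left; apply/eqP; rewrite /c; ring.
have [t1 t12 Ut1] := sup_small n0 cf f0 K0 L0 lip u0A HM B0.
have Vt1 := mild_bnd Ut1.
have t10 : 0 < t1 by lra.
have cL0 : 0 <= cD a * (L * 2) by apply: mulr_ge0; [exact: cD_ge0|exact: mulr_ge0].
have [d1 d10 hd1] := @powR_small R _ 10^-1 2^-1 cL0 q10 ltac:(lra).
have [d2 d20 hd2] := decay_ratio.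
pose d := Num.min 2^-1 (Num.min d1 d2).
have d_gt0 : 0 < d by rewrite !lt_min d10 d20 invr_gt0 ltr0n.
have dh : d <= 2^-1 by rewrite ge_min lexx.
have dd1 : d <= d1 by rewrite !ge_min lexx orbT.
have dd2 : d <= d2 by rewrite !ge_min lexx !orbT.
have hd := hd1 d d_gt0 dd1.
have bootstrap m : forall r, 0 < r -> r <= m%:R * d ->
    bnd (V (t1 + r)) (2 * B) /\ bnd (V (t1 + r)) (2 * (M + 1) * pn r).
  elim: m => [|m IH] r r0; first by rewrite mul0r; lra.
  rewrite -[m.+1%:R]natr1 [(_ + 1) * _]mulrDl mul1r => rm.
  have [h|h] := leP r (m%:R * d); first exact: IH.
  (* The decay bound has to be proved for r > 1 only: for r <= 1 it follows from the sup bound, as 2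
     B <= 2 <= 2 (M + 1) r^(-n/2). This is the reason for M + 1 in place of M. *)
  have key : bnd (V (t1 + r)) (2 * B) /\ (1 < r -> bnd (V (t1 + r)) (2 * (M + 1) * pn r)).
    case: m IH rm h => [|m] IH rm h.
      rewrite mul0r add0r in rm; split; last by lra.
      move=> x; apply: le_trans (mild_bnd (short_time_growth cf f0 K0 L0 lip u0A HM t10 (ltW B0)
        Vt1 hd r0 rm) x) _; lra.
    have th0 : 0 < m.+1%:R * d by rewrite mulr_gt0.
    move: (m.+1%:R * d) rm h th0 IH => th rm h th0 IH.
    have VV r' : 0 < r' -> r' < th -> bnd (V (t1 + r')) (2 * B) /\
        bnd (V (t1 + r')) (2 * (M + 1) * pn r').
      by move=> r'0 /ltW; exact: IH.
    have M1 : M <= M + 1 by lra.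
    have [I1 I2] := decay_improve n0 cf f0 K0 L0 lip p1 C0 flip u0A HM t10 th0 (ltW B0) M1
      small Vt1 VV.
    have pt0 : 0 <= pn th by exact: powR_ge0.
    have b1 : 0 <= 5 / 4 * B by apply: mulr_ge0 => //; exact: ltW.
    have m0 : 0 <= M + 1 by rewrite addr_ge0.
    have b2 : 0 <= 5 / 4 * (M + 1) * pn th by apply: mulr_ge0 => //; apply: mulr_ge0.
    have s0 : 0 < t1 + th by lra.
    have q0 : 0 < r - th by rewrite subr_gt0.
    have qd : r - th <= d by rewrite lerBlDl.
    have S1 := short_time_growth cf f0 K0 L0 lip u0A HM s0 b1 (mild_bnd I1) hd q0 qd.
    have S2 := short_time_growth cf f0 K0 L0 lip u0A HM s0 b2 (mild_bnd I2) hd q0 qd.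
    have er : t1 + th + (r - th) = t1 + r by ring.
    rewrite er in S1 S2; split=> [x|r1 x].
      by apply: le_trans (mild_bnd S1 x) _; lra.
    apply: le_trans (mild_bnd S2 x) _.
    (* From r > 1 and d <= 1/2 follows th >= 1/2, so the increment d is at most 2 d th. *)
    have rth : r <= th * (1 + 2 * d2).
      have th1 : 2^-1 <= th by lra.
      have h1 := ler_wpM2r (ltW d_gt0) th1; have h2 := ler_wpM2l (ltW th0) dd2.
      by apply: le_trans rm _; rewrite mulrDr mulr1 lerD2l; lra.
    have pq := hd2 th r th0 r0 rth.
    have pr0 : 0 <= pn r by exact: powR_ge0.
    have := ler_wpM2l m0 pq; have := mulr_ge0 m0 pr0; lra.
  have [k1 k2] := key; split=> //.
  have [r1|r1] := leP r 1; last exact: k2.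
  move=> x; apply: le_trans (k1 x) _.
  have pr1 : 1 <= pn r.
    by have := powRN_anti nh r0 r1; rewrite powR1.
  have m0 : 0 <= M by [].
  have := ler_wpM2l m0 pr1; lra.
exists t1 => // r r0.
have rd : r <= (Num.truncn (r / d)).+1%:R * d.
  by rewrite -ler_pdivrMr// ltW// Num.Theory.truncnS_gt.
by have [] := bootstrap _ r r0 rd.
Qed.

(** Up to time 2 t1 the bound K is enough; afterwards t - t1 >= t / 2, and counting the decay from 0
    instead of t1 costs 2^(n/2). *)
Lemma global_decay : exists2 c, 0 <= c & forall t, 0 < t -> bnd (V t) (c * pn t).
Proof.
have nh : 0 <= n%:R / 2 :> R by rewrite divr_ge0.
have [t1 t12 h] := late_decay.
have t10 : 0 < 2 * t1 by lra.
have P0 : 0 < pn (2 * t1) by rewrite powR_gt0.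
have c1 : 0 <= K / pn (2 * t1) by rewrite divr_ge0// ltW.
have c2 : 0 <= 2 * (M + 1) * powR 2 (n%:R / 2).
  by apply: mulr_ge0; [rewrite mulr_ge0// addr_ge0|exact: powR_ge0].
exists (K / pn (2 * t1) + 2 * (M + 1) * powR 2 (n%:R / 2)); first exact: addr_ge0.
move=> t t0 x; have p0 : 0 <= pn t by exact: powR_ge0.
have [tt|tt] := leP t (2 * t1).
  apply: (@le_trans _ _ (K / pn (2 * t1) * pn t)).
    apply: le_trans (VK t x) _.
    rewrite -mulrA ler_peMr// mulrC ler_pdivlMr// mul1r; exact: powRN_anti.
  by rewrite ler_wpM2r// lerDl.
apply: (@le_trans _ _ (2 * (M + 1) * powR 2 (n%:R / 2) * pn t));
  last by rewrite ler_wpM2r// lerDr.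
have r0 : 0 < t - t1 by lra.
have := h (t - t1) r0 x; rewrite (_ : t1 + (t - t1) = t); last by ring.
move=> /le_trans; apply; rewrite -[leRHS]mulrA; apply: ler_wpM2l.
  by rewrite mulr_ge0// addr_ge0.
rewrite -(powR_half _ (ltW t0)); apply: powRN_anti => //; lra.
Qed.

(** U agrees with V only almost everywhere, so its pointwise bound is obtained from one more
    application of [short_time_growth], started from V at a time no earlier than t / 2. *)
Lemma mild_decay : exists2 c, 0 <= c & forall t, 0 < t -> bnd (U t) (c * pn t).
Proof.
have nh : 0 <= n%:R / 2 :> R by rewrite divr_ge0.
have [c c0 hc] := global_decay.
have cL0 : 0 <= cD a * (L * 2) by apply: mulr_ge0; [exact: cD_ge0|exact: mulr_ge0].
have q10 : 0 < 10^-1 :> R by rewrite invr_gt0.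
have q2 : 0 < 2^-1 :> R by rewrite invr_gt0.
have [d d0 hd] := @powR_small R _ 10^-1 2^-1 cL0 q10 q2.
exists (10 / 9 * (c * powR 2 (n%:R / 2))).
  by apply: mulr_ge0; [lra|apply: mulr_ge0 => //; exact: powR_ge0].
move=> t t0 x; pose r := Num.min d (t / 2).
have r0 : 0 < r by rewrite lt_min d0 divr_gt0.
have rd : r <= d by rewrite ge_min lexx.
have rt : r <= t / 2 by rewrite ge_min lexx orbT.
have s0 : 0 < t - r by lra.
have pt0 (s : R) : 0 <= pn s by exact: powR_ge0.
have := short_time_growth cf f0 K0 L0 lip u0A HM s0 (mulr_ge0 c0 (pt0 _)) (hc _ s0) (hd d d0
  (lexx d))
  r0 rd x.
rewrite subrK => /le_trans; apply.
rewrite -[leRHS]mulrA; apply: ler_wpM2l; first lra.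
rewrite -[leRHS]mulrA; apply: ler_wpM2l => //.
by rewrite -(powR_half _ (ltW t0)); apply: powRN_anti => //; lra.
Qed.

(** With the flux of U in the integral the truncation has disappeared, and U satisfies a closed
    equation at every point. *)
Lemma mild_duhamel t : 0 < t -> U t = fun x => Eop t u0 x + duh a (flux f U) 0 t t x.
Proof.
move=> t0; rewrite (mild_U HM t0); apply/funext => x; congr (_ + _).
apply: eq_tint => s /andP[s0 _]; rewrite /Dop (convol_ae (psi := flux f U s))//.
- exact: measurable_dgauss.
- exact: jmeas_at (flux_jmeas mf HM).
- exact: (measurableT_comp mf (jmeas_at s (mild_jU HM))).
- by apply: (ae_imp (mild_ae HM s0)) => y e; rewrite /flux/= e.
Qed.

End global_decay.


(** * Asymptotic profiles *)

Section rates.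
Context {R : realType}.
Local Notation TR := (measurableTypeR R).
Local Notation lam := (@lebesgue_measure R).
Local Notation w t := (powR t (- 2^-1)).
Implicit Types (s t ga al : R).

(** The three regimes are those of the integral of s^(-(1/2 + ga)) over (1, t), which grows, is a
    logarithm, or stays bounded. *)
Definition rate ga t : R :=
  if ga < 2^-1 then powR t (- ga)
  else if ga == 2^-1 then w t * ln (2 + t) else w t.

(* t - s >= t (1 - s) for s in (0, 1) and t >= 1. *)
Lemma early_bound t al : 1 <= t -> 0 <= al < 1 ->
  tbound 0 1 (fun s => w (t - s) * powR s (- al)) (w t * cbeta al).
Proof.
move=> t1 al01; have t0 : 0 < t by lra.
have := tboundZ (powR_ge0 t (- 2^-1)) (@tbound_beta R 0 1 al ltr01 al01).
rewrite subr0 powR1 mulr1; apply: tbound_dom.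
  apply: measurable_funM; first exact: measurable_powRBl.
  by have := @measurable_powRB R 0 (- al); under eq_fun do rewrite subr0.
move=> s /andP[s0 s1]; rewrite subr0 mulr_ge0 ?powR_ge0//= mulrA.
apply: ler_wpM2r; first exact: powR_ge0.
have s1' : 0 <= 1 - s by lra.
have h0 : 0 <= 2^-1 :> R by rewrite invr_ge0.
rewrite -powRM ?(ltW t0)//; apply: powRN_anti => //.
  by apply: mulr_gt0 => //; lra.
by rewrite mulrBr mulr1 lerB// ler_peMl// ltW.
Qed.

Lemma tail_bound t F al I : 1 <= t ->
  (forall x : R, 1 < x -> is_derive x 1 F (powR x (- al))) ->
  (forall x, 1 < x -> x < t -> F t - F x <= I) -> 0 <= I ->
  tbound 1 t (fun s => powR s (- al)) I.
Proof.
move=> t1 dF FI I0; split.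
- by have := @measurable_powRB R 0 (- al); under eq_fun do rewrite subr0.
- by move=> s _; exact: powR_ge0.
- rewrite win_integralE; move: t1; rewrite le_eqVlt => /orP[/eqP <-|t1].
    by rewrite set_itv_ge ?integral_set0 ?lee_fin// bnd_simp ltxx.
  apply: (ge0_FTC_le t1 dF) => [x x1|x x1|].
  + apply/differentiable_continuous/derivable1_diffP.
    have x0 : 0 < x by lra.
    by have [] := is_derive1_powR (- al) x0.
  + exact: powR_ge0.
  + exact: FI.
Qed.

(** For ga < 1/2 the weight is integrable at 0 and the Beta bound on (0, t) does. Otherwise
    [tbound_split] is used with the integral of s^(-al) over (1, t), and its second half contributes
    O(t^(-ga)), which is within t^(-1/2). *)
Lemma late_bound ga : 0 < ga -> exists2 c, 0 <= c & forall t, 1 <= t ->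
  tbound 1 t (fun s => w (t - s) * powR s (- (2^-1 + ga))) (c * rate ga t).
Proof.
move=> ga0; set al := 2^-1 + ga.
have h0 : 0 <= 2^-1 :> R by rewrite invr_ge0.
have E (g : R -> R) : (fun s => g s * powR (s - 0) (- al)) = fun s => g s * powR s (- al).
  by apply/funext => s; rewrite subr0.
have p2 (r : R) : 0 <= powR 2 r by exact: powR_ge0.
have split t I : 1 <= t -> tbound 1 t (fun s => powR s (- al)) I -> 2^-1 <= ga ->
    tbound 1 t (fun s => w (t - s) * powR s (- al))
      (powR 2 2^-1 * (w t * I) + 2 * powR 2 al * w t).
  move=> t1 bI ga2; have t0 : 0 < t by lra.
  have al0 : 0 <= al by rewrite /al; lra.
  have bI' : tbound 1 t (fun s => powR (s - 0) (- al)) I.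
    by rewrite (_ : (fun s => _) = fun s => powR s (- al))//; apply/funext => s; rewrite subr0.
  have := tbound_split ler01 t1 (lexx t) t0 al0 bI'.
  rewrite E subr0 !(powR_half _ (ltW t0)); apply: tbound_le.
  rewrite -mulrA lerD2l.
  rewrite [leLHS](_ : _ = 2 * powR 2 al * (powR t (- al) * powR (t - 1) 2^-1)); last by ring.
  apply: ler_wpM2l; first by rewrite mulr_ge0.
  apply: (@le_trans _ _ (powR t (- al) * powR t 2^-1)).
    apply: ler_wpM2l; first exact: powR_ge0.
    by apply: ge0_ler_powR; rewrite ?nnegrE//; lra.
  rewrite (@powR_DE _ t (- al) 2^-1 (- ga))//; last by rewrite /al; ring.
  by rewrite ler_powR//; lra.
have [ga2|ga2|ga2] := ltgtP ga 2^-1.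
- have al01 : 0 <= al < 1 by rewrite /al; apply/andP; split; lra.
  exists (cbeta al).
    rewrite /cbeta; apply: addr_ge0; last by rewrite mulr_ge0.
    by apply: divr_ge0 => //; move/andP: al01; lra.
  move=> t t1; have t0 : 0 < t by lra.
  have := tbound_sub ler01 (lexx t) (tbound_beta t0 al01).
  rewrite E subr0 /rate ga2.
  by rewrite (_ : 2^-1 - al = - ga)//; rewrite /al; ring.
(* The integral of s^(-al) over (1, oo). *)
- pose I : R := (ga - 2^-1)^-1; have I0 : 0 < I by rewrite invr_gt0 subr_gt0.
  exists (powR 2 2^-1 * I + 2 * powR 2 al).
    by apply: addr_ge0; apply: mulr_ge0 => //; exact: ltW.
  move=> t t1; rewrite /rate ltNge (ltW ga2)/= gt_eqF//.
  have n1 : 1 - al != 0 by rewrite /al lt_eqF//; lra.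
  have bI : tbound 1 t (fun s => powR s (- al)) I.
    apply: (@tail_bound t (fun s => powR s (1 - al) / (1 - al))) => //; last exact: ltW.
    + move=> x x1; have x0 : 0 < x by lra.
      have d1 := is_derive1_powR (1 - al) x0.
      have d2 : is_derive x 1 (fun s : R => powR s (1 - al) / (1 - al))
         ((1 - al) * powR x (1 - al - 1) * (1 - al)^-1).
        by apply: is_derive_eq; rewrite /GRing.scale/=; ring.
      apply: (is_derive_eq d2); rewrite (_ : 1 - al - 1 = - al); last by ring.
      by field.
    + move=> x x1 xt; rewrite (_ : 1 - al = - (ga - 2^-1)); last by rewrite /al; field.
      rewrite -mulrBl invrN -/I mulrN -mulNr opprB -[leRHS]mul1r ler_pM2r//.
      have x0 : 0 < x by lra.
      have g0 : 0 <= ga - 2^-1 by lra.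
      have := powRN_anti g0 ltr01 (ltW x1); rewrite powR1.
      have := @powR_ge0 R t (- (ga - 2^-1)); lra.
  apply: tbound_le (split t I t1 bI (ltW ga2)).
  by rewrite le_eqVlt; apply/orP; left; apply/eqP; ring.
- have l2 : 0 < ln 2 :> R by rewrite ln_gt0//; lra.
  exists (powR 2 2^-1 + 2 * powR 2 al / ln 2).
    by apply: addr_ge0 => //; apply: divr_ge0; [exact: mulr_ge0|exact: ltW].
  move=> t t1; have t0 : 0 < t by lra.
  rewrite /rate ga2 ltxx eqxx.
  have al1 : al = 1 by rewrite /al ga2; field.
  have lt : ln t <= ln (2 + t) by rewrite ler_ln ?posrE//; lra.
  have l2t : ln 2 <= ln (2 + t) by rewrite ler_ln ?posrE//; lra.
  have bI : tbound 1 t (fun s => powR s (- al)) (ln t).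
    apply: (@tail_bound t (@ln R)) => //; last exact: ln_ge0.
    + move=> x x1; have x0 : 0 < x by lra.
      apply: (is_derive_eq (is_derive1_ln x0)).
      by rewrite al1 powR_inv1// ltW.
    + by move=> x x1 xt; rewrite gerBl ln_ge0// ltW.
  have ga2' : 2^-1 <= ga by rewrite ga2.
  apply: tbound_le (split t _ t1 bI ga2').
  have wt : 0 <= w t by exact: powR_ge0.
  rewrite [leRHS]mulrDl; apply: lerD.
    by apply: ler_wpM2l => //; apply: ler_wpM2l.
  rewrite [leRHS](_ : _ = 2 * powR 2 al * (w t * (ln (2 + t) / ln 2))); last by ring.
  apply: ler_wpM2l; first exact: mulr_ge0.
  by apply: ler_peMr => //; rewrite ler_pdivlMr// mul1r.
Qed.

Lemma rate_ge0 ga t : 1 <= t -> 0 <= rate ga t.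
Proof.
move=> t1; rewrite /rate; case: ifP => _; first exact: powR_ge0.
by case: ifP => _; rewrite ?mulr_ge0 ?powR_ge0// ln_ge0//; lra.
Qed.

Lemma rate_half ga : exists2 c, 0 <= c & forall t, 1 <= t -> w t <= c * rate ga t.
Proof.
have l2 : 0 < ln 2 :> R by rewrite ln_gt0//; lra.
exists (1 + (ln 2)^-1) => [|t t1]; first by rewrite addr_ge0// invr_ge0 ltW.
have c1 : 1 <= 1 + (ln 2)^-1 :> R by rewrite lerDl invr_ge0 ltW.
have wt : 0 <= w t by exact: powR_ge0.
rewrite /rate; case: ltgtP => ga2.
- apply: (@le_trans _ _ (powR t (- ga))); first by rewrite ler_powR//; lra.
  by rewrite ler_peMl// powR_ge0.
- by rewrite ler_peMl.
- have l2t : ln 2 <= ln (2 + t) by rewrite ler_ln ?posrE//; lra.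
  rewrite mulrCA ler_peMr//.
  have : 1 <= (ln 2)^-1 * ln (2 + t) by rewrite mulrC ler_pdivlMr// mul1r.
  have : 0 <= ln (2 + t) by apply: ln_ge0; lra.
  lra.
Qed.

End rates.

(** * Heat flow of a datum with finite first moment *)

Section heat_mass.
Context {R : realType} {n : nat}.
Local Notation mu := (leb R n).
Local Notation w t := (powR t (- 2^-1)).
Local Notation pn t := (powR t (- (n%:R / 2))).
Implicit Types (phi : 'rV[R]_n -> R) (A B t : R).

Lemma first_moment phi : in_L11 phi -> exists M1, L1le (fun y => l1n y * phi y) M1.
Proof.
move=> [/in_L1_L1le[A [mphi _]] h].
have H (s : seq 'I_n) : exists M1, L1le (fun y => (\sum_(j <- s) `|y ord0 j|) * phi y) M1.
  elim: s => [|j s [B IH]].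
    exists 0; split.
      rewrite (_ : (fun y => _) = fun=> 0)//; apply/funext => y; rewrite big_nil mul0r//.
    by rewrite integral0_eq// => x _; rewrite big_nil mul0r normr0.
  have [B' hB'] := in_L1_L1le (h j).
  exists (1 * B' + B).
  suff -> : (fun y : 'rV[R]_n => (\sum_(i <- j :: s) `|y ord0 i|) * phi y) =
      fun y => `|y ord0 j| * phi y + (\sum_(i <- s) `|y ord0 i|) * phi y.
    apply: L1leD => //; apply: (L1le_dom _ _ ler01 hB').
    - apply: measurable_funM => //; apply: measurableT_comp => //; exact: measurable_coord.
    - by move=> y; rewrite !normrM normr_id mul1r.
  by apply/funext => y; rewrite big_cons mulrDl.
by have [M1 HM1] := H (index_enum 'I_n); exists M1.
Qed.

(** The difference is the integral in y of (G_t(x - y) - G_t(x)) phi(y). Minkowski's inequality and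
    [gauss_shift_L1] leave the weight [l1n y], that is, the first moment. *)
Lemma heat_mass_L1 t phi A M1 : 0 < t -> L1le phi A -> L1le (fun y => l1n y * phi y) M1 ->
  L1le (fun x => Eop t phi x - (\int[mu]_y phi y) * gauss t x)
    (2 * (1 + @cdg R n) * w t * M1).
Proof.
move=> t0 pA pM; have [mp _] := pA; have mg := @measurable_gauss R n t.
have c0 : 0 <= 2 * (1 + @cdg R n) * w t.
  by apply: mulr_ge0; [apply: mulr_ge0 => //; apply: addr_ge0 => //;
    exact: cdg_ge0|exact: powR_ge0].
pose G (z : Rn R n * Rn R n) := (gauss t (z.2 - z.1) - gauss t z.2) * phi z.1.
have mG : measurable_fun setT G.
  apply: measurable_funM; last exact: (measurableT_comp mp measurable_fst).
  apply: measurable_funB; last exact: (measurableT_comp mg measurable_snd).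
  apply: (measurableT_comp mg).
  by apply: measurable_sub2; [exact: measurable_snd|exact: measurable_fst].
have E x : Eop t phi x - (\int[mu]_y phi y) * gauss t x = \int[mu]_y G (y, x).
  rewrite mulrC -(RintZ (gauss t x) pA).
  rewrite -(RintB (convol_L1le x mg (gauss_le t0) pA) (L1leZ (gauss t x) pA)).
  by apply: eq_Rintegral => y _; rewrite /G/= mulrBl.
split.
  apply: measurable_funB; first exact: L1le_measurable (E_L1 t0 pA).
  exact: measurable_funM.
under eq_integral do rewrite E.
apply: le_trans (integral_Rintegral_le mu mu mG) _.
have [mpM pM'] := pM.
apply: (@le_trans _ _ (\int[mu]_y ((2 * (1 + @cdg R n) * w t)%:E * `|l1n y * phi y|%:E))%E).
  apply: ge0_le_integral => //.
  - by move=> y _; exact: integral_ge0.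
  - apply: (measurable_fun_fubini_tonelli_F (m2 := mu) (fun z => `|G z|%:E)) => //.
    by apply/measurable_EFinP; exact: measurableT_comp.
  - by apply: emeasurable_funM => //; apply/measurable_EFinP; exact: measurableT_comp.
  - move=> y _; have [mk kA'] := L1leZ (phi y) (L1leN (gauss_shift_L1 y t0)).
    rewrite (_ : (fun x => `|G (y, x)|%:E) = fun x => `|phi y * - (gauss t x - gauss t (x -
      y))|%:E); last first.
      by apply/funext => x; rewrite /G/= opprB mulrC.
    apply: le_trans kA' _; rewrite -EFinM lee_fin normrM (ger0_norm (l1n_ge0 y)).
    by rewrite le_eqVlt; apply/orP; left; apply/eqP; ring.
rewrite ge0_integralZl//; last by apply/measurable_EFinP; exact: measurableT_comp.
by rewrite [X in (_ <= X)%E]EFinM lee_wpmul2l// lee_fin.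
Qed.

Lemma E_Z t c phi A : 0 < t -> L1le phi A -> Eop t (fun y => c * phi y) = fun x => c * Eop t phi
  x.
Proof.
move=> t0 pA; apply/funext => x; rewrite /Eop /convol.
rewrite -(RintZ c (convol_L1le x (@measurable_gauss R n t) (gauss_le t0) pA)).
by apply: eq_Rintegral => y _; rewrite mulrCA.
Qed.

(** The heat flow over t / 2, from L^1 to L^oo, is applied to the L^1 estimate at time t / 2. *)
Lemma heat_mass_bnd t phi A M1 : 0 < t -> L1le phi A -> L1le (fun y => l1n y * phi y) M1 ->
  bnd (fun x => Eop t phi x - (\int[mu]_y phi y) * gauss t x)
    (pn (t / 2) * (2 * (1 + @cdg R n) * w (t / 2) * M1)).
Proof.
move=> t0 pA pM; have t20 : 0 < t / 2 by rewrite divr_gt0.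
have gA := @gauss_L1 R n _ t20.
have h := E_L1bnd t20 (heat_mass_L1 t20 pA pM).
rewrite (E_B t20 (E_L1 t20 pA) (L1leZ _ gA)) (EE t20 t20 pA) (E_Z _ t20 gA) in h.
rewrite /Eop (convol_gauss t20 t20) -splitr in h.
exact: h.
Qed.

End heat_mass.


(** * Joint estimates in L^1 and weighted L^oo *)

Section mixed_duhamel.
Context {R : realType} {n : nat} (a : 'rV[R]_n).
Local Notation w t := (powR t (- 2^-1)).
Local Notation pn t := (powR t (- (n%:R / 2))).
Implicit Types (F G : R -> 'rV[R]_n -> R) (b : R -> R) (s t : R).

(** A single function b controls the L^1 norm and, up to the weight s^(-n/2), the sup norm; [Lq_le]
    interpolates bounds of this form. *)
Definition mixed F t0 t1 b :=
  forall s, t0 < s < t1 -> L1le (F s) (b s) /\ bnd (F s) (pn s * b s).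

Lemma duh_mixed0 F t0 t1 t b Bt : jmeas F -> 0 <= t0 -> t1 <= t -> mixed F t0 t1 b ->
  tbound t0 t1 (fun s => w (t - s) * b s) Bt ->
  L1le (duh a F t0 t1 t) (cD a * Bt) /\ bnd (duh a F t0 t1 t) (cD a * pn (t / 2) * Bt).
Proof.
move=> jF h0 h1 m tb; split; first by apply: (duh_L1 a jF h1 _ tb) => s /m[].
have := duh_mixed a (c := 0) jF h0 h1 _ _ tb; rewrite subr0; apply=> s /m[] //.
by rewrite subr0.
Qed.

Lemma duh_pointwise F t0 t1 t b x : 0 <= t0 -> t1 <= t -> mixed F t0 t1 b ->
  forall s, t0 < s < t1 -> `|Dop a (t - s) (F s) x| <= cD a * pn (t / 2) * (w (t - s) * b s).
Proof.
move=> h0 h1 m s st; have [mL mB] := m s st.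
have cst : 0 < s < t by case/andP: st => s0 s1; rewrite (le_lt_trans h0 s0) (lt_le_trans s1 h1).
by have := D_mixed a cst mL; rewrite !subr0; apply.
Qed.

Lemma duhB F G t0 t1 t b b' Bt Bt' : jmeas F -> jmeas G -> 0 <= t0 -> t1 <= t ->
  mixed F t0 t1 b -> tbound t0 t1 (fun s => w (t - s) * b s) Bt ->
  mixed G t0 t1 b' -> tbound t0 t1 (fun s => w (t - s) * b' s) Bt' ->
  duh a (fun s x => F s x - G s x) t0 t1 t = fun x => duh a F t0 t1 t x - duh a G t0 t1 t x.
Proof.
move=> jF jG h0 h1 mF tF mG tG; apply/funext => x.
have c0 : 0 <= cD a * pn (t / 2) by apply: mulr_ge0; [exact: cD_ge0|exact: powR_ge0].
rewrite /duh -(tintB (jmeas_D a t jF) (jmeas_D a t jG) (tboundZ c0 tF) (tboundZ c0 tG)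
  (duh_pointwise x h0 h1 mF) (duh_pointwise x h0 h1 mG)).
apply: eq_tint => s st; have /andP[_ s1] := st.
have ts : 0 < t - s by rewrite subr_gt0 (lt_le_trans s1).
by rewrite (D_B a ts (mF s st).1 (mG s st).1).
Qed.

Lemma duh_split F t0 t1 t2 t b Bt : jmeas F -> 0 <= t0 -> t0 <= t1 -> t1 <= t2 -> t2 <= t ->
  mixed F t0 t2 b -> tbound t0 t2 (fun s => w (t - s) * b s) Bt ->
  duh a F t0 t2 t = fun x => duh a F t0 t1 t x + duh a F t1 t2 t x.
Proof.
move=> jF h0 h01 h12 h2 mF tF; apply/funext => x.
have c0 : 0 <= cD a * pn (t / 2) by apply: mulr_ge0; [exact: cD_ge0|exact: powR_ge0].
exact: (tint_split (jmeas_D a t jF) h01 h12 (tboundZ c0 tF) (duh_pointwise x h0 h2 mF)).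
Qed.

End mixed_duhamel.

(** * Comparison of the solution with the profiles *)

Section asymptotics.
Context {R : realType} {n : nat} (a : 'rV[R]_n) (f : R -> R) (C p M M0 M1 c1 : R)
  (u0 : 'rV[R]_n -> R) (W : R -> 'rV[R]_n -> R).
Context (mf : measurable_fun [set: R] f) (f0 : f 0 = 0) (C0 : 0 <= C) (p1 : 1 < p) (c10 : 0 <= c1)
  (flip : forall xi eta, `|f xi - f eta| <=
      C * (powR `|xi| (p - 1) + powR `|eta| (p - 1)) * `|xi - eta|)
  (sig0 : 0 < sigma_exp n p) (sig1 : sigma_exp n p < 2^-1)
  (u0A : L1le u0 M0) (u0M : L1le (fun y => l1n y * u0 y) M1)
  (jW : jmeas W) (WM : forall t, 0 < t -> L1le (W t) M)
  (Wc : forall t, 0 < t -> bnd (W t) (c1 * powR t (- (n%:R / 2))))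
  (Wduh : forall t, 0 < t -> W t = fun x => Eop t u0 x + duh a (flux f W) 0 t t x).
Local Notation mu := (leb R n).
Local Notation w t := (powR t (- 2^-1)).
Local Notation pn t := (powR t (- (n%:R / 2))).
Local Notation sig := (sigma_exp n p).
Local Notation al := (2^-1 + sigma_exp n p).
Implicit Types (s t ga c : R) (A B v : R -> 'rV[R]_n -> R).

Let al01 : 0 <= al < 1.
Proof. by apply/andP; split; move: sig0 sig1; lra. Qed.
Let nh : 0 <= n%:R / 2 :> R.
Proof. by rewrite divr_ge0. Qed.
Let pn0 t : 0 <= pn t.
Proof. exact: powR_ge0. Qed.
Let M_ge0 : 0 <= M := L1le_ge0 (WM ltr01).

Definition lip_coef c : R := C * (2 * powR c (p - 1)).

Lemma lip_coef_ge0 c : 0 <= lip_coef c.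
Proof. by apply: mulr_ge0 => //; apply: mulr_ge0 => //; exact: powR_ge0. Qed.

(** As n (p - 1) / 2 = 1/2 + sigma, the decay s^(-n/2) raised to the power p - 1 is s^(-al). *)
Lemma f_diff c s xi eta : 0 <= c -> 0 < s -> `|xi| <= c * pn s -> `|eta| <= c * pn s ->
  `|f xi - f eta| <= lip_coef c * powR s (- al) * `|xi - eta|.
Proof.
move=> c0 s0 hx he; apply: le_trans (flip xi eta) _; apply: ler_wpM2r => //.
rewrite /lip_coef -mulrA; apply: ler_wpM2l => //.
have P (z : R) : `|z| <= c * pn s -> powR `|z| (p - 1) <= powR c (p - 1) * powR s (- al).
  have -> : powR s (- al) = powR (pn s) (p - 1).
    by rewrite -powRrM /sigma_exp; congr (powR _ _); field.
  move=> hz; rewrite -powRM//; apply: ge0_ler_powR; rewrite ?nnegrE//.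
    by move: p1; lra.
  by apply: mulr_ge0.
have := lerD (P xi hx) (P eta he); lra.
Qed.

Lemma flux_mixed v v' t0 t1 c g : jmeas v -> jmeas v' -> 0 <= c -> 0 <= t0 ->
  (forall s, t0 < s < t1 -> bnd (v s) (c * pn s)) ->
  (forall s, t0 < s < t1 -> bnd (v' s) (c * pn s)) ->
  mixed (fun s x => v s x - v' s x) t0 t1 g ->
  mixed (fun s x => flux f v s x - flux f v' s x) t0 t1
    (fun s => lip_coef c * (powR s (- al) * g s)).
Proof.
move=> jv jv' c0 h0 hv hv' m s st; have [mL mB] := m s st.
have s0 : 0 < s by case/andP: st => /(le_lt_trans h0).
have k0 : 0 <= lip_coef c * powR s (- al) by rewrite mulr_ge0 ?powR_ge0 ?lip_coef_ge0.
have D x : `|flux f v s x - flux f v' s x| <= lip_coef c * powR s (- al) * `|v s x - v' s x|.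
  by apply: f_diff => //; [exact: hv|exact: hv'].
split.
  rewrite mulrA; apply: (L1le_dom _ D k0 mL); apply: measurable_funB.
    exact: (measurableT_comp mf (jmeas_at s jv)).
  exact: (measurableT_comp mf (jmeas_at s jv')).
move=> x; apply: le_trans (D x) _; rewrite [leRHS](_ : _ = lip_coef c * powR s (- al) * (pn s *
  g s)); last by ring.
 apply: ler_wpM2l => //.
Qed.

Lemma flux_mixed0 v t0 t1 c : jmeas v -> 0 <= c -> 0 <= t0 ->
  mixed v t0 t1 (fun=> c) ->
  mixed (flux f v) t0 t1 (fun s => lip_coef c * (powR s (- al) * c)).
Proof.
move=> jv c0 h0 m.
pose z : R -> 'rV[R]_n -> R := fun _ _ => 0.
have z0 s : bnd (z s) (c * pn s) by move=> x; rewrite normr0 mulr_ge0.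
have jz : jmeas z by exact: measurable_cst.
have := @flux_mixed v z t0 t1 c (fun=> c) jv jz c0 h0 _ (fun s _ => z0 s).
have -> : (fun s x => flux f v s x - flux f z s x) = flux f v.
  by apply/funext => s; apply/funext => x; rewrite /flux/= f0 subr0.
apply; first by move=> s /m[_]; rewrite mulrC.
have -> : (fun s x => v s x - z s x) = v by apply/funext => s; apply/funext => x; rewrite subr0.
exact: m.
Qed.

Definition close A (g : R -> R) := exists2 c, 0 <= c & forall t, 1 <= t ->
  L1le (fun x => W t x - A t x) (c * g t) /\ bnd (fun x => W t x - A t x) (pn t * (c * g t)).

Lemma jmeas_A0 : jmeas (A0 u0).
Proof.
apply: measurable_funM => //.
exact: measurable_gauss_jt.
Qed.

Let m0 : R := `|mass u0|.
Let m00 : 0 <= m0 := normr_ge0 _.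

Lemma mixed_A0 t0 t1 : 0 <= t0 -> mixed (A0 u0) t0 t1 (fun=> m0).
Proof.
move=> h0 s /andP[s0 _]; have sp : 0 < s by exact: le_lt_trans s0.
split; first by have := L1leZ (mass u0) (gauss_L1 sp); rewrite mulr1.
move=> x; rewrite normrM mulrC; apply: ler_wpM2r => //; exact: gauss_le.
Qed.

Let cc : R := c1 + M + m0.
Let cc0 : 0 <= cc.
Proof. by rewrite !addr_ge0. Qed.

Lemma mixed_W t0 t1 : 0 <= t0 -> mixed W t0 t1 (fun=> cc).
Proof.
move=> h0 s /andP[s0 _]; have sp : 0 < s by exact: le_lt_trans s0.
split; first by apply: L1le_trans (WM sp); rewrite /cc addrAC lerDr addr_ge0.
move=> x; apply: le_trans (Wc sp x) _; rewrite mulrC; apply: ler_wpM2l => //.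
by rewrite /cc -addrA lerDl addr_ge0.
Qed.

Lemma mixed_A0' t0 t1 : 0 <= t0 -> mixed (A0 u0) t0 t1 (fun=> cc).
Proof.
move=> h0 s st; have [h1 h2] := mixed_A0 h0 st.
have mc : m0 <= cc by rewrite /cc lerDr addr_ge0.
split; first exact: L1le_trans h1.
by move=> x; apply: le_trans (h2 x) _; apply: ler_wpM2l.
Qed.

Lemma massE : mass u0 = \int[mu]_y u0 y.
Proof. by congr fine; apply: (iintE (f := fun y : Rn R n => (u0 y)%:E));
  exact: L1le_integrable u0A. Qed.

Lemma heat_close : exists2 c, 0 <= c & forall t, 1 <= t ->
  L1le (fun x => Eop t u0 x - A0 u0 t x) (c * w t) /\
  bnd (fun x => Eop t u0 x - A0 u0 t x) (pn t * (c * w t)).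
Proof.
have M10 := L1le_ge0 u0M; have g0 := @cdg_ge0 R n.
pose k := 2 * (1 + @cdg R n) * M1.
have k0 : 0 <= k by apply: mulr_ge0 => //; apply: mulr_ge0 => //; apply: addr_ge0.
have p20 (r : R) : 0 <= r -> 1 <= powR 2 r by move=> r0; rewrite -[leLHS](powRr0 2) ler_powR//;
  lra.
pose c := powR 2 (n%:R / 2) * powR 2 2^-1 * k.
exists c => [|t t1]; first by apply: mulr_ge0 => //; apply: mulr_ge0; exact: powR_ge0.
have t0 : 0 < t by lra.
rewrite /A0 massE; split.
  apply: L1le_trans (heat_mass_L1 t0 u0A u0M).
  rewrite [leLHS](_ : _ = k * w t); last by rewrite /k; ring.
  apply: ler_wpM2r; first exact: powR_ge0.
  rewrite /c ler_peMl// -[leLHS]mulr1; apply: ler_pM => //; exact: p20.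
move=> x; apply: le_trans (heat_mass_bnd t0 u0A u0M x) _.
rewrite !(powR_half _ (ltW t0)) le_eqVlt; apply/orP; left; apply/eqP.
by rewrite /c /k; ring.
Qed.

Lemma tbound_pow t0 t1 t k g Bt : 0 <= k ->
  tbound t0 t1 (fun s => w (t - s) * (powR s (- al) * g s)) Bt ->
  tbound t0 t1 (fun s => w (t - s) * (k * (powR s (- al) * g s))) (k * Bt).
Proof.
move=> k0 h; have := tboundZ k0 h.
by rewrite (_ : (fun s => k * _) = fun s => w (t - s) * (k * (powR s (- al) * g s)))//;
  apply/funext => s; rewrite mulrCA.
Qed.

Let tb_cst t0 t1 t k c I : 0 <= k -> 0 <= c ->
  tbound t0 t1 (fun s => w (t - s) * powR s (- al)) I ->
  tbound t0 t1 (fun s => w (t - s) * (k * (powR s (- al) * c))) (k * (c * I)).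
Proof.
move=> k0 c0 h; apply: (@tbound_pow _ _ _ _ (fun=> c)) => //.
have := tboundZ c0 h.
rewrite (_ : (fun s => c * _) = fun s => w (t - s) * (powR s (- al) * c))//.
by apply/funext => s; ring.
Qed.

Let full_bound t : 0 < t ->
  tbound 0 t (fun s => w (t - s) * powR s (- al)) (cbeta al * powR t (- sig)).
Proof.
move=> t0; have := tbound_beta t0 al01.
rewrite subr0 (_ : 2^-1 - al = - sig); last by ring.
by under eq_fun do rewrite subr0.
Qed.

Let flux_cc v t0 t1 : jmeas v -> 0 <= t0 -> mixed v t0 t1 (fun=> cc) ->
  mixed (flux f v) t0 t1 (fun s => lip_coef cc * (powR s (- al) * cc)).
Proof. by move=> jv h0 m; exact: flux_mixed0. Qed.

Let j_flux v : jmeas v -> jmeas (flux f v).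
Proof. by move=> jv; exact: jmeas_comp mf jv. Qed.

Let cb0 : 0 <= cbeta al.
Proof.
rewrite /cbeta; apply: addr_ge0; last by rewrite mulr_ge0// powR_ge0.
by apply: divr_ge0; [exact: powR_ge0|move/andP: al01; lra].
Qed.

Let pn_half t g : 0 < t -> cD a * pn (t / 2) * g = pn t * (powR 2 (n%:R / 2) * cD a * g).
Proof. by move=> t0; rewrite (powR_half _ (ltW t0)); ring. Qed.

Let p2 : 1 <= powR 2 (n%:R / 2) :> R.
Proof. by rewrite -[leLHS](powRr0 2) ler_powR//; lra. Qed.

(** The factor 2^(n/2) stems from t / 2 in the sup bound; it is kept in the L^1 bound too, so that
    both share one constant. *)
Lemma duh_close v t0 t1 t b Bt : jmeas v -> 0 <= t0 -> t1 <= t -> 0 < t -> 0 <= Bt ->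
  mixed v t0 t1 b -> tbound t0 t1 (fun s => w (t - s) * b s) Bt ->
  L1le (duh a v t0 t1 t) (powR 2 (n%:R / 2) * cD a * Bt) /\
  bnd (duh a v t0 t1 t) (pn t * (powR 2 (n%:R / 2) * cD a * Bt)).
Proof.
move=> jv h0 h1 t_gt0 B0 m tb; have [hL hB] := duh_mixed0 a jv h0 h1 m tb.
split; last by move=> x; have := hB x; rewrite (pn_half _ t_gt0).
apply: L1le_trans hL; rewrite -mulrA ler_peMl// mulr_ge0//; exact: cD_ge0.
Qed.

(** The whole Duhamel integral counts as error and determines the rate; the error t^(-1/2) of the
    heat part is smaller since sigma < 1/2. *)
Lemma close_base : close (A0 u0) (fun t => powR t (- sig)).
Proof.
have [c c0 hc] := heat_close.
pose k := powR 2 (n%:R / 2) * cD a * (lip_coef cc * (cc * cbeta al)).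
have k0 : 0 <= k.
  have := lip_coef_ge0 cc; have := cD_ge0 a => q1 q2.
  by apply: mulr_ge0; [apply: mulr_ge0 => //; exact: powR_ge0|apply: mulr_ge0 => //;
    apply: mulr_ge0].
exists (c + k) => [|t t1]; first exact: addr_ge0.
have t0 : 0 < t by lra.
have [h1 h2] := hc t t1.
have tb := tb_cst (lip_coef_ge0 cc) cc0 (full_bound t0).
have B0 : 0 <= lip_coef cc * (cc * (cbeta al * powR t (- sig))).
  apply: mulr_ge0; first exact: lip_coef_ge0.
  by apply: mulr_ge0 => //; apply: mulr_ge0 => //; exact: powR_ge0.
have [d1 d2] := duh_close (j_flux jW) (lexx 0) (lexx t) t0 B0
  (flux_cc jW (lexx 0) (mixed_W (t1 := t) (lexx 0))) tb.
have wt : w t <= powR t (- sig) by rewrite ler_powR//; move: sig1; lra.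
have E : c * w t + powR 2 (n%:R / 2) * cD a * (lip_coef cc * (cc * (cbeta al * powR t (- sig))))
    <= (c + k) * powR t (- sig).
  rewrite [leRHS]mulrDl; apply: lerD; first exact: ler_wpM2l.
  by rewrite /k le_eqVlt; apply/orP; left; apply/eqP; ring.
have -> : (fun x => W t x - A0 u0 t x) =
    fun x => (Eop t u0 x - A0 u0 t x) + duh a (flux f W) 0 t t x.
  by apply/funext => x; rewrite (Wduh t0) addrAC.
split; first exact: L1le_trans E (L1leD h1 d1).
move=> x; apply: le_trans (ler_normD _ _) _; apply: le_trans (lerD (h2 x) (d2 x)) _.
by rewrite -mulrDr; exact: ler_wpM2l.
Qed.

(* [A0k] with the Duhamel integrals in the form [duh]; the two agree for t >= 1. *)
Fixpoint profile (j : nat) : R -> 'rV[R]_n -> R :=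
  match j with
  | 0 => A0 u0
  | j'.+1 => fun t x => A0 u0 t x + duh a (flux f (A0 u0)) 0 1 t x
               + duh a (flux f (profile j')) 1 t t x
  end.

Lemma jmeas_profile j : jmeas (profile j).
Proof.
elim: j => [|j IH]; first exact: jmeas_A0.
apply: jmeasD; last by apply: (@jmeas_duh _ _ _ _ (fun=> 1) id) => //; exact: j_flux.
by apply: jmeasD; [exact: jmeas_A0|apply: (@jmeas_duh _ _ _ _ (fun=> 0) (fun=> 1)) => //;
  exact: j_flux jmeas_A0].
Qed.

Lemma close_step j ga : 0 < ga -> close (profile j) (fun t => powR t (- ga)) ->
  close (profile j.+1) (rate (ga + sig)).
Proof.
move=> ga0 [c c0 hc].
have [ch ch0 hh] := heat_close.
have gs0 : 0 < ga + sig by rewrite addr_gt0.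
have [cl cl0 hl] := late_bound gs0.
have [cr cr0 hr] := @rate_half R (ga + sig).
have jP := jmeas_profile j.
(* A common bound for the solution and the profile after time 1, since s^(-ga) <= 1 there. *)
pose c' := cc + c; have c'0 : 0 <= c' by rewrite addr_ge0.
have le_c' : cc <= c' by rewrite lerDl.
have mWP t : mixed (fun s x => W s x - profile j s x) 1 t (fun s => c * powR s (- ga)).
  by move=> s /andP[/ltW s1 _]; exact: hc.
have mW' t : mixed W 1 t (fun=> c').
  move=> s st; have [h1 h2] := mixed_W (t0 := 1) ler01 st.
  by split; [exact: L1le_trans h1|move=> x; apply: le_trans (h2 x) _; exact: ler_wpM2l].
have mP t : mixed (profile j) 1 t (fun=> c').
  move=> s st; have [h1 h2] := mixed_W (t0 := 1) ler01 st; have [h3 h4] := mWP t s st.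
  have s1 : 1 < s by case/andP: st.
  have gle : c * powR s (- ga) <= c.
    rewrite ler_piMr//; have := powRN_anti (ltW ga0) ltr01 (ltW s1); by rewrite powR1.
  have -> : profile j s = fun x => W s x - (W s x - profile j s x).
    by apply/funext => x; rewrite subKr.
  split; first by apply: L1le_trans (L1leB h1 h3); rewrite lerD2l.
  move=> x; apply: le_trans (ler_normB _ _) _; apply: le_trans (lerD (h2 x) (h4 x)) _.
  by rewrite -mulrDr; apply: ler_wpM2l => //; rewrite lerD2l.
pose p2c := powR 2 (n%:R / 2) * cD a; pose kk := lip_coef cc; pose k' := lip_coef c'.
have p2c0 : 0 <= p2c by rewrite mulr_ge0 ?powR_ge0 ?cD_ge0.
have kk0 : 0 <= kk by exact: lip_coef_ge0.
have k'0 : 0 <= k' by exact: lip_coef_ge0.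
pose e := p2c * (kk * (cc * cbeta al)).
have e0 : 0 <= e by apply: mulr_ge0 => //; apply: mulr_ge0 => //; apply: mulr_ge0.
pose l := p2c * (k' * (c * cl)).
have l0 : 0 <= l by apply: mulr_ge0 => //; apply: mulr_ge0 => //; apply: mulr_ge0.
exists ((ch + e + e) * cr + l) => [|t t1].
  by apply: addr_ge0 => //; apply: mulr_ge0 => //; apply: addr_ge0 => //; apply: addr_ge0.
have t0 : 0 < t by lra.
have r0 := rate_ge0 (ga + sig) t1.
have wt0 : 0 <= w t by exact: powR_ge0.
have [h1 h2] := hh t t1.
have tbe := tb_cst kk0 cc0 (early_bound t1 al01).
have Be : 0 <= kk * (cc * (w t * cbeta al)).
  by apply: mulr_ge0 => //; apply: mulr_ge0 => //; apply: mulr_ge0.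
have [d1 d2] := duh_close (j_flux jW) (lexx 0) t1 t0 Be
  (flux_cc jW (lexx 0) (mixed_W (t1 := 1) (lexx 0))) tbe.
have [d3 d4] := duh_close (j_flux jmeas_A0) (lexx 0) t1 t0 Be
  (flux_cc jmeas_A0 (lexx 0) (mixed_A0' (t1 := 1) (lexx 0))) tbe.
(* The [eq_ind] terms only commute a product: [mixed] has the weight in front of the constant,
   [flux_mixed] behind it. *)
have mD := flux_mixed jW jP c'0 ler01 (fun s st x => le_trans ((mW' t s st).2 x)
  (eq_ind _ (fun z => is_true (z <= c' * pn s)) (lexx _) _ (mulrC _ _)))
  (fun s st x => le_trans ((mP t s st).2 x)
  (eq_ind _ (fun z => is_true (z <= c' * pn s)) (lexx _) _ (mulrC _ _))) (mWP t).
have tbl : tbound 1 t (fun s => w (t - s) * (k' * (powR s (- al) * (c * powR s (- ga)))))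
    (k' * (c * (cl * rate (ga + sig) t))).
  have := tboundZ k'0 (tboundZ c0 (hl t t1)); apply: tbound_dom.
    apply: measurable_funM; first exact: measurable_powRBl.
    have mp (r : R) : measurable_fun [set: measurableTypeR R] (fun s => powR s r).
      by have := @measurable_powRB R 0 r; under eq_fun do rewrite subr0.
    by apply: measurable_funM => //; apply: measurable_funM => //; apply: measurable_funM.
  move=> s /andP[s1 s2]; have s0 : 0 < s by lra.
  rewrite -(@powR_DE _ s (- al) (- ga) (- (2^-1 + (ga + sig))))//; last by ring.
  apply/andP; split; last by rewrite le_eqVlt; apply/orP; left; apply/eqP; ring.
  by do ![apply: mulr_ge0 => //; rewrite ?powR_ge0//].
have Bl : 0 <= k' * (c * (cl * rate (ga + sig) t)).
  by apply: mulr_ge0 => //; apply: mulr_ge0 => //; apply: mulr_ge0.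
have jD := jmeasB (j_flux jW) (j_flux jP).
have [d5 d6] := duh_close jD ler01 (lexx t) t0 Bl mD tbl.
have E : ch * w t + p2c * (kk * (cc * (w t * cbeta al))) + p2c * (kk * (cc * (w t * cbeta al))) +
    p2c * (k' * (c * (cl * rate (ga + sig) t))) <= ((ch + e + e) * cr + l) * rate (ga + sig) t.
  rewrite [leLHS](_ : _ = (ch + e + e) * w t + l * rate (ga + sig) t); last by rewrite /e /l;
    ring.
  rewrite [leRHS]mulrDl lerD2r -mulrA; apply: ler_wpM2l; first by rewrite !addr_ge0.
  exact: hr.
have tbf : tbound 1 t (fun s => w (t - s) * (lip_coef c' * (powR s (- al) * c')))
    (lip_coef c' * (c' * (cbeta al * powR t (- sig)))).
  by exact: tb_cst k'0 c'0 (tbound_sub ler01 (lexx t) (full_bound t0)).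
have DB := duhB a (j_flux jW) (j_flux jP) ler01 (lexx t)
  (flux_mixed0 jW c'0 ler01 (mW' t)) tbf (flux_mixed0 jP c'0 ler01 (mP t)) tbf.
have DS := duh_split a (j_flux jW) (lexx 0) ler01 t1 (lexx t)
  (flux_cc jW (lexx 0) (mixed_W (t1 := t) (lexx 0))) (tb_cst kk0 cc0 (full_bound t0)).
have -> : (fun x => W t x - profile j.+1 t x) = fun x =>
   ((Eop t u0 x - A0 u0 t x) + duh a (flux f W) 0 1 t x - duh a (flux f (A0 u0)) 0 1 t x) +
   duh a (fun s x => flux f W s x - flux f (profile j) s x) 1 t t x.
  apply/funext => x; rewrite (Wduh t0) DB DS /=.
  have aux (u v1 v2 A b d : R) : u + (v1 + v2) - (A + b + d) = u - A + v1 - b + (v2 - d) by ring.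
  exact: aux.
split; first exact: L1le_trans E (L1leD (L1leB (L1leD h1 d1) d3) d5).
move=> x; apply: le_trans (ler_normD _ _) _.
apply: le_trans (lerD (ler_normB _ _) (lexx _)) _.
apply: le_trans (lerD (lerD (ler_normD _ _) (lexx _)) (lexx _)) _.
apply: le_trans (lerD (lerD (lerD (h2 x) (d2 x)) (d4 x)) (d6 x)) _.
by rewrite -!mulrDr; exact: ler_wpM2l.
Qed.

Lemma profile_close j : j.+1%:R * sig < 2^-1 ->
  close (profile j) (fun t => powR t (- (j.+1%:R * sig))).
Proof.
elim: j => [|j IH] h; first by rewrite mul1r; exact: close_base.
have e : j.+2%:R * sig = j.+1%:R * sig + sig by rewrite -[j.+2%:R]natr1 mulrDl mul1r.
have g0 : 0 < j.+1%:R * sig by rewrite mulr_gt0.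
have h' : j.+1%:R * sig < 2^-1 by move: h; rewrite e; move: sig0; lra.
have := close_step g0 (IH h'); rewrite -e.
have -> // : rate (j.+2%:R * sig) = fun t => powR t (- (j.+2%:R * sig)).
by apply/funext => t; rewrite /rate h.
Qed.

(** Since k sigma < 1/2, all rates before the last step are pure powers and can be fed into
    [close_step]; only the last one can reach or pass 1/2. *)
Lemma profile_rate k : (0 < k)%N -> k%:R * sig < 2^-1 ->
  close (profile k) (rate (k.+1%:R * sig)).
Proof.
case: k => // k _ h.
have e : k.+2%:R * sig = k.+1%:R * sig + sig by rewrite -[k.+2%:R]natr1 mulrDl mul1r.
have g0 : 0 < k.+1%:R * sig by rewrite mulr_gt0.
by rewrite e; exact: close_step g0 (profile_close h).
Qed.

Lemma mixed_profile j : j.+1%:R * sig < 2^-1 -> exists2 c, 0 <= c & forall t,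
  mixed (profile j) 1 t (fun=> c).
Proof.
move=> h; have [c c0 hc] := profile_close h; exists (cc + c) => [|t s st]; first exact: addr_ge0.
have g0 : 0 <= j.+1%:R * sig by rewrite mulr_ge0// ltW.
have [h1 h2] := mixed_W (t0 := 1) ler01 st.
have s1 : 1 < s by case/andP: st.
have [h3 h4] := hc s (ltW s1).
have gle : c * powR s (- (j.+1%:R * sig)) <= c.
  by rewrite ler_piMr//; have := powRN_anti g0 ltr01 (ltW s1); rewrite powR1.
have -> : profile j s = fun x => W s x - (W s x - profile j s x).
  by apply/funext => x; rewrite subKr.
split; first by apply: L1le_trans (L1leB h1 h3); rewrite lerD2l.
move=> x; apply: le_trans (ler_normB _ _) _; apply: le_trans (lerD (h2 x) (h4 x)) _.
by rewrite -mulrDr; apply: ler_wpM2l => //; rewrite lerD2l.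
Qed.

(** Rewriting the derivative of [heat] as [Dop] requires the flux of the previous profile to be
    integrable at each s > 1; the bounds of [mixed_profile] supply this, and they rest on the
    condition on k sigma. *)
Lemma A0kE k t : k%:R * sig < 2^-1 -> 1 <= t -> A0k a f u0 k t = profile k t.
Proof.
elim: k t => // k IH t h t1; apply/funext => x /=.
have mD F s0 s1 : jmeas F -> measurable_fun [set: measurableTypeR R]
    (fun s => win s0 s1 s (Dop a (t - s) (F s) x)).
  by move=> jF; exact: (jmeas_pt x (jmeas_win s0 s1 (jmeas_D a t jF))).
congr (_ + _ + _).
  apply: (duhamelE (F := flux f (A0 u0))); last exact: mD (j_flux jmeas_A0).
  move=> s /andP[s0 s1]; apply: derive_heat; first by rewrite subr_gt0; lra.
  have s01 : 0 < s < 1 by rewrite s0.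
  exact: (flux_mixed0 jmeas_A0 cc0 (lexx 0) (mixed_A0' (t1 := 1) (lexx 0)) s01).1.
apply: (duhamelE (F := flux f (profile k))); last exact: mD (j_flux (jmeas_profile k)).
have h' : k%:R * sig < 2^-1.
  by move: h; rewrite -natr1 mulrDl mul1r; move: sig0; lra.
have [c c0 hc] := mixed_profile h.
move=> s st; have /andP[s1 st1] := st.
rewrite (IH s h' (ltW s1)); apply: derive_heat; first by rewrite subr_gt0.
exact: (flux_mixed0 (jmeas_profile k) c0 ler01 (hc t) st).1.
Qed.

End asymptotics.


(** * Interpolation between L^1 and L^oo *)

Section lq_interpolation.
Context {R : realType} {n : nat}.
Local Notation mu := (leb R n).
Implicit Types (g h : 'rV[R]_n -> R) (A P r : R).

Lemma esssup_le g h B : measurable_fun [set: Rn R n] g -> {ae mu, forall x, g x = h x} ->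
  bnd h B -> (Lq_norm +oo%E g <= B%:E)%E.
Proof.
move=> mg [N [mN N0 sN]] hB; apply: ereal_inf_lbound; split.
  by rewrite lee_fin; exact: le_trans (hB 0).
have mA : measurable ([set x : Rn R n | (B%:E < `|g x|%:E)%E]).
  have mE : measurable_fun [set: Rn R n] (fun x => `|g x|%:E).
    by apply/measurable_EFinP; exact: measurableT_comp.
  have := emeasurable_fun_o_infty measurableT mE B%:E.
  by rewrite setTI.
rewrite lmeasE//; apply: (subset_measure0 mA mN _ N0) => x /= gB; apply: sN => /= e.
by move: gB; rewrite e lte_fin ltNge hB.
Qed.

(** Integrate |g|^r <= (P A)^(r-1) |g|. Writing the sup bound as P A, with P to be t^(-n/2), brings
    out the factor P^(1-1/r) that the weight in the theorem cancels. *)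
Lemma lq_interpolation g h A P r : 1 <= r -> 0 < A -> 0 < P ->
  measurable_fun [set: Rn R n] g -> {ae mu, forall x, g x = h x} ->
  L1le h A -> bnd h (P * A) ->
  (Lq_norm r%:E g <= (powR P (1 - r^-1) * A)%:E)%E.
Proof.
move=> r1 A0 P0 mg gh hA hB; have r0 : 0 < r by lra.
have PA0 : 0 < P * A by rewrite mulr_gt0.
have mp : measurable_fun [set: Rn R n] (fun x => powR `|g x| r).
  apply: (@measurableT_comp _ _ _ _ _ _ (@powR R ^~ r)); first exact: measurable_powR.
  exact: measurableT_comp.
have gA := L1le_ae mg (ae_sym gh) hA.
pose k := powR (P * A) (r - 1); have k0 : 0 <= k by exact: powR_ge0.
have I1 : (\int[mu]_x (powR `|g x| r)%:E <= (k * A)%:E)%E.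
  apply: (@le_trans _ _ (\int[mu]_x (k%:E * `|g x|%:E))%E); last first.
    rewrite ge0_integralZl//; last by apply/measurable_EFinP; exact: measurableT_comp.
    by rewrite [X in (_ <= X)%E]EFinM lee_wpmul2l//; exact: gA.2.
  apply: ae_ge0_le_integral => //.
  - exact/measurable_EFinP.
  - by move=> x _; rewrite mule_ge0.
  - by apply: emeasurable_funM => //; apply/measurable_EFinP; exact: measurableT_comp.
  - have [N [mN N0 sN]] := gh; exists N; split=> // x /= H; apply: sN => /= e; apply: H => _.
    rewrite -EFinM lee_fin e.
    rewrite -[X in powR _ X](subrK 1) powRD; last first.
      by rewrite subrK gt_eqF.
    rewrite powRr1//; apply: ler_wpM2r => //; apply: ge0_ler_powR; rewrite ?nnegrE//.
      by lra.
    exact: ltW.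
rewrite /Lq_norm (ge0_iintE (f := fun x : Rn R n => (powR `|g x| r)%:E)).
- have I0 : (0 <= \int[mu]_x (powR `|g x| r)%:E)%E.
    by apply: integral_ge0 => x _; rewrite lee_fin powR_ge0.
  move: I0 I1; case: (\int[mu]_x _)%E => [v| |]//; rewrite !lee_fin => v0 vk.
  have -> : powR P (1 - r^-1) * A = powR (k * A) r^-1.
    rewrite /k powRM ?powR_ge0 ?(ltW A0)// -powRrM powRM ?(ltW P0) ?(ltW A0)//.
    rewrite (_ : (r - 1) * r^-1 = 1 - r^-1); last by field; rewrite gt_eqF.
    rewrite -mulrA (@powR_DE _ A (1 - r^-1) r^-1 1)//; last by ring.
    by rewrite powRr1// ltW.
  by apply: ge0_ler_powR; rewrite ?nnegrE ?invr_ge0 ?(ltW r0)// mulr_ge0// ltW.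
- exact/measurable_EFinP.
- by move=> x; rewrite lee_fin powR_ge0.
Qed.

Lemma Lq_le g h A P q : (1 <= q)%E -> 0 < A -> 0 < P ->
  measurable_fun [set: Rn R n] g -> {ae mu, forall x, g x = h x} ->
  L1le h A -> bnd h (P * A) ->
  (Lq_norm q g <= (powR P (1 - inv_exp q) * A)%:E)%E.
Proof.
case: q => [r| |]// q1 A0 P0 mg gh hA hB; first by rewrite lee_fin in q1;
  exact: lq_interpolation gh hA hB.
by rewrite subr0 powRr1 ?(ltW P0)//; exact: esssup_le gh hB.
Qed.

End lq_interpolation.

Theorem theorem2p1 (R : realType) (n : nat) (a : 'rV[R]_n) (p : R)
  (f : R -> R) (k : nat) (u0 : 'rV[R]_n -> R) (u : R -> 'rV[R]_n -> R) :
  (1 <= n)%N -> a != 0 ->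
  (* f in C^1(R), f not identically 0, f(0) = 0, local Lipschitz bound *)
  (forall x, derivable f x 1) -> continuous (derive1 f) ->
  (exists x, f x != 0) -> f 0 = 0 ->
  (exists C : R, forall xi eta, `|f xi - f eta| <=
      C * (powR `|xi| (p - 1) + powR `|eta| (p - 1)) * `|xi - eta|) ->
  (0 < k)%N ->
  1 + n%:R^-1 < p -> p < 1 + (k.+1)%:R / (k%:R * n%:R) ->
  in_L11 u0 -> in_Lq +oo%E u0 ->
  global_solution a f u0 u ->
  forall q : \bar R, (1 <= q)%E ->
  exists2 C : R, 0 < C &
    forall t : R, 2 ^+ k < t ->
      ((powR t (n%:R / 2 * (1 - inv_exp q)))%:E
         * Lq_norm q ((u t \- A0k a f u0 k t)%R)
       <= (if (k.+1)%:R * sigma_exp n p < 2^-1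
           then C * powR t (- ((k.+1)%:R * sigma_exp n p))
           else if (k.+1)%:R * sigma_exp n p == 2^-1
           then C * powR t (- 2^-1) * ln (2 + t)
           else C * powR t (- 2^-1))%:E)%E.
Proof.
move=> n0 _ df _ _ f0 [C' flip'] k0 p1 p2 u011 _ sol q q1.
have np : 0 < n%:R :> R by rewrite ltr0n.
have kp : 0 < k%:R :> R by rewrite ltr0n.
have k1 : 1 <= k%:R :> R by rewrite ler1n.
have pp : 1 < p by apply: le_lt_trans p1; rewrite lerDl invr_ge0.
have cf : continuous f.
  by move=> x; apply/differentiable_continuous/derivable1_diffP; exact: df.
have mf := continuous_measurable_fun cf.
(* A nonnegative constant is wanted from here on. *)
pose C := `|C'|; have C0 : 0 <= C by exact: normr_ge0.
have flip xi eta : `|f xi - f eta| <=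
    C * (powR `|xi| (p - 1) + powR `|eta| (p - 1)) * `|xi - eta|.
  apply: le_trans (flip' xi eta) _; apply: ler_wpM2r => //.
  by apply: ler_wpM2r; [rewrite addr_ge0 ?powR_ge0|exact: ler_norm].
have sig0 : 0 < sigma_exp n p.
  have : 1 < (p - 1) * n%:R by rewrite -ltr_pdivrMr// mul1r; move: p1; lra.
  by rewrite /sigma_exp; lra.
(* The upper bound on p reads (p - 1) k n < k + 1, which is k sigma < 1/2. *)
have ksig : k%:R * sigma_exp n p < 2^-1.
  have : (p - 1) * (k%:R * n%:R) < k.+1%:R by rewrite -ltr_pdivlMr ?mulr_gt0//; move: p2; lra.
  by rewrite /sigma_exp -[k.+1%:R]natr1; lra.
have sig1 : sigma_exp n p < 2^-1.
  by apply: le_lt_trans ksig; rewrite ler_peMl// ltW.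
have [M0 u0A] := in_L1_L1le u011.1.
have [M1 u0M] := first_moment u011.
have [K [M [U [V [K0 HM uV]]]]] := solution_mild mf f0 pp flip u011.1 sol.
have L0 : 0 <= `|C| * (2 * powR K (p - 1)) by rewrite !mulr_ge0 ?powR_ge0.
have lip := lip_local pp K0 flip.
have [c1 c10 hc1] := mild_decay n0 cf f0 K0 L0 lip p1 C0 flip u0A HM.
have jU := mild_jU HM; have UL := mild_UL HM; have Ud := mild_duhamel cf HM.
have [c c0 hc] := profile_rate mf f0 C0 pp c10 flip sig0 sig1 u0A u0M jU UL hc1 Ud k0 ksig.
have uU t : 0 < t -> {ae leb R n, forall x, u t x = U t x}.
  by move=> t0; exact: ae_trans (uV t t0) (mild_ae HM t0).
(* c may vanish, while the final constant and the bounds passed to [Lq_le] have to be positive. *)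
have Cp : 0 < c + 1 by rewrite ltr_wpDl.
exists (c + 1) => // t tk.
have t1 : 1 < t by apply: le_lt_trans tk; rewrite exprn_ege1// ler1n.
have t0 : 0 < t by lra.
set ga := k.+1%:R * sigma_exp n p.
have rp : 0 < rate ga t.
  rewrite /rate; case: ifP => _; first exact: powR_gt0.
  by case: ifP => _; rewrite ?mulr_gt0 ?powR_gt0// ln_gt0//; lra.
have -> : (if ga < 2^-1 then (c + 1) * powR t (- ga) else if ga == 2^-1
    then (c + 1) * powR t (- 2^-1) * ln (2 + t) else (c + 1) * powR t (- 2^-1)) =
    (c + 1) * rate ga t.
  by rewrite /rate; case: ifP => // _; case: ifP => // _; rewrite mulrA.
have Pp : 0 < powR t (- (n%:R / 2)) by exact: powR_gt0.
have Ap : 0 < (c + 1) * rate ga t by rewrite mulr_gt0.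
have cA : c * rate ga t <= (c + 1) * rate ga t by rewrite ler_pM2r// lerDl.
have [h1 h2] := hc t (ltW t1).
have mu_t : measurable_fun [set: Rn R n] (u t).
  by have [/borel_funP] := sol.1 t (ltW t0).
have mA := jmeas_at t (jmeas_profile a u0 mf k).
have eA : A0k a f u0 k t = profile a f u0 k t.
  exact: (A0kE mf f0 C0 pp c10 flip sig0 sig1 u0A u0M jU UL hc1 Ud ksig (ltW t1)).
have L : (Lq_norm q ((u t \- A0k a f u0 k t)%R) <=
    (powR (powR t (- (n%:R / 2))) (1 - inv_exp q) * ((c + 1) * rate ga t))%:E)%E.
  rewrite eA.
  apply: (Lq_le (h := fun x => U t x - profile a f u0 k t x) q1 Ap Pp).
  - exact: measurable_funB.
  - by apply: (ae_imp (uU t t0)) => x /= ->.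
  - exact: L1le_trans cA h1.
  - move=> x; apply: le_trans (h2 x) _; apply: ler_wpM2l => //; exact: ltW.
have e0 : (0 <= (powR t (n%:R / 2 * (1 - inv_exp q)))%:E)%E by rewrite lee_fin powR_ge0.
apply: le_trans (lee_wpmul2l e0 L) _.
(* The two powers of t have opposite exponents, so their product is t^0. *)
rewrite -EFinM lee_fin -powRrM mulrA.
rewrite (@powR_DE _ t _ _ 0)//; last by ring.
by rewrite powRr0 mul1r.
Qed.
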